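(* Let $A$ be a $\sigma$-unital $C_0(X)$-algebra with base map $\phi$, and suppose that $\phi$ is the complete regularization map for $\mathrm{Prim}(A)$ and that $\mathrm{Orc}(A)<\infty$. Let $E$ be a non-empty closed subset of $X_\phi$ and suppose that $J_E$ is locally modular. Then $\phi$ is locally closed at $E$ and $H_E$ is strictly closed in $M(A)$.
   Context: For a C$^*$-algebra $A$, $\mathrm{Prim}(A)$ is the primitive ideal space with the hull-kernel topology and $M(A)$ is the multiplier algebra. $A$ is a $C_0(X)$-algebra with base map $\phi$ if $X$ is a locally compact Hausdorff space and $\phi:\mathrm{Prim}(A)\to X$ is continuous; $X_\phi$ denotes the image of $\phi$ with the subspace topology. For a closed two-sided ideal $J$ of $A$, $\tilde J=\{b\in M(A): ba,ab\in J \text{ for all } a\in A\}$. If $P\in\mathrm{Prim}(A)$ then $\tilde P\in\mathrm{Prim}(M(A))$, and $P\mapsto\tilde P$ is a homeomorphism onto a dense open subset of $\mathrm{Prim}(M(A))$. The map $\phi$ has a unique extension to a continuous map $\overline\phi:\mathrm{Prim}(M(A))\to\beta X$ (the Stone-Čech compactification) with $\overline\phi(\tilde P)=\phi(P)$ for all $P\in\mathrm{Prim}(A)$. ''Strictly closed'' means closed in the strict topology of $M(A)$. For a closed subset $E$ of $X_\phi$, $J_E=\bigcap\{P\in\mathrm{Prim}(A):\phi(P)\in E\}$ and $H_E=\bigcap\{Q\in\mathrm{Prim}(M(A)):\overline\phi(Q)\in E\}$. Let $H(E)=\phi^{-1}(E)$, with boundary $\partial H(E)$ and interior $U(E)$ in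 $\mathrm{Prim}(A)$. $J_E$ is locally modular if for each $P\in\partial H(E)$ there is a relatively open neighbourhood $V$ of $P$ in $\mathrm{Prim}(A)\setminus U(E)$ such that $A/\ker V$ is unital, where $\ker V=\bigcap_{Q\in V}Q$. The map $\phi$ is locally closed at $E$ if whenever $Y$ is a closed subset of $\mathrm{Prim}(A)$ with $\phi(Y)\cap E=\emptyset$, then the closure of $\phi(Y)$ in $X_\phi$ does not meet $E$. Complete regularization: identify $P,Q\in\mathrm{Prim}(A)$ when $f(P)=f(Q)$ for all bounded continuous real-valued $f$ on $\mathrm{Prim}(A)$; the quotient set, with the weakest topology making all functions induced by such $f$ continuous, is a completely regular Hausdorff space, and the quotient map is the complete regularization map $\phi_A$. Saying $\phi$ is the complete regularization map means that $\phi=\phi_A$ with $X_\phi$ being this space (and $X$ may be taken to be $X_\phi$ if it is locally compact, or $\beta X_\phi$). Connecting order: for $P,Q\in\mathrm{Prim}(A)$ write $P\sim Q$ if $P$ and $Q$ cannot be separated by disjoint open subsets of $\mathrm{Prim}(A)$. View $\mathrm{Prim}(A)$ as a graph with $P,Q$ adjacent if $P\sim Q$; $d_A(P,Q)$ is the length of a shortest path from $P$ to $Q$ ($\infty$ if none exists). The diameter of a $\sim$-component (connected component of the graph) is the supremum of the distances between its points, with the convention that a singleton component has diameter $1$. $\mathrm{Orc}(A)\in\{1,2,\dots,\infty\}$ is the supremum of the diameters of the $\sim$-components. *)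

(* Defs.v *)
From HB Require Import structures.
From mathcomp Require Import all_boot all_order all_algebra complex.
From mathcomp Require Import all_classical all_reals all_analysis.
Import numFieldNormedType.Exports.

Set Implicit Arguments.
Unset Strict Implicit.
Unset Printing Implicit Defensive.

Import Order.TTheory GRing.Theory Num.Theory.
Local Open Scope classical_set_scope.
Local Open Scope ring_scope.

(* MathComp rings are unital, so the (possibly non-unital) product is an
   operation on a complex vector space. *)
HB.mixin Record Lmodule_isStarAlgebra (R : realType) A
    of GRing.Lmodule R[i] A := {
  smul : A -> A -> A;
  adj : A -> A;
  smulA : associative smul;
  smulDl : left_distributive smul +%R;
  smulDr : right_distributive smul +%R;
  smulZl : forall (c : R[i]) a b, smul (c *: a) b = c *: smul a b;
  smulZr : forall (c : R[i]) a b, smul a (c *: b) = c *: smul a b;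
  adjD : forall a b, adj (a + b) = adj a + adj b;
  adjZ : forall (c : R[i]) a, adj (c *: a) = c^* *: adj a;
  adjM : forall a b, adj (smul a b) = smul (adj b) (adj a);
  adjK : involutive adj
}.

#[short(type="starAlgType")]
HB.structure Definition StarAlgebra (R : realType) :=
  {A of Lmodule_isStarAlgebra R A & GRing.Lmodule R[i] A}.

Notation "a ** b" := (smul a b) (at level 40, left associativity) : ring_scope.

HB.mixin Record StarAlgebra_isCstar (R : realType) A
    of CompleteNormedModule R[i] A & StarAlgebra R A := {
  norm_smul_le : forall a b : A, `|a ** b| <= `|a| * `|b|;
  cstar_identity : forall a : A, `|adj a ** a| = `|a| ^+ 2
}.

#[short(type="cstarAlgType")]
HB.structure Definition CstarAlgebra (R : realType) :=
  {A of StarAlgebra_isCstar R A & CompleteNormedModule R[i] A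
      & StarAlgebra R A}.

Section Representation.
Context {R : realType} {H : completeNormedModType R[i]}.

(* A Hilbert space is a Banach space whose norm comes from an inner product. *)
Definition is_inner_product (ip : H -> H -> R[i]) :=
  [/\ forall (c : R[i]) x y z, ip (c *: x + y) z = c * ip x z + ip y z,
      forall x y, ip y x = (ip x y)^*
    & forall x, ip x x = `|x| ^+ 2].

Definition closed_linear_subspace (K : set H) :=
  [/\ K 0, forall (c : R[i]) x y, K x -> K y -> K (c *: x + y) & closed K].

Context {A : starAlgType R}.

Definition is_representation (ip : H -> H -> R[i]) (pi : A -> H -> H) :=
  [/\ forall a, linear (pi a) /\ continuous (pi a),
      forall x (c : R[i]) a b, pi (c *: a + b) x = c *: pi a x + pi b x,
      forall a b x, pi (a ** b) x = pi a (pi b x)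
    & forall a x y, ip (pi a x) y = ip x (pi (adj a) y)].

Definition irreducible_representation (pi : A -> H -> H) :=
  (exists a x, pi a x != 0) /\
  (forall K : set H, closed_linear_subspace K ->
    (forall a x, K x -> K (pi a x)) -> K = [set 0] \/ K = setT).

End Representation.

Definition primitive {R : realType} (A : starAlgType R) : set (set A) :=
  [set P | exists (H : completeNormedModType R[i]) (ip : H -> H -> R[i])
             (pi : A -> H -> H),
    [/\ is_inner_product ip, is_representation ip pi,
        irreducible_representation pi
      & P = [set a | forall x, pi a x = 0] ] ].

Section PrimitiveTheory.
Context {R : realType} {A : starAlgType R}.
Implicit Types P : set A.

Lemma primitive_proper P : primitive P -> P <> setT.
Proof.
move=> [H [ip [pi [_ _ [[a [x pax]] _] ->]]]] PT.
have /(_ x) : [set a | forall x, pi a x = 0] a by rewrite PT.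
by move/eqP; rewrite (negbTE pax).
Qed.

Lemma primitive_prime P a b :
  primitive P -> (forall c, P (a ** c ** b)) -> P a \/ P b.
Proof.
move=> [H [ip [pi [[ipl ipC ipn] [pilc pila piM piadj] [pin0 irr] ->]]]] /= Pacb.
have pil c := (pilc c).1; have pic c := (pilc c).2.
have pi0 c : pi c 0 = 0.
  by have := pil c (-1) 0 0; rewrite scaleN1r oppr0 addr0 scaleN1r addNr.
have ip0 y : ip 0 y = 0.
  have := ipl (-1) 0 0 y.
  by rewrite scaleN1r oppr0 addr0 mulN1r addNr.
have closedker c : closed [set x | pi c x = 0].
  have -> : [set x | pi c x = 0] = pi c @^-1` [set 0] by [].
  apply: preimage_closed => [? _|]; first exact: pic.
  exact/accessible_closed_set1/hausdorff_accessible/norm_hausdorff.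
pose N := [set x : H | forall c, pi c x = 0].
have N0 : N = [set 0].
  have [|c x Nx d|//|NT] := irr N.
  - split=> [c|k x y Nx Ny c|]; first exact: pi0.
      by rewrite pil Nx Ny scaler0 addr0.
    have -> : N = \bigcap_c [set x | pi c x = 0].
      by apply/seteqP; split=> [x Nx c _|x Nx c]; [exact: Nx|exact: (Nx c I)].
    by apply: closed_bigI => c _; exact: closedker.
  - by rewrite Nx pi0.
  - have [c [x /eqP]] := pin0; have : N x by rewrite NT.
    by move=> ->.
pose K := [set x : H | forall c, pi a (pi c x) = 0].
have [|c x Kx d|K0|KT] := irr K.
- split=> [c|k x y Kx Ky c|]; first by rewrite !pi0.
    by rewrite pil pil Kx Ky scaler0 addr0.
  have -> : K = \bigcap_c [set x | pi (a ** c) x = 0].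
    apply/seteqP; split=> [x Kx c _ /=|x Kx c]; first by rewrite piM.
    by rewrite -piM; exact: (Kx c I).
  by apply: closed_bigI => c _; exact: closedker.
- by rewrite -(piM d c).
- right=> x; suff : K (pi b x) by rewrite K0.
  by move=> c; rewrite -!piM.
- have ipr0 y : ip y 0 = 0 by rewrite ipC ip0 conjC0.
  have def0 y : ip y y = 0 -> y = 0.
    by rewrite ipn => /eqP; rewrite sqrf_eq0 normr_eq0 => /eqP.
  have KE z : K z by rewrite KT.
  left=> x; suff adj0 y : pi (adj a) y = 0 by apply: def0; rewrite piadj adj0.
  suff : N (pi (adj a) y) by rewrite N0.
  by move=> c; apply: def0; rewrite piadj piadj adjK KE.
Qed.

End PrimitiveTheory.

Definition Prim {R : realType} (A : starAlgType R) : Type :=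
  set_type (@primitive R A).

Section HullKernel.
Context {R : realType} {A : starAlgType R}.

Definition ideal_of (P : Prim A) : set A := set_val P.

(* [ker set0] is the whole algebra. *)
Definition ker (F : set (Prim A)) : set A := \bigcap_(P in F) ideal_of P.

Definition hull (J : set A) : set (Prim A) := [set P | J `<=` ideal_of P].

Definition hull_kernel_open (U : set (Prim A)) := hull (ker (~` U)) `<=` ~` U.

Lemma ideal_of_primitive (P : Prim A) : primitive (ideal_of P).
Proof. exact: set_valP. Qed.

Lemma hull_kernel_openT : hull_kernel_open setT.
Proof.
move=> P; rewrite setCT => hP; exfalso.
apply: (primitive_proper (ideal_of_primitive P)).
by apply/seteqP; split=> // a _; apply: hP.
Qed.

Lemma hull_kernel_openI : setI_closed hull_kernel_open.
Proof.
move=> U V oU oV P hP [UP VP].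
have /existsNP[a /not_implyP[ka nPa]] : ~ hull (ker (~` U)) P by move=> /oU.
have /existsNP[b /not_implyP[kb nPb]] : ~ hull (ker (~` V)) P by move=> /oV.
have [c|//|//] := primitive_prime (a := a) (b := b) (ideal_of_primitive P).
apply: hP => Q; rewrite setCI.
have [H [ip [pi [_ [pil _ piM _] _ QE]]]] := ideal_of_primitive Q.
have pi0 d : pi d 0 = 0.
  by have := (pil d).1 (-1) 0 0; rewrite scaleN1r oppr0 addr0 scaleN1r addNr.
move=> [nU|nV]; rewrite QE /= => x; rewrite !piM.
  by have := ka _ nU; rewrite QE /= => ->.
by have := kb _ nV; rewrite QE /= => ->; rewrite !pi0.
Qed.

Lemma hull_kernel_open_bigU (I : Type) (f : I -> set (Prim A)) :
  (forall i, hull_kernel_open (f i)) -> hull_kernel_open (\bigcup_i f i).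
Proof.
move=> fo P hP [i _ fiP]; apply: (fo i P) => // a ka; apply: hP => Q nQ.
by apply: ka => fiQ; apply: nQ; exists i.
Qed.

HB.instance Definition _ := Choice.on (Prim A).
HB.instance Definition _ := isOpenTopological.Build (Prim A)
  hull_kernel_openT hull_kernel_openI hull_kernel_open_bigU.

End HullKernel.

Section Multiplier.
Context {R : realType} {A : cstarAlgType R}.
Implicit Types (T : (A -> A) * (A -> A)) (a b : A).

(* [T.1] is left multiplication and [T.2] right multiplication by the
   multiplier. *)
Definition double_centralizer T :=
  [/\ linear T.1 /\ continuous T.1, linear T.2 /\ continuous T.2
    & forall a b, a ** T.1 b = T.2 a ** b].

Definition double_centralizers : {pred (A -> A) * (A -> A)} :=
  fun T => `[< double_centralizer T >].

Lemma norm_adj a : `|adj a| = `|a|.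
Proof.
have le b : `|b| <= `|adj b|.
  have [->|b0] := eqVneq b 0; first by rewrite normr0.
  rewrite -(ler_pM2r (x := `|b|)) ?normr_gt0 // -expr2 -cstar_identity.
  exact: norm_smul_le.
by apply/eqP; rewrite eq_le le andbT -{2}(adjK a) le.
Qed.

Lemma adjB a b : adj (a - b) = adj a - adj b.
Proof. by rewrite adjD -scaleN1r adjZ rmorphN1 scaleN1r. Qed.

Lemma continuous_adj : continuous (adj : A -> A).
Proof.
move=> a; apply/cvgrPdist_lt => e e0; near=> b.
by rewrite -adjB norm_adj; near: b; apply: cvgr_dist_lt.
Unshelve. all: by end_near. Qed.

Lemma double_centralizers_submod : submod_closed double_centralizers.
Proof.
have smul0 a : a ** 0 = 0 by rewrite -(scale0r (0 : A)) smulZr !scale0r.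
have smul0l a : 0 ** a = 0 by rewrite -(scale0r (0 : A)) smulZl !scale0r.
split.
  apply/asboolP; split=> [||a b]; last by rewrite smul0 smul0l.
  - by split=> [c x y /=|x]; [rewrite scaler0 addr0|exact: cvg_cst].
  - by split=> [c x y /=|x]; [rewrite scaler0 addr0|exact: cvg_cst].
move=> c S T /asboolP[[S1l S1c] [S2l S2c] SE] /asboolP[[T1l T1c] [T2l T2c] TE].
have E1 x : (c *: S + T).1 x = c *: S.1 x + T.1 x by [].
have E2 x : (c *: S + T).2 x = c *: S.2 x + T.2 x by [].
apply/asboolP; split.
- split=> [k x y|x].
    by rewrite !E1 S1l T1l !scalerDr !scalerA [k * c]mulrC addrACA.
  by apply: cvgD; [apply: cvgZr; exact: S1c|exact: T1c].
- split=> [k x y|x].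
    by rewrite !E2 S2l T2l !scalerDr !scalerA [k * c]mulrC addrACA.
  by apply: cvgD; [apply: cvgZr; exact: S2c|exact: T2c].
- by move=> a b; rewrite E1 E2 smulDr smulDl smulZr smulZl SE TE.
Qed.

HB.instance Definition _ := GRing.isSubmodClosed.Build R[i]
  ((A -> A) * (A -> A))%type double_centralizers double_centralizers_submod.

End Multiplier.

Section MultiplierType.
Context {R : realType} (A : cstarAlgType R).

Record multiplier := Multiplier {
  centralizers :> (A -> A) * (A -> A);
  centralizersP : centralizers \in double_centralizers }.

HB.instance Definition _ := [isSub for centralizers].
HB.instance Definition _ := [Choice of multiplier by <:].
HB.instance Definition _ :=
  [SubChoice_isSubLmodule of multiplier by <:].

Lemma multiplierP (m : multiplier) : double_centralizer m.
Proof. by case: m => T /= /asboolP. Qed.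

Lemma multiplier_mul_subproof (m n : multiplier) :
  (m.1 \o n.1, n.2 \o m.2) \in double_centralizers.
Proof.
have [[m1l m1c] [m2l m2c] mE] := multiplierP m.
have [[n1l n1c] [n2l n2c] nE] := multiplierP n.
apply/asboolP; split=> /= [||a b]; last by rewrite mE nE.
- split=> [c x y /=|x]; first by rewrite n1l m1l.
  by apply: continuous_comp; [exact: n1c|exact: m1c].
- split=> [c x y /=|x]; first by rewrite m2l n2l.
  by apply: continuous_comp; [exact: m2c|exact: n2c].
Qed.

Definition multiplier_mul (m n : multiplier) :=
  Multiplier (multiplier_mul_subproof m n).

Lemma multiplier_adj_subproof (m : multiplier) :
  (adj \o m.2 \o adj, adj \o m.1 \o adj) \in double_centralizers.
Proof.
have [[m1l m1c] [m2l m2c] mE] := multiplierP m.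
have cadj : continuous (adj : A -> A) := continuous_adj.
apply/asboolP; split=> /= [||a b].
- split=> [c x y /=|x]; first by rewrite adjD adjZ m2l adjD adjZ conjCK.
  apply: (@continuous_comp _ _ _ (m.2 \o adj) adj); last exact: cadj.
  by apply: continuous_comp; [exact: cadj|exact: m2c].
- split=> [c x y /=|x]; first by rewrite adjD adjZ m1l adjD adjZ conjCK.
  apply: (@continuous_comp _ _ _ (m.1 \o adj) adj); last exact: cadj.
  by apply: continuous_comp; [exact: cadj|exact: m1c].
- by apply: (can_inj adjK); rewrite !adjM !adjK mE.
Qed.

Definition multiplier_adj (m : multiplier) :=
  Multiplier (multiplier_adj_subproof m).

Lemma multiplier_eq (m n : multiplier) :
  (forall a, m.1 a = n.1 a) -> (forall a, m.2 a = n.2 a) -> m = n.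
Proof.
move=> e1 e2; apply: val_inj; rewrite [LHS]surjective_pairing.
by rewrite [RHS]surjective_pairing; congr pair; apply/funext.
Qed.

Fact multiplier_mulA : associative multiplier_mul.
Proof. by move=> l m n; exact: multiplier_eq. Qed.

Fact multiplier_mulDl : left_distributive multiplier_mul +%R.
Proof.
move=> l m n; apply: multiplier_eq => a //=.
have [_ [n2l _] _] := multiplierP n.
by have := n2l 1 (l.2 a) (m.2 a); rewrite !scale1r.
Qed.

Fact multiplier_mulDr : right_distributive multiplier_mul +%R.
Proof.
move=> l m n; apply: multiplier_eq => a //=.
have [[l1l _] _ _] := multiplierP l.
by have := l1l 1 (m.1 a) (n.1 a); rewrite !scale1r.
Qed.

Fact linear_scale (f : A -> A) (c : R[i]) a : linear f -> f (c *: a) = c *: f a.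
Proof.
move=> fl; have f0 : f 0 = 0.
  by have := fl (-1) 0 0; rewrite scaleN1r oppr0 addr0 scaleN1r addNr.
by have := fl c a 0; rewrite f0 !addr0.
Qed.

Fact multiplier_mulZl (c : R[i]) m n :
  multiplier_mul (c *: m) n = c *: multiplier_mul m n.
Proof.
apply: multiplier_eq => a //=.
have [_ [n2l _] _] := multiplierP n.
exact: linear_scale.
Qed.

Fact multiplier_mulZr (c : R[i]) m n :
  multiplier_mul m (c *: n) = c *: multiplier_mul m n.
Proof.
apply: multiplier_eq => a //=.
have [[m1l _] _ _] := multiplierP m.
exact: linear_scale.
Qed.

Fact multiplier_adjD m n :
  multiplier_adj (m + n) = multiplier_adj m + multiplier_adj n.
Proof. by apply: multiplier_eq => a /=; rewrite adjD. Qed.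

Fact multiplier_adjZ (c : R[i]) m :
  multiplier_adj (c *: m) = c^* *: multiplier_adj m.
Proof. by apply: multiplier_eq => a /=; rewrite adjZ. Qed.

Fact multiplier_adjM m n : multiplier_adj (multiplier_mul m n) =
  multiplier_mul (multiplier_adj n) (multiplier_adj m).
Proof. by apply: multiplier_eq => a /=; rewrite adjK. Qed.

Fact multiplier_adjK : involutive multiplier_adj.
Proof. by move=> m; apply: multiplier_eq => a /=; rewrite !adjK. Qed.

(* The C*-norm of M(A), i.e. the operator norm of either centralizer, is
   determined by the *-algebra structure, and neither Prim(M(A)) nor the strict
   topology refers to it. *)
HB.instance Definition _ := Lmodule_isStarAlgebra.Build R multiplier
  multiplier_mulA multiplier_mulDl multiplier_mulDr multiplier_mulZl
  multiplier_mulZr multiplier_adjD multiplier_adjZ multiplier_adjM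
  multiplier_adjK.

End MultiplierType.

Section Strict.
Context {R : realType} {A : cstarAlgType R}.

Definition tilde (J : set A) : set (multiplier A) :=
  [set b | forall a, J (b.1 a) /\ J (b.2 a)].

(* The strict topology is generated by the seminorms |ba| and |ab| for a in A:
   pointwise norm convergence of both centralizers. *)
Definition strict_topology : Type :=
  initial_topology (fun b : multiplier A =>
    (b.1, b.2) : {ptws A -> A} * {ptws A -> A}).

HB.instance Definition _ := Topological.on strict_topology.

Definition strictly_closed (S : set (multiplier A)) :=
  closed (S : set strict_topology).

End Strict.

Definition positive_elt {R : realType} {A : cstarAlgType R} (a : A) :=
  exists b : A, a = adj b ** b.

(* A has a countable (increasing, contractive) approximate unit. *)
Definition sigma_unital {R : realType} (A : cstarAlgType R) :=
  exists u : nat -> A,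
    [/\ forall n, positive_elt (u n) /\ `|u n| <= 1,
        forall n, positive_elt (u n.+1 - u n)
      & forall a, (u n ** a) @[n --> \oo] --> a /\
                  (a ** u n) @[n --> \oo] --> a].

Section StoneCech.
Context (R : realType) (X : topologicalType).

Definition unit_interval_maps : set (X -> R) :=
  [set f : _ -> R | continuous f /\ forall x, 0 <= f x <= 1].

Definition stone_cech_eval (x : X) : {ptws unit_interval_maps -> R} :=
  fun f => set_val f x.

(* The closure of the image of X in the cube indexed by the continuous maps
   from X to [0, 1]. *)
Definition stone_cech : Type := set_type (closure (range stone_cech_eval)).

HB.instance Definition _ := Topological.on stone_cech.

Lemma stone_cech_in_subproof (x : X) :
  stone_cech_eval x \in closure (range stone_cech_eval).
Proof. by apply/mem_set/subset_closure; exists x. Qed.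

Definition stone_cech_in (x : X) : stone_cech :=
  exist (fun y => y \in closure (range stone_cech_eval)) _
    (stone_cech_in_subproof x).

End StoneCech.

Section CompleteRegularization.
Context (R : realType) (T : topologicalType).

Definition bounded_continuous : set (T -> R) :=
  [set f : _ -> R | continuous f /\ exists M, forall x, `|f x| <= M].

Definition cr_rel (x y : T) : bool :=
  `[< forall f, bounded_continuous f -> f x = f y >].

Lemma cr_rel_refl : reflexive cr_rel.
Proof. by move=> x; apply/asboolP. Qed.

Lemma cr_rel_sym : symmetric cr_rel.
Proof.
by move=> x y; apply/idP/idP => /asboolP e; apply/asboolP => f /e ->.
Qed.

Lemma cr_rel_trans : transitive cr_rel.
Proof.
move=> y x z /asboolP e1 /asboolP e2; apply/asboolP => f bf.
by rewrite e1// e2.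
Qed.

Canonical cr_equiv := EquivRel cr_rel cr_rel_refl cr_rel_sym cr_rel_trans.

Definition cr_quotient : Type := {eq_quot cr_equiv}%qT.
HB.instance Definition _ := Choice.on cr_quotient.
HB.instance Definition _ := Quotient.on cr_quotient.

(* [repr q] is a representative of the class [q]: bounded continuous functions
   are constant on classes. *)
Definition cr_eval (q : cr_quotient) : {ptws bounded_continuous -> R} :=
  fun f => set_val f (repr q).

Definition cr_space : Type := initial_topology cr_eval.
HB.instance Definition _ := Topological.on cr_space.

Definition cr_map (x : T) : cr_space := \pi_cr_quotient%qT x.

End CompleteRegularization.

Definition topological_embedding {S T : topologicalType} (h : S -> T) :=
  injective h /\
  forall U : set S, open U <-> exists2 V, open V & U = h @^-1` V.

(* phi is cr_map once the image of phi, with the subspace topology, is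
   identified with the complete regularization of its domain. *)
Definition is_complete_regularization (R : realType) {T X : topologicalType}
    (phi : T -> X) :=
  exists2 h : cr_space R T -> X,
    topological_embedding h & phi = h \o @cr_map R T.

Definition closed_in {X : topologicalType} (Y E : set X) :=
  exists2 F, closed F & E = Y `&` F.

Section Orc.
Context (R : realType) {T : topologicalType}.

Definition inseparable (x y : T) :=
  ~ exists U V, [/\ open U, open V, U x, V y & U `&` V = set0].

Definition sim_path (x y : T) : set (seq T) :=
  [set s | path (fun u v => `[< inseparable u v >]) x s /\ last x s = y].

Definition sim_dist (x y : T) : \bar R :=
  ereal_inf [set ((size s)%:R%:E)%E | s in sim_path x y].

Definition sim_component (x : T) : set T := [set y | sim_path x y !=set0].

Definition sim_diameter (C : set T) : \bar R :=
  if `[< exists x, C = [set x] >] then 1%E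
  else ereal_sup [set sim_dist p.1 p.2 | p in C `*` C].

End Orc.

Definition Orc {R : realType} (A : starAlgType R) : \bar R :=
  ereal_sup [set sim_diameter R (sim_component P) | P in [set: Prim A]].

Section BaseMap.
Context {R : realType} {A : cstarAlgType R} {X : topologicalType}.
Variable phi : Prim A -> X.
Implicit Types E : set X.

(* Existence and uniqueness of the extension are standard; multipliers [Q] of
   the form [tilde P] are identified through their underlying ideals. *)
Definition extends_base_map (phibar : Prim (multiplier A) -> stone_cech R X) :=
  continuous phibar /\
  forall (P : Prim A) (Q : Prim (multiplier A)),
    ideal_of Q = tilde (ideal_of P) -> phibar Q = stone_cech_in R (phi P).

Definition J_ideal E : set A := ker (phi @^-1` E).

Definition H_ideal (phibar : Prim (multiplier A) -> stone_cech R X) E :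
    set (multiplier A) :=
  ker (phibar @^-1` (@stone_cech_in R X @` E)).

(* The quotient of A by the ideal J has a unit element. *)
Definition unital_quotient (J : set A) :=
  exists e : A, forall a, J (e ** a - a) /\ J (a ** e - a).

(* Local modularity of [J_ideal E], a condition on phi and E. *)
Definition locally_modular E :=
  let HE := phi @^-1` E in
  let U := interior HE in
  forall P, (closure HE `\` U) P ->
    exists2 W, open W /\ W P & unital_quotient (ker (W `\` U)).

Definition locally_closed_at E :=
  forall Y : set (Prim A), closed Y -> (phi @` Y) `&` E = set0 ->
    (closure (phi @` Y) `&` range phi) `&` E = set0.

End BaseMap.

(* Main.v *)
(* Let H be the preimage of E under phi, and U its interior.

   Local modularity makes every boundary point of H interior to the union of U
   with a compact closed set (the hull of an ideal with unital quotient), because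
   the ideals ker F, for F in a decreasing family of closed sets, exhaust the
   kernel of the intersection up to closure.  By the same argument closed subsets
   of Prim(A) are Lindelof when A is sigma-unital.  Hence, as in a regular
   Lindelof space, a set that is saturated for ~ and closed can be separated from
   disjoint closed sets near H.  Since Orc(A) is finite, iterating the passage to
   ~-neighbours finitely often saturates any set, so Urysohn's construction can
   be run with saturated sets: it gives, for Y closed and disjoint from H, a
   continuous function vanishing on H and equal to 1 on Y.  Such a function
   factors through the complete regularization phi, so the closure of phi(Y) does
   not meet E.

   The inclusion of H_E in the strictly closed ideal tilde(J_E) only uses that
   tilde(P) is primitive.  For the converse let b be in tilde(J_E), h = b* b, and
   Q = ker s with phibar(Q) in E.  The norm of h at P is upper semicontinuous on
   H, so it exceeds d only on a set whose closure Y misses H.  As phi is locally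
   closed at E, there is an ideal K of M(A), not contained in Q, of multipliers
   vanishing on Y, so |h n| <= d |n| on K.  Since the sequence |s(h^j n) y| is
   log-convex and at most d^j |n| |y|, we get |s(h) z| <= d |z| for z = s(n) y;
   such vectors are dense, and d is arbitrary. *)

(* [Prim A] is not Hausdorff: a point inseparable from a point of [B] lies in the closure of every
   open set around [B]. So an open set whose closure fits between [B] and an open [V] requires [V]
   to contain all such points, and each further interpolation requires one more ~-step. With paths
   bounded by [k], asking that [iter k nbr B] lie in [V] is stable under interpolation, because that
   set is saturated. Its closedness is the second obstacle: [nbr] preserves closed sets only where
   points can be separated locally from closed sets. This confines the construction to a
   neighbourhood of H on which compactness is available.

   On the algebraic side [A] may lack a unit and [multiplier A] has no norm structure. States and
   positivity are therefore developed for a unital *-algebra with a C*-norm given as a predicate,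
   then used on the multipliers, whose irreducible representations are restricted to [A]. No
   quotient algebra is formed: an ideal enters only as a condition on bounds and functionals. *)
Require Import Defs.
From HB Require Import structures.
From mathcomp Require Import all_boot all_order all_algebra complex.
From mathcomp Require Import all_classical all_reals all_analysis.
From mathcomp Require Import ring lra.
Import numFieldNormedType.Exports.
Import Order.TTheory GRing.Theory Num.Theory.
Import Defs.
Set Implicit Arguments.
Unset Strict Implicit.
Unset Printing Implicit Defensive.
Local Open Scope classical_set_scope.
Local Open Scope ring_scope.
Local Open Scope complex_scope.

(** * Linear combinations *)

Section LinearCombinations.
Context {K : comNzRingType} {V : lmodType K}.

Inductive lincomb :=
| LVar of nat | LZero | LAdd of lincomb & lincomb | LOpp of lincomb
| LScale of K & lincomb.

(** Elaborating [lc_scalars l] makes unification find the scalar ring of the module containing [l];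
    [lincomb_coefs] reads it off from there. *)
Definition lc_scalars of V := K.

Fixpoint lc_eval (env : seq V) e : V :=
  match e with
  | LVar n => nth 0 env n
  | LZero => 0
  | LAdd a b => lc_eval env a + lc_eval env b
  | LOpp a => - lc_eval env a
  | LScale c a => c *: lc_eval env a
  end.

Fixpoint lc_coef e (n : nat) : K :=
  match e with
  | LVar m => if m == n then 1 else 0
  | LZero => 0
  | LAdd a b => lc_coef a n + lc_coef b n
  | LOpp a => - lc_coef a n
  | LScale c a => c * lc_coef a n
  end.

Lemma lc_evalE env e :
  lc_eval env e = \sum_(i < size env) lc_coef e i *: env`_i.
Proof.
elim: e => [m||a IHa b IHb|a IHa|c a IHa] /=; rewrite ?IHa ?IHb.
- have [mlt|mge] := ltnP m (size env).
    rewrite (bigD1 (Ordinal mlt)) //= eqxx scale1r big1 ?addr0// => i.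
    by rewrite -val_eqE /= eq_sym => /negPf ->; rewrite scale0r.
  rewrite nth_default// big1// => i _.
  have /negPf -> : m != i; last by rewrite scale0r.
  by apply: contraTneq (ltn_ord i) => <-; rewrite -leqNgt.
- by rewrite big1// => i _; rewrite scale0r.
- by rewrite -big_split; apply: eq_bigr => i _; rewrite scalerDl.
- by rewrite -sumrN; apply: eq_bigr => i _; rewrite scaleNr.
- by rewrite scaler_sumr; apply: eq_bigr => i _; rewrite scalerA.
Qed.

Fixpoint lc_same e1 e2 n : Prop :=
  if n is m.+1 then lc_coef e1 m = lc_coef e2 m /\ lc_same e1 e2 m else True.

Lemma lc_eq env e1 e2 :
  lc_same e1 e2 (size env) -> lc_eval env e1 = lc_eval env e2.
Proof.
rewrite !lc_evalE => same; apply: eq_bigr => i _; congr (_ *: _).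
elim: (size env) same i => [_ []//|n IHn /= [en same] i].
have [->//|ni] := eqVneq (i : nat) n.
have ilt : (i < n)%N by rewrite ltn_neqAle ni -ltnS ltn_ord.
exact: (IHn same (Ordinal ilt)).
Qed.

End LinearCombinations.

Ltac lc_index x env :=
  lazymatch env with
  | x :: _ => constr:(O)
  | _ :: ?r => let n := lc_index x r in constr:(S n)
  end.
Ltac lc_insert x env :=
  lazymatch env with
  | context [cons x _] => env
  | _ => constr:(x :: env)
  end.
Ltac lc_atoms e env :=
  lazymatch e with
  | 0 => env
  | ?a + ?b => let env := lc_atoms a env in lc_atoms b env
  | - ?a => lc_atoms a env
  | _ *: ?a => lc_atoms a env
  | _ => lc_insert e env
  end.
Ltac lc_quote K e env :=
  lazymatch e with
  | 0 => constr:(@LZero K)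
  | ?a + ?b => let a := lc_quote K a env in let b := lc_quote K b env in
      constr:(@LAdd K a b)
  | - ?a => let a := lc_quote K a env in constr:(@LOpp K a)
  | ?c *: ?a => let a := lc_quote K a env in constr:(@LScale K c a)
  | _ => let n := lc_index e env in constr:(@LVar K n)
  end.
(* Reduces an equation between linear combinations to the equations between
   the coefficients of its atoms. *)
Ltac lincomb_coefs :=
  lazymatch goal with
  | |- @eq ?T ?l ?r =>
    let env := lc_atoms l constr:(@nil T) in
    let env := lc_atoms r env in
    let K := lazymatch constr:(lc_scalars l) with
             | @lc_scalars ?K _ _ => K end in
    let e1 := lc_quote K l env in
    let e2 := lc_quote K r env in
    apply: (@lc_eq K _ env e1 e2); rewrite /=; do ?split
  end.
Lemma eq_Re_Im (R : rcfType) (x y : R[i]) :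
  complex.Re x = complex.Re y -> complex.Im x = complex.Im y -> x = y.
Proof. by case: x y => [a b] [c d] /= -> ->. Qed.

Ltac complex_field := first [by [] | ring
  | apply: eq_Re_Im; rewrite /=; first [ring | field; by [] | by field; rewrite gt_eqF | field; lra]].
Ltac lincomb := lincomb_coefs; complex_field.

(** * C*-norms and positive elements *)

Section SmulTheory.
Context {R : realType} {B : starAlgType R}.
Implicit Types a b c : B.

Lemma smul0r a : a ** 0 = 0.
Proof. by rewrite -(scale0r (0 : B)) smulZr !scale0r. Qed.

Lemma smul0l a : 0 ** a = 0.
Proof. by rewrite -(scale0r (0 : B)) smulZl !scale0r. Qed.

Lemma smulNr a b : a ** (- b) = - (a ** b).
Proof. by rewrite -scaleN1r smulZr scaleN1r. Qed.

Lemma smulNl a b : (- a) ** b = - (a ** b).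
Proof. by rewrite -scaleN1r smulZl scaleN1r. Qed.

Definition smulE := (@smulDl R B, @smulDr R B, smulNl, smulNr, @smulZl R B,
  @smulZr R B, smul0l, smul0r, @smulA R B).

Lemma adj0 : adj 0 = 0 :> B.
Proof. by rewrite -(scale0r (0 : B)) adjZ rmorph0 !scale0r. Qed.

Lemma adjN a : adj (- a) = - adj a.
Proof. by rewrite -scaleN1r adjZ rmorphN1 scaleN1r. Qed.

Lemma adjZr (t : R) a : adj (t%:C *: a) = t%:C *: adj a.
Proof. by rewrite adjZ; congr (_ *: _); rewrite conj_Creal // complex_real. Qed.

Lemma adjZi a : adj ('i%C *: a) = - 'i%C *: adj a.
Proof. by rewrite adjZ complexiE conjCi. Qed.

Definition adjE := (@adjD R B, adjN, adjZr, adjZi, @adjM R B, @adjK R B, adj0).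

End SmulTheory.


Lemma le0_small (R : realFieldType) (x C : R) : 0 <= C ->
  (forall e, 0 < e -> x <= C * e) -> x <= 0.
Proof.
move=> C0 xC; rewrite leNgt; apply/negP => x0.
have c1 : 0 < C + 1 by lra.
have := xC (x / (2 * (C + 1))) ltac:(by rewrite divr_gt0// mulr_gt0).
have -> : C * (x / (2 * (C + 1))) = (C * x) / (2 * (C + 1)) by rewrite mulrA.
by rewrite ler_pdivlMr; nra.
Qed.

Section CstarNorm.
Context {R : realType} {B : starAlgType R}.
Implicit Types (x y z : B) (p : B -> R).

(** A predicate on [p] rather than a structure on [B], so that it covers both [nm] on [A] and the
    operator norm [opn] on [multiplier A]. *)
Record cstar_norm p : Prop := CstarNorm {
  cnD : forall x y, p (x + y) <= p x + p y;
  cnZ : forall (c : R[i]) x, p (c *: x) = complex.Re `|c| * p x;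
  cn_eq0 : forall x, p x = 0 -> x = 0;
  cnM : forall x y, p (x ** y) <= p x * p y;
  cnC : forall x, p (adj x ** x) = p x ^+ 2;
  cn_complete : forall u : nat -> B,
    (forall e, 0 < e -> exists N, forall m n, (N <= m)%N -> (N <= n)%N ->
      p (u m - u n) < e) ->
    exists l, forall e, 0 < e -> exists N, forall n, (N <= n)%N ->
      p (u n - l) < e }.

Definition cn_closed p (I : set B) :=
  forall x, (forall e, 0 < e -> exists2 y, I y & p (x - y) < e) -> I x.

Context {p : B -> R} (cn : cstar_norm p).

Lemma cnZr (t : R) x : p (t%:C *: x) = `|t| * p x.
Proof. by rewrite (cnZ cn) normc_def /= expr0n addr0 sqrtr_sqr. Qed.

Lemma cn0 : p 0 = 0.
Proof. by rewrite -(scale0r (0 : B)) -[0]/(0%:C) cnZr normr0 mul0r. Qed.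

Lemma cnN x : p (- x) = p x.
Proof. by rewrite -scaleN1r -(rmorphN1 (real_complex R)) cnZr normrN1 mul1r. Qed.

Lemma cnB x y : p (x - y) <= p x + p y.
Proof. by rewrite -(cnN y) (cnD cn). Qed.

Lemma cnBC x y : p (x - y) = p (y - x).
Proof. by rewrite -cnN opprB. Qed.

Lemma cn_ge0 x : 0 <= p x.
Proof. by have := cnB x x; rewrite subrr cn0; lra. Qed.

Lemma cn_adj x : p (adj x) = p x.
Proof.
have le y : p y <= p (adj y).
  have := cnM cn (adj y) y; rewrite (cnC cn) expr2.
  have := cn_ge0 y; rewrite le_eqVlt => /predU1P[<- _|y0]; first exact: cn_ge0.
  by rewrite ler_pM2r.
by apply/eqP; rewrite eq_le le andbT -{2}(adjK x) le.
Qed.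

Lemma cn_triangle y x z : p (x - z) <= p (x - y) + p (y - z).
Proof. by have := cnD cn (x - y) (y - z); rewrite addrA subrK. Qed.

Lemma cn_small x C : 0 <= C -> (forall e, 0 < e -> p x <= C * e) -> x = 0.
Proof.
move=> C0 /(le0_small C0) px; apply: (cn_eq0 cn).
by apply/eqP; rewrite eq_le px cn_ge0.
Qed.

(** A fixed point [k] satisfies (1 - k)^2 = 1 - g, so 1 - k is a square root of 1 - g; the map makes
    sense without a unit. *)
Definition half_square g x : B := (2^-1)%:C *: (g + x ** x).

Let kappa : nat -> R := fun n => iter n (fun t => (1 + t ^+ 2) / 2) 0.

Let kappaS n : kappa n.+1 = (1 + kappa n ^+ 2) / 2. Proof. by []. Qed.

Let kappa01 n : 0 <= kappa n <= 1.
Proof. by elim: n => [|n /andP[? ?]]; [rewrite lexx ler01|rewrite kappaS; nra]. Qed.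

Let kappa_cauchy e : 0 < e ->
  exists N, forall n, (N <= n)%N -> kappa n - kappa N < e.
Proof.
move=> e0; have hs : has_sup (range kappa).
  split; first by exists (kappa 0); exists 0%N.
  by exists 1 => _ [n _ <-]; case/andP: (kappa01 n).
have [_ [N _ <-] lt] := sup_adherent e0 hs.
exists N => n _; have : kappa n <= sup (range kappa).
  by apply: ub_le_sup; [case: hs|exists n].
by move: lt; lra.
Qed.

(* [x |-> (g + x^2)/2] is majorized by [t |-> (1 + t^2)/2], whose iterates
   from 0 increase to 1; so its iterates converge even when [p g = 1]. *)
Lemma half_square_fixpoint g : p g <= 1 ->
  exists2 k, half_square g k = k
    & forall I : set B, cn_closed p I -> I 0 ->
      (forall x, I x -> I (half_square g x)) -> I k.
Proof.
move=> g1; pose s n := iter n (half_square g) 0.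
have sS n : s n.+1 = half_square g (s n) by [].
have hB x y : p (half_square g x - half_square g y) <=
    (p x + p y) / 2 * p (x - y).
  have -> : half_square g x - half_square g y =
      (2^-1)%:C *: (x ** (x - y) + (x - y) ** y).
    by rewrite /half_square !smulE; lincomb.
  rewrite cnZr gtr0_norm//.
  have := cnD cn (x ** (x - y)) ((x - y) ** y).
  have := cnM cn x (x - y); have := cnM cn (x - y) y; nra.
have sk n : p (s n) <= kappa n.
  elim: n => [|n IHn]; first by rewrite cn0.
  rewrite sS kappaS /half_square cnZr gtr0_norm//.
  have := cnD cn g (s n ** s n); have := cnM cn (s n) (s n).
  by have := cn_ge0 (s n); nra.
have sd n : p (s n.+1 - s n) <= kappa n.+1 - kappa n.
  elim: n => [|n IHn].
    rewrite sS kappaS subr0 /half_square smul0l addr0 cnZr gtr0_norm//=.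
    by rewrite /kappa/=; lra.
  (* [hB] is exact for the majorant: (kappa n.+1 + kappa n) / 2 times the increment of [kappa] is
     its next increment. *)
  rewrite !sS; apply: (le_trans (hB _ _)); rewrite -sS !kappaS.
  have := sk n.+1; have := sk n; have := cn_ge0 (s n.+1 - s n).
  have := cn_ge0 (s n); have := cn_ge0 (s n.+1).
  move: IHn; rewrite !kappaS; have := kappa01 n; nra.
have sdn m n : p (s (n + m)%N - s n) <= kappa (n + m)%N - kappa n.
  elim: m => [|m IHm]; first by rewrite addn0 !subrr cn0.
  rewrite addnS; have := cn_triangle (s (n + m)%N) (s (n + m).+1) (s n).
  by have := sd (n + m)%N; lra.
have [k sk_k] : exists k, forall e, 0 < e -> exists N, forall n, (N <= n)%N ->
    p (s n - k) < e.
  apply: (cn_complete cn) => e e0; have [|N kN] := kappa_cauchy (e := e / 2).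
    by rewrite divr_gt0.
  exists N => m n Nm Nn; apply: (le_lt_trans (cn_triangle (s N) _ _)).
  rewrite [X in _ + X]cnBC -(subnKC Nm) -(subnKC Nn).
  have := sdn (m - N)%N N; have := sdn (n - N)%N N.
  by rewrite !subnKC//; have := kN m Nm; have := kN n Nn; lra.
exists k; last first.
  move=> I Icl I0 IS; apply: Icl => e /sk_k[N /(_ N (leqnn N)) sNk].
  exists (s N); last by rewrite cnBC.
  by elim: (N) => [//|n IHn]; exact: IS.
apply/eqP; rewrite -subr_eq0; apply/eqP.
apply: (@cn_small _ (p k + 3)); first by have := cn_ge0 k; lra.
move=> e /sk_k[N kN].
have := cn_triangle (s N.+1) (half_square g k) k.
have := kN N.+1 (leqnSn N); have := kN N (leqnn N).
have := hB k (s N); rewrite -sS [p (k - s N)]cnBC.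
have := sk N; have := kappa01 N; have := cn_ge0 (s N - k); have := cn_ge0 k.
have := cn_ge0 (s N); set a := p (half_square g k - _); nra.
Qed.

Lemma closed_sa : cn_closed p [set x | adj x = x].
Proof.
move=> x xcl /=; apply/eqP; rewrite -subr_eq0; apply/eqP.
apply: (@cn_small _ 2) => // e /xcl[y /= yy xy].
have := cn_triangle y (adj x) x.
by rewrite -{1}yy -adjN -adjD cn_adj [p (y - x)]cnBC; lra.
Qed.

End CstarNorm.

Section Positive.
Context {R : realType} {B : starAlgType R} {p : B -> R} (cn : cstar_norm p).
Variable e : B.
Hypothesis e1 : forall x, e ** x = x.
Hypothesis ee : forall x, x ** e = x.
Implicit Types (x y z a b k : B) (t c : R).

Lemma adj_unit : adj e = e.
Proof. by rewrite -[LHS]ee -{2}[e]adjK -adjM ee adjK. Qed.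

Lemma cn_unit : p e <= 1.
Proof.
have := cnC cn e; rewrite adj_unit e1; have := cn_ge0 cn e; nra.
Qed.

Lemma cn_sqr x : adj x = x -> p (x ** x) = p x ^+ 2.
Proof. by move=> xx; rewrite -{1}xx (cnC cn). Qed.

(** Positivity without spectra: for self-adjoint [x] the inequality says that the spectrum lies in
    [0, 2 t]. Sums are then immediate; the positivity of a^* a is what takes work. *)
Definition pos x := adj x = x /\ exists2 t, 0 <= t & p (t%:C *: e - x) <= t.

Lemma pos_sa x : pos x -> adj x = x. Proof. by case. Qed.

Lemma posD x y : pos x -> pos y -> pos (x + y).
Proof.
move=> [xx [t t0 tx]] [yy [s s0 sy]]; split; first by rewrite adjD xx yy.
exists (t + s); first exact: addr_ge0.
have -> : (t + s)%:C *: e - (x + y) = t%:C *: e - x + (s%:C *: e - y).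
  by lincomb.
by apply: (le_trans (cnD cn _ _)); exact: lerD.
Qed.

Lemma posZ t x : 0 <= t -> pos x -> pos (t%:C *: x).
Proof.
move=> t0 [xx [s s0 sx]]; split; first by rewrite adjZr xx.
exists (t * s); first exact: mulr_ge0.
have -> : (t * s)%:C *: e - t%:C *: x = t%:C *: (s%:C *: e - x) by lincomb.
by rewrite (cnZr cn) ger0_norm// ler_wpM2l.
Qed.

Lemma pos_sa_norm x : adj x = x -> pos ((p x)%:C *: e - x).
Proof.
move=> xx; split; first by rewrite !adjE adj_unit xx.
exists (p x); first exact: (cn_ge0 cn).
by rewrite opprB addrC subrK.
Qed.

Lemma pos_unit c : 0 <= c -> pos (c%:C *: e).
Proof.
move=> c0; split; first by rewrite adjZr adj_unit.
by exists c => //; rewrite subrr (cn0 cn).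
Qed.

Lemma pos0 : pos 0.
Proof. by rewrite -(scale0r e); exact: (pos_unit (lexx 0)). Qed.

Lemma closed_commutant z : cn_closed p [set x | z ** x = x ** z].
Proof.
move=> x xcl; apply/eqP; rewrite -subr_eq0; apply/eqP.
apply: (cn_small cn (C := 2 * p z)); first by rewrite mulr_ge0// (cn_ge0 cn).
move=> d /xcl[y /= zy xy].
have -> : z ** x - x ** z = z ** (x - y) - (x - y) ** z.
  by rewrite !smulE zy; lincomb.
apply: (le_trans (cnB cn _ _)).
have := cnM cn z (x - y); have := cnM cn (x - y) z.
have := cn_ge0 cn z; nra.
Qed.

Lemma closed_ball c : cn_closed p [set x | p x <= c].
Proof.
move=> x xcl /=; rewrite -subr_le0; apply: (le0_small ler01) => d /xcl[y /= yc].
by have := cn_triangle cn y x 0; rewrite !subr0; lra.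
Qed.

(** The root is e - k for the fixed point [k] of [half_square g]. Self-adjointness, the bound and
    commutation pass to [k] because each defines a closed set stable under the iteration. *)
Lemma sqrt_one_sub g : adj g = g -> p g <= 1 ->
  exists l, [/\ adj l = l, l ** l = e - g, p (e - l) <= 1
    & forall z, z ** g = g ** z -> z ** l = l ** z].
Proof.
move=> gg g1; have [k kE kI] := half_square_fixpoint cn g1.
have kk : k ** k = 2%:C *: k - g by rewrite -{3}kE /half_square; lincomb.
exists (e - k); split.
- rewrite adjD adjN adj_unit; congr (_ - _); apply: (kI [set x | adj x = x]).
  + exact: (closed_sa cn).
  + by rewrite /= adj0.
  + by move=> x /= xx; rewrite /half_square !adjE gg xx.
- by rewrite !smulE e1 ee kk e1; lincomb.
- rewrite opprB addrC subrK; apply: (kI [set x | p x <= 1]).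
  + exact: closed_ball.
  + by rewrite /= (cn0 cn) ler01.
  + move=> x /= x1; rewrite /half_square (cnZr cn) gtr0_norm//.
    have := cnD cn g (x ** x); have := cnM cn x x; have := cn_ge0 cn x; nra.
- move=> z zg; rewrite !smulE e1 ee; congr (_ - _); apply: (kI [set x | z ** x = x ** z]).
  + exact: closed_commutant.
  + by rewrite /= smul0r smul0l.
  + move=> x /= zx; rewrite /half_square !smulE zg zx.
    by rewrite -[x ** z ** x]smulA zx smulA.
Qed.

Lemma pos_sqrt x : pos x ->
  exists y, [/\ pos y, y ** y = x & forall z, z ** x = x ** z -> z ** y = y ** z].
Proof.
move=> [xx [t]]; rewrite le_eqVlt => /predU1P[<-|t0 xt].
  rewrite scale0r sub0r (cnN cn) => x0.
  have -> : x = 0.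
    by apply: (cn_eq0 cn); apply/eqP; rewrite eq_le x0 (cn_ge0 cn).
  by exists 0; split=> [||z]; [exact: pos0|rewrite smul0r|rewrite smul0r smul0l].
have [||l [ll lE l1 lc]] := @sqrt_one_sub (e - t^-1%:C *: x).
- by rewrite !adjE adj_unit xx.
- have -> : e - t^-1%:C *: x = t^-1%:C *: (t%:C *: e - x).
    by lincomb.
  by rewrite (cnZr cn) gtr0_norm ?invr_gt0// ler_pdivrMl// mulr1.
have st := sqr_sqrtr (ltW t0).
exists ((Num.sqrt t)%:C *: l); split.
- split; first by rewrite adjZr ll.
  exists (Num.sqrt t); first exact: sqrtr_ge0.
  rewrite -scalerBr (cnZr cn) ger0_norm ?sqrtr_ge0//.
  by rewrite -[leRHS]mulr1 ler_wpM2l// sqrtr_ge0.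
- rewrite !smulE lE scalerA -rmorphM/= -expr2 st opprB addrC subrK scalerA.
  by rewrite -rmorphM/= mulfV ?gt_eqF// scale1r.
- move=> z zx; rewrite smulZl smulZr lc// !smulE ee e1.
  by rewrite zx.
Qed.

(* [x + i y] is normal, so its norm squared is the norm of [x^2 + y^2]. *)
Lemma cn_cart x y : adj x = x -> adj y = y -> x ** y = y ** x ->
  p x ^+ 2 <= p (x ** x + y ** y).
Proof.
move=> xx yy xy; pose u := x + 'i%C *: y.
have uE : adj u = x - 'i%C *: y by rewrite /u !adjE xx yy scaleNr.
have <- : adj u ** u = x ** x + y ** y.
  by rewrite uE !smulE xy; lincomb.
rewrite (cnC cn) lerXn2r ?nnegrE ?(cn_ge0 cn)//.
have -> : x = (2^-1)%:C *: (u + adj u) by rewrite uE /u; lincomb.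
have := cnD cn u (adj u); rewrite (cn_adj cn) (cnZr cn) gtr0_norm//; lra.
Qed.

(** Rescale [x] to [y] of norm at most 1 and let l^2 = e - y^2. As l^2 + y^2 = e, [cn_cart] bounds
    the norm of e - y^2 by that of [e]. *)
Lemma pos_sqr x : adj x = x -> pos (x ** x).
Proof.
move=> xx; have px0 := cn_ge0 cn x; pose s := p x + 1.
have s0 : 0 < s by rewrite /s; lra.
pose y := s^-1%:C *: x.
have yy : adj y = y by rewrite /y adjZr xx.
have xE : x ** x = (s ^+ 2)%:C *: (y ** y) by rewrite /y !smulE; lincomb.
have y1 : p y <= 1.
  rewrite (cnZr cn) gtr0_norm ?invr_gt0// ler_pdivrMl// mulr1 /s; lra.
have [||l [ll lE _ lc]] := @sqrt_one_sub (y ** y).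
- by rewrite adjM yy.
- by have := cnM cn y y; have := cn_ge0 cn y; nra.
have yl : l ** y = y ** l by rewrite -lc// smulA.
rewrite xE; apply: posZ; first exact: sqr_ge0.
split; first by rewrite adjM yy.
exists 1 => //; rewrite scale1r -lE cn_sqr//.
have := cn_cart ll yy yl; rewrite lE subrK => /le_trans; apply.
exact: cn_unit.
Qed.

(** Take commuting square roots [y] of [x] and [z] of c e - x; [cn_cart] compares y^2 with y^2 + z^2
    = c e. *)
Lemma pos_norm_le c x : 0 <= c -> pos x -> pos (c%:C *: e - x) -> p x <= c.
Proof.
move=> c0 px pcx; have [y [[yy _] yE yc]] := pos_sqrt px.
have [z [[zz _] zE zc]] := pos_sqrt pcx.
have yz : y ** z = z ** y.
  apply: zc; rewrite smulDr smulDl smulZr smulZl e1 ee smulNr smulNl; congr (_ - _).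
  by rewrite -yE smulA.
have := cn_cart yy zz yz; rewrite yE zE addrC subrK -yE cn_sqr// => /le_trans.
apply; rewrite (cnZr cn) ger0_norm//.
by have := cn_unit; have := cn_ge0 cn e; nra.
Qed.

(* With [m = b b^*] and [X = t + k] one has [(t - m) b = b X], and [t - m] has
   norm at most [t]; hence [X k X <= t^2 |k|], which pushes [k] strictly below
   its norm unless [k = 0]. *)
Lemma neg_square_eq0 b k : pos k -> adj b ** b = - k -> b = 0.
Proof.
move=> pk bk; have kk := pos_sa pk.
(* From b b^* + b^* b = 2 (x^2 + y^2), the element b b^* is positive although b^* b is negative. *)
pose x := (2^-1)%:C *: (b + adj b); pose y := (2^-1)%:C *: ('i%C *: (b - adj b)).
have xx : adj x = x by rewrite /x !adjE [X in _ *: X]addrC.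
have yy : adj y = y by rewrite /y !adjE; lincomb.
have mE : b ** adj b = 2%:C *: (x ** x + y ** y) + k.
  rewrite -[k]opprK -bk.
  by rewrite /x /y !smulE; lincomb.
have pm : pos (b ** adj b).
  rewrite mE; apply: posD => //; apply: posZ => //.
  by apply: posD; exact: pos_sqr.
case: pm => mm [t]; rewrite le_eqVlt => /predU1P[<-|t0] mt.
  rewrite -[b]adjK; suff -> : adj b = 0 by rewrite adj0.
  apply: (cn_eq0 cn); have := cnC cn (adj b); rewrite adjK.
  move: mt; rewrite scale0r sub0r (cnN cn) => mt mE'.
  by have := cn_ge0 cn (adj b); nra.
pose X := t%:C *: e + k.
have XX : adj X = X by rewrite /X !adjE adj_unit kk.
have bX : (t%:C *: e - b ** adj b) ** b = b ** X.
  by rewrite /X !smulE e1 ee -(smulA b) bk smulNr opprK.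
have pbX : p (b ** X) ^+ 2 <= t ^+ 2 * p k.
  have -> : p k = p b ^+ 2 by rewrite -(cnC cn) bk (cnN cn).
  rewrite -bX -exprMn lerXn2r ?nnegrE ?mulr_ge0 ?(cn_ge0 cn) ?(ltW t0)//.
  apply: (le_trans (cnM cn _ _)); rewrite ler_wpM2r//; exact: (cn_ge0 cn).
have [w [pw wE wc]] := pos_sqrt pk.
have wk : w ** k = k ** w by rewrite -wE smulA.
have kkk : pos (k ** k ** k).
  have -> : k ** k ** k = (w ** k) ** (w ** k).
    by rewrite {1}wk !smulA -(smulA k w w) wE.
  by apply: pos_sqr; rewrite adjM kk (pos_sa pw).
have pXX : pos ((t ^+ 2 * p k)%:C *: e - X ** k ** X).
  have XkX : X ** k ** X = - (adj (b ** X) ** (b ** X)).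
    by rewrite adjM XX !smulA -(smulA X (adj b)) bk smulNr smulNl opprK.
  have : p (X ** k ** X) <= t ^+ 2 * p k by rewrite XkX (cnN cn) (cnC cn).
  move=> le; rewrite -[_ * _](subrK (p (X ** k ** X))) rmorphD scalerDl -addrA.
  apply: posD; first by apply: pos_unit; lra.
  by apply: pos_sa_norm; rewrite !adjM XX kk smulA.
have := pos_norm_le _ (posZ _ pk) _.
pose K := p k; have K0 : 0 <= K := cn_ge0 cn k.
(* Adding k^3 and 2 t (K - k)^2 to t^2 K - X k X cancels the terms in k^2 and k^3; these are the
   coefficients of the affine remainder. The resulting bound reads 2 t K^2 <= 0. *)
move=> /(_ (t ^+ 2 * K + 2 * t * K ^+ 2) (t ^+ 2 + 4 * t * K)).
have c0 : 0 <= t ^+ 2 * K + 2 * t * K ^+ 2.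
  by rewrite addr_ge0// mulr_ge0 ?sqr_ge0// mulr_ge0// ltW.
have d0 : 0 <= t ^+ 2 + 4 * t * K.
  by rewrite addr_ge0 ?sqr_ge0// mulr_ge0// mulr_ge0// ltW.
move=> /(_ c0 d0); rewrite (cnZr cn) ger0_norm// -/K => normk.
have K00 : K = 0.
  suff KK : (t ^+ 2 + 4 * t * K) * K <= t ^+ 2 * K + 2 * t * K ^+ 2.
    have : t * K ^+ 2 <= 0 by lra.
    by rewrite pmulr_rle0// => K2; apply/eqP; rewrite -sqrf_eq0 eq_le K2 sqr_ge0.
  apply: normk; rewrite /K.
  have -> : (t ^+ 2 * p k + 2 * t * p k ^+ 2)%:C *: e -
      (t ^+ 2 + 4 * t * p k)%:C *: k =
      ((t ^+ 2 * p k)%:C *: e - X ** k ** X) + k ** k ** k +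
      (2 * t)%:C *: (((p k)%:C *: e - k) ** ((p k)%:C *: e - k)).
    by rewrite /X !smulE !e1 !ee; lincomb.
  apply: posD; first exact: posD.
  apply: posZ; first by rewrite mulr_ge0// ltW.
  by apply: pos_sqr; rewrite !adjE adj_unit kk.
have k0 : k = 0 by exact: (cn_eq0 cn).
apply: (cn_eq0 cn); have := cnC cn b; rewrite bk k0 oppr0 (cn0 cn).
by have := cn_ge0 cn b; nra.
Qed.

(** With r the square root of h^2, the element n = r - h is twice the negative part of [h]. Since h
    n = - n r, the square of the modulus of a n is - n^2 r = - (v n)^2 with v^2 = r. So
    [neg_square_eq0] gives a n = 0, whence h n = 0, n = 0 and h = r. *)
Lemma pos_adjM a : pos (adj a ** a).
Proof.
have [h hE] : exists h, h = adj a ** a by exists (adj a ** a).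
have hh : adj h = h by rewrite hE adjM adjK.
have [r [pr rE rc]] := pos_sqrt (pos_sqr hh).
have hr : h ** r = r ** h by apply: rc; rewrite smulA.
have [v [pv vE vc]] := pos_sqrt pr.
have hv : h ** v = v ** h by exact: vc.
have rv : r ** v = v ** r by rewrite -vE smulA.
pose n := r - h.
have nn : adj n = n by rewrite adjD adjN hh (pos_sa pr).
have nv : n ** v = v ** n by rewrite /n !smulE hv rv.
have an : a ** n = 0.
  apply: (@neg_square_eq0 _ ((v ** n) ** (v ** n))).
    by apply: pos_sqr; rewrite adjM nn (pos_sa pv) nv.
  have -> : (v ** n) ** (v ** n) = n ** n ** r.
    by rewrite -vE !smulA -nv -(smulA (n ** v)) -nv !smulA -(smulA n v n) -nv !smulA.
  have hn : h ** n = - (n ** r).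
    by rewrite /n smulDr smulNr smulDl smulNl hr -rE opprB.
  by rewrite adjM nn -smulA (smulA _ a) -hE hn smulNr smulA.
have hn : h ** r = h ** h.
  apply/eqP; rewrite -subr_eq0 -smulNr -smulDr -/n {1}hE -smulA an smul0r.
  exact: eqxx.
suff n0 : n = 0 by rewrite -hE; rewrite -(subrK h r) -/n n0 add0r in pr.
apply: (cn_eq0 cn); apply/eqP; rewrite -sqrf_eq0 -cn_sqr//.
have -> : n ** n = 0.
  by rewrite /n smulDl smulNl !smulDr !smulNr -hr hn rE !subrr.
by rewrite (cn0 cn).
Qed.

Lemma pos_conj x z : pos x -> pos (adj z ** x ** z).
Proof.
move=> /pos_sqrt[y [[yy _] <- _]].
by have := pos_adjM (y ** z); rewrite adjM yy !smulA.
Qed.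

Lemma cn_sqr_sub x : pos ((p x ^+ 2)%:C *: e - adj x ** x).
Proof. by rewrite -(cnC cn); apply: pos_sa_norm; rewrite adjM adjK. Qed.

Lemma neumann g : p g < 1 -> exists r, r ** (e - g) = e.
Proof.
move=> g1; have g0 := cn_ge0 cn g.
pose s n := iter n (fun x => e + x ** g) 0.
(* As C = 1 + C p g, this number bounds all partial sums of the geometric series. *)
pose C := (1 - p g)^-1.
have C0 : 0 < C by rewrite invr_gt0; lra.
have CE : 1 + C * p g = C by rewrite /C; field; lra.
have sC n : p (s n) <= C.
  elim: n => [|n IHn] /=; first by rewrite (cn0 cn) ltW.
  have := cnD cn e (s n ** g); have := cnM cn (s n) g; have := cn_unit.
  by have := cn_ge0 cn (s n); nra.
have sd n m : p (s (m + n)%N - s n) <= C * p g ^+ n.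
  elim: n => [|n IHn]; first by rewrite addn0 subr0 mulr1.
  rewrite addnS /= opprD addrACA subrr add0r -smulNl -smulDl exprSr mulrA.
  by apply: (le_trans (cnM cn _ _)); rewrite ler_wpM2r.
have sm d : 0 < d -> exists N, C * p g ^+ N < d.
  move=> d0; have /cvgrPdist_lt/(_ (d / C)) : p g ^+ n @[n --> \oo] --> 0.
    by apply: cvg_expr; rewrite ger0_norm.
  rewrite divr_gt0// => /(_ isT)[N _ /(_ N (leqnn N))] /=.
  rewrite sub0r normrN ger0_norm ?exprn_ge0// ltr_pdivlMr// mulrC => ?.
  by exists N.
have [r sr] : exists r, forall d, 0 < d -> exists N, forall n, (N <= n)%N ->
    p (s n - r) < d.
  apply: (cn_complete cn) => d d0; have [|N NC] := sm (d / 2).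
    by rewrite divr_gt0.
  exists N => m n Nm Nn; apply: (le_lt_trans (cn_triangle cn (s N) _ _)).
  have := sd N (m - N)%N; have := sd N (n - N)%N; rewrite !subnK//.
  by rewrite [p (s N - _)](cnBC cn); lra.
exists r; rewrite smulDr ee smulNr.
apply/eqP; rewrite -subr_eq0; apply/eqP; apply: (cn_small cn (C := 2)) => // d.
move=> /sr[N sN].
have -> : r - r ** g - e = (r - s N.+1) - (r - s N) ** g.
  by rewrite /= !smulE; lincomb.
apply: (le_trans (cnB cn _ _)); have := cnM cn (r - s N) g.
have := sN N (leqnn N); have := sN N.+1 (leqnSn N).
rewrite ![p (s _ - r)](cnBC cn); have := cn_ge0 cn (r - s N); nra.
Qed.

Lemma pos_inv J : pos J -> exists2 r, adj r = r & r ** (e + J) = e.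
Proof.
(* Then e + J = (1 + t) (e - g) with p g <= t / (1 + t) < 1. *)
move=> [JJ [t t0 tJ]]; pose g := (1 + t)^-1%:C *: (t%:C *: e - J).
have t1 : 0 < 1 + t by lra.
have [|r rE] := @neumann g.
  rewrite (cnZr cn) gtr0_norm ?invr_gt0// ltr_pdivrMl//; lra.
have eJ : e + J = (1 + t)%:C *: (e - g) by rewrite /g; lincomb.
pose s := (1 + t)^-1%:C *: r.
have sE : s ** (e + J) = e.
  rewrite eJ /s !smulZl smulZr rE scalerA -rmorphM/= mulVf ?scale1r//.
  by rewrite gt_eqF.
exists s => //; have := congr1 adj sE.
rewrite adjM adjD adj_unit JJ => sE'.
by rewrite -[RHS]ee -sE' smulA sE e1.
Qed.

Record cn_ideal (I : set B) : Prop := CnIdeal {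
  cni0 : I 0;
  cniZD : forall (c : R[i]) x y, I x -> I y -> I (c *: x + y);
  cniMl : forall x b, I x -> I (b ** x);
  cniMr : forall x b, I x -> I (x ** b);
  cni_adj : forall x, I x -> I (adj x);
  cni_closed : cn_closed p I }.

Section Ideal.
Context {I : set B} (HI : cn_ideal I).

Lemma cniZ (c : R[i]) x : I x -> I (c *: x).
Proof. by move=> Ix; rewrite -[_ *: _]addr0; exact/(cniZD HI)/(cni0 HI). Qed.

Lemma cniD x y : I x -> I y -> I (x + y).
Proof. by move=> Ix Iy; rewrite -(scale1r x); exact/(cniZD HI). Qed.

(* From [a^* a <= s + j <= 2 s + J] with [J = j^2 / 4 s], cut off by
   [r = (1 + J / s)^-1], which is congruent to 1 modulo [I]. *)
Lemma ideal_dist a j s : 0 < s -> I j -> adj j = j ->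
  pos (s%:C *: e + j - adj a ** a) -> exists2 i, I i & p (a - i) ^+ 2 <= 2 * s.
Proof.
move=> s0 Ij jj pa.
(* This [J] is j^2 / (4 s^2), already divided by [s], so that the cut-off is the inverse of e +
   J. *)
have [J [J0 IJ jjE]] : exists J, [/\ pos J, I J & j ** j = (4 * s ^+ 2)%:C *: J].
  exists ((4 * s ^+ 2)^-1%:C *: (j ** j)); split.
  - by apply: posZ; [rewrite invr_ge0 mulr_ge0// sqr_ge0|exact: pos_sqr].
  - by apply: cniZ; exact: (cniMl HI).
  - by lincomb.
have [r rr rE] := pos_inv J0; have rE' : (e + J) ** r = e.
  by have := congr1 adj rE; rewrite adjM adjD adj_unit (pos_sa J0) rr.
exists (a ** (r ** J)).
  by apply: (cniMl HI); exact: (cniMl HI).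
have -> : a - a ** (r ** J) = a ** r.
  have -> : r ** J = e - r by rewrite -rE smulDr ee; lincomb.
  by rewrite smulDr ee smulNr; lincomb.
rewrite -(cnC cn) adjM rr smulA -(smulA r).
apply: pos_norm_le; first by rewrite mulr_ge0// ltW.
  by rewrite -{1}rr; apply/pos_conj/pos_adjM.
(* With [e] written as r (e + J)^2 r, everything is a conjugate by [r]; the square (s - j / 2)^2 / s
   absorbs [j] because j^2 / (4 s) = s J. *)
have -> : (2 * s)%:C *: e - r ** (adj a ** a) ** r =
    adj r ** ((s%:C *: e + j - adj a ** a) +
              (s^-1%:C *: ((s%:C *: e - (2^-1)%:C *: j) **
                          (s%:C *: e - (2^-1)%:C *: j)))) ** r +
    s%:C *: (adj r ** (3%:C *: J + 2%:C *: (J ** J)) ** r).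
  have {1}-> : e = r ** ((e + J) ** (e + J)) ** r.
    by rewrite smulA rE e1 rE'.
  rewrite rr !smulDl !smulDr !smulNl !smulNr !smulZl !smulZr !e1 !ee jjE.
  by rewrite !smulE !ee; lincomb.
apply: posD.
  apply: pos_conj; apply: posD => //.
  apply: posZ; first by rewrite invr_ge0 ltW.
  by apply: pos_sqr; rewrite !adjE adj_unit jj.
apply: posZ; first exact: ltW.
apply: pos_conj; apply: posD; apply: posZ => //.
exact/pos_sqr/pos_sa.
Qed.

End Ideal.

End Positive.

(** * Extreme functionals *)

Section Sublinear.
Context {R : realType} {V : lmodType R[i]}.
Implicit Types (f g q : V -> R) (x y v : V) (t : R).

Definition sublinear g :=
  (forall x y, g (x + y) <= g x + g y) /\
  (forall t x, 0 < t -> g (t%:C *: x) <= t * g x).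

Definition real_linear f :=
  (forall x y, f (x + y) = f x + f y) /\ (forall t x, f (t%:C *: x) = t * f x).

(* [g] cuts out a face of the convex set of linear functionals below [q]. *)
Definition face q g := forall f1 f2 t, real_linear f1 -> real_linear f2 ->
  (forall x, f1 x <= q x) -> (forall x, f2 x <= q x) -> 0 < t < 1 ->
  (forall x, t * f1 x + (1 - t) * f2 x <= g x) -> forall x, f1 x <= g x.

Lemma real_linearN f x : real_linear f -> f (- x) = - f x.
Proof.
by move=> [_ /(_ (-1) x)]; rewrite rmorphN1 scaleN1r mulN1r.
Qed.

Lemma sublinear0 g : sublinear g -> g 0 = 0.
Proof.
move=> [_ gZ]; have := gZ 2 0 ltac:(lra); have := gZ 2^-1 0 ltac:(lra).
rewrite !scaler0; lra.
Qed.

Lemma sublinearZ g t x : sublinear g -> 0 < t -> g (t%:C *: x) = t * g x.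
Proof.
move=> [_ gZ] t0; apply/eqP; rewrite eq_le gZ//= -ler_pdivlMl//.
have := gZ t^-1 (t%:C *: x); rewrite scalerA -rmorphM/= mulVf ?gt_eqF//.
by rewrite scale1r invr_gt0; exact.
Qed.

Lemma sublinear_ge g x y : sublinear g -> g x - g (x - y) <= g y.
Proof.
by move=> [gD _]; have := gD y (x - y); rewrite addrC subrK; lra.
Qed.

Lemma sublinear_oddP g : sublinear g -> (forall v, g (- v) <= - g v) ->
  real_linear g.
Proof.
move=> gs gN; have gN' v : g (- v) = - g v.
  apply/eqP; rewrite eq_le gN/=.
  by have := sublinear_ge v (v - - v) gs; have := gs.1 v (- v);
    rewrite subrr (sublinear0 gs); lra.
split=> [x y|t x].
  apply/eqP; rewrite eq_le gs.1/=.
  by have := gs.1 (- x) (- y); rewrite -opprD !gN'; lra.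
have [t0|t0|<-] := ltgtP 0 t; first exact: sublinearZ.
  have -> : t%:C *: x = - ((- t)%:C *: x) by lincomb.
  by rewrite gN' sublinearZ ?oppr_gt0// mulNr opprK.
by rewrite scale0r sublinear0// mul0r.
Qed.

(** The one-step reduction of Hahn-Banach: it stays sublinear and below [g], but its value at - v is
    at most - g v. Linear functionals below it therefore take the value g v at [v]. *)
Definition along g v x := inf [set g (x + t%:C *: v) - t * g v | t in [set t | 0 <= t]].

Section Along.
Variables (g : V -> R) (v : V).
Hypothesis gs : sublinear g.

Let lbd x : has_lbound [set g (x + t%:C *: v) - t * g v | t in [set t | 0 <= t]].
Proof.
exists (- g (- x)) => _ [t /= t0 <-].
have -> : t * g v = g (t%:C *: v).
  move: t0; rewrite le_eqVlt => /predU1P[<-|t0].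
    by rewrite mul0r scale0r sublinear0.
  by rewrite sublinearZ.
by have := gs.1 (- x) (x + t%:C *: v); rewrite addKr; lra.
Qed.

Lemma along_le x t : 0 <= t -> along g v x <= g (x + t%:C *: v) - t * g v.
Proof. by move=> t0; apply: ge_inf; [exact: lbd|exists t]. Qed.

Lemma along_ge x c :
  (forall t, 0 <= t -> c <= g (x + t%:C *: v) - t * g v) -> c <= along g v x.
Proof.
move=> cle; apply: lb_le_inf.
  by exists (g (x + 0%:C *: v) - 0 * g v); exists 0; rewrite /= ?lexx.
by move=> _ [t /= t0 <-]; exact: cle.
Qed.

Lemma along_leg x : along g v x <= g x.
Proof.
by apply: le_trans (along_le x (lexx 0)) _; rewrite scale0r addr0 mul0r subr0.
Qed.

Lemma along_opp : along g v (- v) <= - g v.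
Proof.
apply: le_trans (along_le (- v) ler01) _.
by rewrite scale1r addNr sublinear0// mul1r sub0r.
Qed.

Lemma sublinear_along : sublinear (along g v).
Proof.
split=> [x y|c x c0].
  rewrite -lerBlDr; apply: along_ge => t t0; rewrite lerBlDr -lerBlDl.
  apply: along_ge => s s0; rewrite lerBlDl.
  apply: le_trans (along_le (x + y) (addr_ge0 t0 s0)) _.
  have := gs.1 (x + t%:C *: v) (y + s%:C *: v).
  have -> : x + t%:C *: v + (y + s%:C *: v) = x + y + (t + s)%:C *: v by lincomb.
  lra.
rewrite -ler_pdivrMl//; apply: along_ge => t t0; rewrite ler_pdivrMl//.
apply: le_trans (along_le _ (mulr_ge0 (ltW c0) t0)) _.
have -> : c%:C *: x + (c * t)%:C *: v = c%:C *: (x + t%:C *: v) by lincomb.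
by rewrite sublinearZ//; lra.
Qed.

Lemma face_along q : face q g -> face q (along g v).
Proof.
move=> fqg f1 f2 t l1 l2 f1q f2q /andP[t0 t1] f12 x.
have f12g y := le_trans (f12 y) (along_leg y).
have f1g := fqg f1 f2 t l1 l2 f1q f2q ltac:(by rewrite t0) f12g.
have f2g := fqg f2 f1 (1 - t) l2 l1 f2q f1q ltac:(lra)
  ltac:(by move=> y; have := f12g y; lra).
have f1v : f1 v = g v.
  have := le_trans (f12 (- v)) along_opp; rewrite !real_linearN//.
  have := f1g v; have := f2g v; nra.
apply: along_ge => s s0; rewrite lerBrDr -f1v -(l1.2 s) -l1.1; exact: f1g.
Qed.

End Along.

(* A minimal element, for the pointwise order, of the sublinear functionals
   below [q] that cut out a face is linear, and then it is an extreme point: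
   this proves Hahn-Banach and Krein-Milman at one stroke. *)
Lemma extreme_functional q h : sublinear q ->
  exists f, [/\ real_linear f, forall x, f x <= q x, f h = q h & face q f].
Proof.
(* Searching below [along q h] instead of [q] forces f h = q h. The preorder [r] is reversed, so
   Zorn's lemma yields a minimal functional. *)
move=> qs; pose T := {g | [/\ sublinear g, forall x, g x <= along q h x & face q g]}.
pose mkT g (gT : [/\ sublinear g, forall x, g x <= along q h x & face q g]) : T :=
  exist _ g gT.
pose r (a b : T) := `[< forall x, sval b x <= sval a x >].
have q_T : [/\ sublinear (along q h), forall x, along q h x <= along q h x
    & face q (along q h)].
  split=> //; first exact: sublinear_along.
  by apply: face_along => // f1 f2 t _ _.
have [m mP] : exists m : T, forall s, r m s -> r s m.
  apply: (@ZL_preorder T (mkT _ q_T)).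
  - by move=> a; apply/asboolP.
  - by move=> b a c /asboolP ab /asboolP bc; apply/asboolP => x; exact: le_trans (ab x).
  move=> C tot; have [[c0 Cc0]|C0] := pselect (exists c, C c); last first.
    by exists (mkT _ q_T) => s Cs; case: C0; exists s.
  pose S x := [set sval c x | c in C].
  have lbd x : has_lbound (S x).
    exists (- q (- x)) => _ [[c [cs cq cf]] Cc <-] /=.
    have := cs.1 x (- x); rewrite subrr (sublinear0 cs).
    by have := le_trans (cq (- x)) (along_leg h qs (- x)); lra.
  pose G x := inf (S x).
  have Gle c x : C c -> G x <= sval c x.
    by move=> Cc; apply: ge_inf => //; exists c.
  have leG z x : (forall c, C c -> z <= sval c x) -> z <= G x.
    move=> zc; apply: lb_le_inf; first by exists (sval c0 x); exists c0.
    by move=> _ [c Cc <-]; exact: zc.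
  have G_T : [/\ sublinear G, forall x, G x <= along q h x & face q G].
    split=> [|x|f1 f2 t l1 l2 f1q f2q t01 f12 x].
    - split=> [x y|t x t0].
        rewrite -lerBlDr; apply: (leG) => c Cc; rewrite lerBlDr -lerBlDl.
        apply: (leG) => d Cd; rewrite lerBlDl.
        have [/asboolP cd|/asboolP cd] := tot c d Cc Cd.
          apply: le_trans (Gle _ _ Cd) _; have [ds _ _] := svalP d.
          by have := ds.1 x y; have := cd x; lra.
        apply: le_trans (Gle _ _ Cc) _; have [cs _ _] := svalP c.
        by have := cs.1 x y; have := cd y; lra.
      rewrite -ler_pdivrMl//; apply: (leG) => c Cc; rewrite ler_pdivrMl//.
      by apply: le_trans (Gle _ _ Cc) _; have [cs _ _] := svalP c; exact: cs.2.
    - by apply: le_trans (Gle _ _ Cc0) _; have [_ + _] := svalP c0; exact.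
    - apply: (leG) => c Cc; have [_ _ cf] := svalP c.
      apply: (cf f1 f2 t) => // y; exact: le_trans (f12 y) (Gle _ _ Cc).
  by exists (mkT _ G_T) => c Cc; apply/asboolP => x; exact: Gle.
have [gs gq gf] := svalP m; set g := sval m in gs gq gf *.
have gl : real_linear g.
  (* By minimality [g] is below [along g v], whose value at - v is at most - g v. *)
  apply: sublinear_oddP => // v.
  have av_T : [/\ sublinear (along g v), forall x, along g v x <= along q h x
      & face q (along g v)].
    split; first exact: sublinear_along.
      by move=> x; exact: le_trans (along_leg _ gs x) (gq x).
    exact: face_along.
  have /asboolP/(_ (- v)) /= : r (mkT _ av_T) m.
    by apply: mP; apply/asboolP => x /=; exact: along_leg.
  move=> /le_trans; apply; exact: along_opp.
exists g; split=> //; first by move=> x; exact: le_trans (gq x) (along_leg _ qs x).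
apply/eqP; rewrite eq_le (le_trans (gq h) (along_leg _ qs h))/=.
have := le_trans (gq (- h)) (along_opp h qs); rewrite real_linearN//; lra.
Qed.

End Sublinear.

(** * Hilbert spaces *)

Section RealNorm.
Context {R : realType} {V : normedModType R[i]}.
Implicit Types (x y : V) (K : set V).

(** Norms over [R[i]] take values in [R[i]]; the real version brings estimates within reach of [lra]
    and [nra]. *)
Definition nm x : R := complex.Re `|x|.

Lemma nmE x : `|x| = (nm x)%:C.
Proof. by rewrite /nm RRe_real// normr_real. Qed.

Lemma nm_ge0 x : 0 <= nm x.
Proof. by rewrite -lecR -nmE normr_ge0. Qed.

Lemma nmD x y : nm (x + y) <= nm x + nm y.
Proof. by rewrite -lecR rmorphD/= -!nmE ler_normD. Qed.

Lemma nmZ (c : R[i]) x : nm (c *: x) = complex.Re `|c| * nm x.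
Proof.
apply: complexI; rewrite rmorphM/= -!nmE normrZ.
by congr (_ * _); rewrite RRe_real// normr_real.
Qed.

Lemma nmN x : nm (- x) = nm x. Proof. by rewrite /nm normrN. Qed.

Lemma nm0_eq0 x : nm x = 0 -> x = 0.
Proof. by move=> x0; apply/eqP; rewrite -normr_eq0 nmE x0. Qed.

Lemma nm0 : nm (0 : V) = 0. Proof. by rewrite /nm normr0. Qed.

Lemma nmBC x y : nm (x - y) = nm (y - x). Proof. by rewrite -nmN opprB. Qed.

Lemma nm_triangle y x z : nm (x - z) <= nm (x - y) + nm (y - z).
Proof. by have := nmD (x - y) (y - z); rewrite addrA subrK. Qed.

Lemma nmZr (t : R) x : nm (t%:C *: x) = `|t| * nm x.
Proof. by rewrite nmZ normc_def /= expr0n addr0 sqrtr_sqr. Qed.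

Lemma real_pos (e : R[i]) : 0 < e -> exists2 d : R, 0 < d & e = d%:C.
Proof.
move=> e0; exists (complex.Re e); last by rewrite RRe_real// gtr0_real.
by rewrite -ltcR RRe_real// gtr0_real.
Qed.

Lemma nbhs_nmP x (U : set V) : nbhs x U <->
  exists2 d : R, 0 < d & forall y, nm (x - y) < d -> U y.
Proof.
rewrite -nbhs_ballE; split=> [[e /= /real_pos[d d0 ->]] xU|[d d0 xU]].
  by exists d => // y xy; apply: xU; rewrite -ball_normE /ball_ /= nmE ltcR.
exists d%:C => /=; first by rewrite ltcR.
by move=> y; rewrite -ball_normE /ball_ /= nmE ltcR; exact: xU.
Qed.

Lemma closed_nmP K : closed K <->
  forall x, (forall d, 0 < d -> exists2 y, K y & nm (x - y) < d) -> K x.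
Proof.
split=> [Kc x xK|Kx x xK].
  apply: Kc => U /nbhs_nmP[d /xK[y Ky xy] dU]; exists y; split=> //; exact: dU.
apply: Kx => d d0; have [|y [Ky xy]] := xK [set y | nm (x - y) < d].
  by apply/nbhs_nmP; exists d.
by exists y.
Qed.

Lemma closure_nmP K x : closure K x <->
  forall d, 0 < d -> exists2 y, K y & nm (x - y) < d.
Proof.
split=> [xK d d0|xK U /nbhs_nmP[d /xK[y Ky xy] dU]].
  have [|y [Ky xy]] := xK [set y | nm (x - y) < d].
    by apply/nbhs_nmP; exists d.
  by exists y.
by exists y; split=> //; exact: dU.
Qed.

Lemma cvg_nmP (u : nat -> V) l : u n @[n --> \oo] --> l <->
  forall d, 0 < d -> exists N, forall n, (N <= n)%N -> nm (u n - l) < d.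
Proof.
split=> [ul d d0|ul U /nbhs_nmP[d /ul[N uN] dU]].
  have [|N _ uN] := ul [set y | nm (l - y) < d].
    by apply/nbhs_nmP; exists d.
  by exists N => n Nn; rewrite nmBC; exact: uN.
by exists N => // n /= Nn; apply: dU; rewrite nmBC; exact: uN.
Qed.

Lemma linear_scaleD (W : lmodType R[i]) (f : V -> W) : linear f ->
  [/\ f 0 = 0, forall x y, f (x + y) = f x + f y, forall x, f (- x) = - f x
    & forall c x, f (c *: x) = c *: f x].
Proof.
move=> fl; have f0 : f 0 = 0.
  by have := fl (-1) 0 0; rewrite scaleN1r oppr0 addr0 scaleN1r addNr.
have fZ c x : f (c *: x) = c *: f x by have := fl c x 0; rewrite f0 !addr0.
split=> // [x y|x]; first by have := fl 1 x y; rewrite !scale1r.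
by rewrite -[- x]scaleN1r fZ scaleN1r.
Qed.

Lemma linear_bounded_continuous_nm (W : normedModType R[i]) (f : V -> W) C :
  linear f -> (forall x, complex.Re `|f x| <= C * nm x) -> continuous f.
Proof.
move=> fl fC x; have [f0 fD fN fZ] := linear_scaleD fl.
apply/cvgrPdist_lt => e /real_pos[d d0 ->]; near=> y.
rewrite -fN -fD (_ : `|_| = (complex.Re `|f (x - y)|)%:C); last first.
  by rewrite RRe_real// normr_real.
rewrite ltcR; apply: le_lt_trans (fC _) _.
have : nm (x - y) < d / (`|C| + 1).
  near: y; apply/nbhs_nmP; exists (d / (`|C| + 1)) => //.
  by rewrite divr_gt0// ltr_wpDl.
rewrite ltr_pdivlMr ?ltr_wpDl//.
have := nm_ge0 (x - y); have := ler_norm C; nra.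
Unshelve. all: by end_near. Qed.

Lemma linear_continuous_bounded_nm (f : V -> V) : linear f -> continuous f ->
  exists2 C, 0 <= C & forall x, nm (f x) <= C * nm x.
Proof.
move=> fl fc; have [f0 fD fN fZ] := linear_scaleD fl.
have /fc/nbhs_nmP[d d0 fd] : nbhs (f 0) [set y | nm y < 1].
  apply/nbhs_nmP; exists 1 => // y; by rewrite f0 sub0r nmN.
exists (2 / d) => [|x]; first by rewrite divr_ge0// ltW.
have [->|x0] := eqVneq x 0; first by rewrite f0 nm0 mulr0.
have px : 0 < nm x.
  by rewrite lt_neqAle nm_ge0 andbT eq_sym; apply: contraNneq x0 => /nm0_eq0 ->.
pose c := d / (2 * nm x).
have c0 : 0 < c by rewrite divr_gt0// mulr_gt0.
have /= := fd (c%:C *: x); rewrite sub0r nmN nmZr gtr0_norm// fZ nmZr gtr0_norm//.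
have -> : c * nm x = d / 2 by rewrite /c; field; rewrite gt_eqF.
have dd : d / 2 < d by lra.
move=> /(_ dd); rewrite -ltr_pdivlMl// mulr1 => /ltW/le_trans; apply.
by rewrite /c invf_div; lra.
Qed.

End RealNorm.

Lemma complete_nm {R : realType} {V : completeNormedModType R[i]} (u : nat -> V) :
  (forall d : R, 0 < d -> exists N, forall m n, (N <= m)%N -> (N <= n)%N ->
    nm (u m - u n) < d) ->
  exists l : V, u n @[n --> \oo] --> l.
Proof.
move=> uc; suff /cvg_ex[l ul] : cvg (u n @[n --> \oo]) by exists l.
apply/cauchy_cvgP/cauchy_exP => e /real_pos[d d0 ->].
have [N uN] := uc d d0; exists (u N), N => // n /= Nn.
by rewrite -ball_normE /ball_ /= nmE ltcR; exact: uN.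
Qed.

Lemma cstar_norm_nm {R : realType} (A : cstarAlgType R) :
  cstar_norm (nm : A -> R).
Proof.
split=> [x y|c x|x|x y|x|u /complete_nm[l /cvg_nmP ul]].
- exact: nmD.
- exact: nmZ.
- exact: nm0_eq0.
- by rewrite -lecR rmorphM/= -!nmE norm_smul_le.
- by apply: complexI; rewrite rmorphXn/= -!nmE cstar_identity.
- by exists l.
Qed.

Lemma real_complete (R : realType) (u : nat -> R) :
  (forall d : R, 0 < d -> exists N, forall m n, (N <= m)%N -> (N <= n)%N ->
    `|u m - u n| < d) ->
  exists l, forall d, 0 < d -> exists N, forall n, (N <= n)%N -> `|u n - l| < d.
Proof.
move=> uc; have /cvg_ex[l /cvgrPdist_lt ul] : cvg (u n @[n --> \oo]).
  apply/cauchy_cvgP/cauchy_exP => d d0; have [N uN] := uc d d0.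
  by exists (u N), N => // n /= Nn; rewrite /ball/=; exact: uN.
exists l => d /ul[N _ uN]; exists N => n Nn; rewrite distrC; exact: uN.
Qed.

(** * Completion of a semi-inner product space *)

Section SemiInner.
Context {R : realType} {V : lmodType R[i]}.

(* [s] is the real part of a semi-inner product. *)
Record semi_inner (s : V -> V -> R) : Prop := SemiInner {
  siC : forall a b, s a b = s b a;
  siD : forall a b c, s (a + b) c = s a c + s b c;
  siZ : forall (t : R) a b, s (t%:C *: a) b = t * s a b;
  siJ : forall (c : R[i]) a b, s (c *: a) b = s a ((c^*)%R *: b);
  si_ge0 : forall a, 0 <= s a a }.

Context (s : V -> V -> R) (Hs : semi_inner s).
Implicit Types (a b : V).

Lemma siDr a b c : s a (b + c) = s a b + s a c.
Proof. by rewrite (siC Hs) (siD Hs) !(siC Hs a). Qed.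

Lemma siZrr (t : R) a b : s a (t%:C *: b) = t * s a b.
Proof. by rewrite (siC Hs) (siZ Hs) (siC Hs a). Qed.

Lemma siN a b : s (- a) b = - s a b.
Proof. by have := siZ Hs (-1) a b; rewrite rmorphN1 scaleN1r mulN1r. Qed.

Lemma siNr a b : s a (- b) = - s a b.
Proof. by rewrite (siC Hs) siN (siC Hs a). Qed.

Lemma si_scale (c : R[i]) a : s (c *: a) (c *: a) = (complex.Re `|c|) ^+ 2 * s a a.
Proof.
rewrite (siJ Hs) scalerA -siZrr; congr (s _ (_ *: _)).
rewrite mulrC -normCK rmorphXn/=.
by congr (_ ^+ 2); rewrite RRe_real ?normr_real.
Qed.

(** The supremum of 2 g b - s b b is the squared dual norm of [g]. This form avoids dividing by s b
    b, which may vanish. *)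
Definition dual_bounded (_ : semi_inner s) : {pred V -> R} := fun g =>
  `[< real_linear g /\ exists M, forall b, 2 * g b - s b b <= M >].

Lemma dual_boundedP g : reflect (real_linear g /\
  exists M, forall b, 2 * g b - s b b <= M) (g \in dual_bounded Hs).
Proof. exact: asboolP. Qed.

Lemma functional_CS g M : real_linear g -> (forall b, 2 * g b - s b b <= M) ->
  forall b, g b ^+ 2 <= M * s b b.
Proof.
move=> [gD gZ] gM b; have gt t : 2 * t * g b - t ^+ 2 * s b b <= M.
  have := gM (t%:C *: b); rewrite gZ (siZ Hs) siZrr; lra.
have := si_ge0 Hs b; rewrite le_eqVlt => /predU1P[sb|sb].
  rewrite -sb mulr0; have [gb|gb] := eqVneq (g b) 0; first by rewrite gb expr0n.
  have := gt ((M + 1) / (2 * g b)); rewrite -sb mulr0 subr0.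
  have -> : 2 * ((M + 1) / (2 * g b)) * g b = M + 1 by field.
  lra.
rewrite -ler_pdivrMr//; have := gt (g b / s b b).
rewrite (_ : _ - _ = g b ^+ 2 / s b b)//; field; exact: lt0r_neq0.
Qed.

Lemma CS_functional g K b : g b ^+ 2 <= K * s b b -> 2 * g b - s b b <= `|K|.
Proof.
have := si_ge0 Hs b; set x := s b b; rewrite le_eqVlt => /predU1P[<-|x0 gb].
  rewrite mulr0 => gb; have -> : g b = 0.
    by apply/eqP; rewrite -sqrf_eq0 eq_le gb sqr_ge0.
  by rewrite mulr0 subr0.
apply: le_trans (ler_norm K); rewrite -(ler_pM2r x0).
by have := sqr_ge0 (g b - x); lra.
Qed.

Lemma dual_bounded_zmod : GRing.zmod_closed (dual_bounded Hs).
Proof.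
split.
  apply/dual_boundedP; split; first by split=> *; rewrite ?addr0 ?mulr0.
  by exists 0 => b; rewrite mulr0 sub0r oppr_le0 (si_ge0 Hs).
move=> f g /dual_boundedP[fl fM] /dual_boundedP[gl gM].
have fgl : real_linear (f - g).
  split=> [x y|t x].
    by change (f (x + y) - g (x + y) = f x - g x + (f y - g y));
      rewrite fl.1 gl.1; ring.
  by change (f (t%:C *: x) - g (t%:C *: x) = t * (f x - g x));
    rewrite fl.2 gl.2; ring.
apply/dual_boundedP; split=> //.
have [K /(functional_CS fl) fK] := fM; have [L /(functional_CS gl) gL] := gM.
exists `|2 * (K + L)| => b; apply: CS_functional.
change ((f b - g b) ^+ 2 <= 2 * (K + L) * s b b).
by have := fK b; have := gL b; have := sqr_ge0 (f b + g b); lra.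
Qed.

HB.instance Definition _ := GRing.isZmodClosed.Build (V -> R)
  (dual_bounded Hs) dual_bounded_zmod.

(* The completion of [V], realized as its dual: the real part of [<v, .>]
   determines the vector [v]. *)
Record hdual := HDual { hdual_fun :> V -> R;
  hdual_funP : hdual_fun \in dual_bounded Hs }.

HB.instance Definition _ := [isSub for hdual_fun].
HB.instance Definition _ := [Choice of hdual by <:].
HB.instance Definition _ := [SubChoice_isSubZmodule of hdual by <:].

Implicit Types (g h : hdual).

Lemma hdual_eq g h : (forall b, g b = h b) -> g = h.
Proof. by move=> gh; apply: val_inj; apply/funext. Qed.

Lemma hdualP g : real_linear g /\ exists M, forall b, 2 * g b - s b b <= M.
Proof. by apply/dual_boundedP; exact: hdual_funP. Qed.

Lemma hdual_scale_subproof (c : R[i]) g :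
  (fun b => g ((c^*)%R *: b)) \in dual_bounded Hs.
Proof.
have [gl gM] := hdualP g.
have gcl : real_linear (fun b => g ((c^*)%R *: b)).
  by split=> [x y|t x]; [rewrite scalerDr gl.1|rewrite -gl.2 !scalerA mulrC].
apply/dual_boundedP; split=> //; have [K /(functional_CS gl) gK] := gM.
exists `|K * (complex.Re `|(c^*)%R|) ^+ 2| => b.
apply: (CS_functional (g := fun b => g ((c^*)%R *: b))).
by rewrite -mulrA -si_scale.
Qed.

(** Follows the rule Re <c v, b> = Re <v, c^* b> for an inner product linear in its first
    argument. *)
Definition hdual_scale c g := HDual (hdual_scale_subproof c g).

Fact hdual_scalerA (c d : R[i]) g :
  hdual_scale c (hdual_scale d g) = hdual_scale (c * d) g.
Proof. by apply: hdual_eq => x /=; rewrite scalerA -rmorphM mulrC. Qed.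
Fact hdual_scale1r : left_id 1 hdual_scale.
Proof. by move=> g; apply: hdual_eq => x /=; rewrite rmorph1 scale1r. Qed.
Fact hdual_scalerDr : right_distributive hdual_scale +%R.
Proof. by move=> c g h; exact: hdual_eq. Qed.
Fact hdual_scalerDl g : {morph hdual_scale^~ g : a b / a + b}.
Proof.
by move=> a b; apply: hdual_eq => x /=; rewrite rmorphD/= scalerDl (hdualP g).1.1.
Qed.

HB.instance Definition _ := GRing.Zmodule_isLmodule.Build R[i] hdual
  hdual_scalerA hdual_scale1r hdual_scalerDr hdual_scalerDl.

Lemma hdualD g h b : (g + h) b = g b + h b. Proof. by []. Qed.
Lemma hdualN g b : (- g) b = - g b. Proof. by []. Qed.
Lemma hdual0 b : (0 : hdual) b = 0. Proof. by []. Qed.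
Lemma hdualZ (c : R[i]) g b : (c *: g) b = g ((c^*)%R *: b). Proof. by []. Qed.
Lemma hdualZr (t : R) g b : (t%:C *: g) b = t * g b.
Proof.
by rewrite hdualZ -(hdualP g).1.2; congr (g (_ *: _)); rewrite conj_Creal// complex_real.
Qed.

Definition hN g := sup (range (fun b => 2 * g b - s b b)).

Let hasup g : has_sup (range (fun b => 2 * g b - s b b)).
Proof.
split; first by exists (2 * g 0 - s 0 0); exists 0.
by have [_ [M gM]] := hdualP g; exists M => _ [b _ <-].
Qed.

Lemma hN_ge g b : 2 * g b - s b b <= hN g.
Proof. by apply: ub_le_sup; [case: (hasup g)|exists b]. Qed.

Lemma hN_le g K : (forall b, 2 * g b - s b b <= K) -> hN g <= K.
Proof.
by move=> gK; apply: ge_sup; [case: (hasup g)|move=> _ [b _ <-]].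
Qed.

Lemma hN_near g d : 0 < d -> exists b, hN g - d < 2 * g b - s b b.
Proof.
move=> d0; have [_ [b _ <-] lt] := sup_adherent d0 (hasup g).
by exists b.
Qed.

Lemma s00 : s 0 0 = 0.
Proof. by have := siZ Hs 0 0 0; rewrite scale0r mul0r. Qed.

Lemma hN_ge0 g : 0 <= hN g.
Proof.
have := hN_ge g 0; rewrite s00 subr0.
by have := (hdualP g).1.2 0 0; rewrite scale0r mul0r => ->; rewrite mulr0.
Qed.

Definition hnorm g := Num.sqrt (hN g).

Lemma hnorm_ge0 g : 0 <= hnorm g. Proof. exact: sqrtr_ge0. Qed.
Lemma hnorm_sqr g : hnorm g ^+ 2 = hN g. Proof. exact/sqr_sqrtr/hN_ge0. Qed.

Lemma hnorm_le g K : 0 <= K -> hN g <= K ^+ 2 -> hnorm g <= K.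
Proof.
by move=> K0; rewrite -hnorm_sqr ler_sqr ?nnegrE ?hnorm_ge0.
Qed.

Lemma hdual_CS g b : g b ^+ 2 <= hN g * s b b.
Proof. by apply: functional_CS; [case: (hdualP g)|exact: hN_ge]. Qed.

Lemma hdual_le g b : `|g b| <= hnorm g * Num.sqrt (s b b).
Proof.
rewrite -ler_sqr ?nnegrE ?mulr_ge0 ?sqrtr_ge0// exprMn hnorm_sqr.
by rewrite sqr_sqrtr ?(si_ge0 Hs)// real_normK ?num_real// hdual_CS.
Qed.

Lemma hnormD g h : hnorm (g + h) <= hnorm g + hnorm h.
Proof.
apply: hnorm_le; first by rewrite addr_ge0 ?hnorm_ge0.
apply: hN_le => b; rewrite hdualD; have := hdual_le g b; have := hdual_le h b.
have := sqr_sqrtr (si_ge0 Hs b); set r := Num.sqrt _ => <- hb gb.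
have := ler_norm (g b); have := ler_norm (h b).
have := sqr_ge0 (hnorm g + hnorm h - r); nra.
Qed.

Lemma hN_scale_le (c : R[i]) g : hN (c *: g) <= (complex.Re `|c|) ^+ 2 * hN g.
Proof.
apply: hN_le => b; rewrite hdualZ.
have [->|c0] := eqVneq c 0.
  rewrite rmorph0 scale0r normr0/= expr0n mul0r.
  have := (hdualP g).1.2 0 0; rewrite scale0r mul0r => ->.
  by rewrite mulr0 sub0r oppr_le0 (si_ge0 Hs).
set k := complex.Re `|c|; have kE : k%:C = `|c| by rewrite RRe_real// normr_real.
have k0 : 0 < k by rewrite -ltcR kE normr_gt0.
pose b' := c^-1 *: b; have -> : b = c *: b' by rewrite scalerA mulfV// scale1r.
rewrite scalerA [(c^*)%R * c]mulrC -normCK -kE -rmorphXn/= (hdualP g).1.2.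
rewrite si_scale -/k.
by have := hN_ge g b'; nra.
Qed.

Lemma hN_scale (c : R[i]) g : hN (c *: g) = (complex.Re `|c|) ^+ 2 * hN g.
Proof.
have [->|c0] := eqVneq c 0.
  apply/eqP; rewrite eq_le hN_scale_le normr0/= expr0n mul0r; exact: hN_ge0.
apply/eqP; rewrite eq_le hN_scale_le/=.
have := hN_scale_le c^-1 (c *: g); rewrite scalerA mulVf// scale1r normfV.
set k := complex.Re `|c|; have kE : k%:C = `|c| by rewrite RRe_real// normr_real.
have k0 : 0 < k by rewrite -ltcR kE normr_gt0.
by rewrite -kE -fmorphV/= exprVn -ler_pdivlMl ?exprn_gt0// mulrC.
Qed.

Lemma hnormZ (c : R[i]) g : hnorm (c *: g) = complex.Re `|c| * hnorm g.
Proof.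
rewrite /hnorm hN_scale sqrtrM ?sqr_ge0// sqrtr_sqr ger0_norm//.
rewrite -lecR RRe_real ?normr_real //; exact: normr_ge0.
Qed.

Lemma hnorm_eq0 g : hnorm g = 0 -> g = 0.
Proof.
move=> g0; apply: hdual_eq => b; apply/eqP; rewrite -normr_le0.
by have := hdual_le g b; rewrite g0 mul0r.
Qed.

Fact hnormC_normD g h : (hnorm (g + h))%:C <= (hnorm g)%:C + (hnorm h)%:C.
Proof. by rewrite -rmorphD/= lecR hnormD. Qed.
Fact hnormC_Z (c : R[i]) g : (hnorm (c *: g))%:C = `|c| * (hnorm g)%:C.
Proof. by rewrite hnormZ -[`|c| in RHS]RRe_real ?normr_real // -rmorphM. Qed.
Fact hnormC_eq0 g : (hnorm g)%:C = 0 -> g = 0.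
Proof. by move=> g0; apply: hnorm_eq0; apply: complexI. Qed.

HB.instance Definition _ := @Lmodule_isNormed.Build R[i] hdual
  (fun g => (hnorm g)%:C) hnormC_normD hnormC_Z hnormC_eq0.

Lemma nm_hdual g : nm g = hnorm g. Proof. by []. Qed.

End SemiInner.

Lemma inv_natS_lt (R : realType) (d : R) : 0 < d -> exists N, forall n, (N <= n)%N -> n.+1%:R^-1 < d.
Proof.
move=> d0; have [N _ HN] : \forall n \near \oo, n.+1%:R^-1 < d :> R.
  have /cvgrPdist_lt/(_ d d0) := @cvg_harmonic R.
  by apply: filterS => n; rewrite sub0r normrN ger0_norm// invr_ge0.
by exists N => n Nn; exact: HN.
Qed.

Lemma cauchy_seq_complete {R : realType} {V : normedModType R[i]} :
  (forall u : nat -> V, (forall d : R, 0 < d -> exists N, forall m n,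
      (N <= m)%N -> (N <= n)%N -> nm (u m - u n) < d) ->
    exists l, forall d : R, 0 < d -> exists N, forall n, (N <= n)%N ->
      nm (u n - l) < d) ->
  forall F : set_system V, ProperFilter F -> cauchy F -> cvg F.
Proof.
move=> seqc F FF /cauchyP Fc.
have /choice[u uF] : forall n, exists x, F (ball x (n.+1%:R^-1 : R)%:C).
  by move=> n; apply: Fc; rewrite ltcR invr_gt0.
have ud m n : nm (u m - u n) < m.+1%:R^-1 + n.+1%:R^-1.
  have [z [uz uz']] := filter_ex (filterI (uF m) (uF n)).
  have := nm_triangle z (u m) (u n); move: uz uz'.
  rewrite -!ball_normE /ball_ /= !nmE !ltcR (nmBC z) => ? ? h.
  by apply: le_lt_trans h _; exact: ltrD.
have [|l ul] := seqc u.
  move=> d d0; have [|N Nd] := @inv_natS_lt R (d / 2); first by rewrite divr_gt0.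
  exists N => m n Nm Nn; apply: lt_trans (ud m n) _.
  by rewrite [d]splitr ltrD ?Nd.
apply/cvg_ex; exists l => U /nbhs_nmP[d d0 dU].
have [|N Nd] := @inv_natS_lt R (d / 2); first by rewrite divr_gt0.
have [|M Md] := ul (d / 2); first by rewrite divr_gt0.
have := uF (maxn N M); apply: filterS => x; rewrite -ball_normE /ball_ /= nmE ltcR.
move=> ux; apply: dU; have := Nd _ (leq_maxl N M); have := Md _ (leq_maxr N M).
move=> lu nd; apply: le_lt_trans (nm_triangle (u (maxn N M)) l x) _.
by rewrite nmBC [d]splitr ltrD// (lt_trans ux).
Qed.

Section HdualComplete.
Context {R : realType} {V : lmodType R[i]}.
Context (s : V -> V -> R) (Hs : semi_inner s).
Implicit Types (g h : hdual Hs) (a b : V).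

(** A Cauchy sequence converges at each point, and the bounds on the norm are inequalities at each
    [b], so they survive the limit. *)
Lemma hdual_complete (F : set_system (hdual Hs)) :
  ProperFilter F -> cauchy F -> cvg F.
Proof.
apply: cauchy_seq_complete => u uc.
have pw b : exists l, forall d, 0 < d -> exists N, forall n, (N <= n)%N ->
    `|u n b - l| < d.
  apply: real_complete => d d0; pose r := Num.sqrt (s b b) + 1.
  have r0 : 0 < r by rewrite ltr_wpDl ?sqrtr_ge0.
  have [|N uN] := uc (d / r); first by rewrite divr_gt0.
  exists N => m n Nm Nn; have := uN m n Nm Nn; rewrite ltr_pdivlMr// => lt.
  apply: le_lt_trans (hdual_le (u m - u n) b) _; rewrite -nm_hdual.
  apply: le_lt_trans lt; rewrite ler_wpM2l ?nm_ge0// /r; lra.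
have [l lP] := choice pw.
have lrl : real_linear l.
  split=> [x y|t x]; apply/eqP; rewrite -subr_eq0 -normr_le0.
    apply: (le0_small (C := 3)) => // d d0.
    have [N1 /(_ _ _)H1] := lP (x + y) d d0; have [N2 H2] := lP x d d0.
    have [N3 H3] := lP y d d0; pose n := maxn N1 (maxn N2 N3).
    have := H1 n ltac:(by rewrite leq_max leqnn).
    have := H2 n ltac:(by rewrite !leq_max leqnn orbT).
    have := H3 n ltac:(by rewrite !leq_max leqnn !orbT).
    rewrite (hdualP (u n)).1.1 !ltr_norml !ler_norml; lra.
  apply: (le0_small (C := 1 + `|t|)); first by rewrite addr_ge0.
  move=> d d0; have [N1 H1] := lP (t%:C *: x) d d0; have [N2 H2] := lP x d d0.
  pose n := maxn N1 N2.
  have := H1 n ltac:(by rewrite leq_max leqnn).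
  have := H2 n ltac:(by rewrite leq_max leqnn orbT).
  rewrite (hdualP (u n)).1.2 => h2 h1.
  have -> : l (t%:C *: x) - t * l x =
      - (t * u n x - l (t%:C *: x)) + t * (u n x - l x) by ring.
  apply: le_trans (ler_normD _ _) _; rewrite normrN normrM mulrDl mul1r.
  by apply: lerD; [exact: ltW|rewrite ler_wpM2l// ltW].
have bound N K : 0 <= K -> (forall m, (N <= m)%N -> nm (u N - u m) <= K) ->
    forall b, 2 * (u N b - l b) - s b b <= K ^+ 2.
  move=> K0 uK b; rewrite -subr_le0; apply: (le0_small (C := 2)) => // d d0.
  have [M HM] := lP b d d0; pose m := maxn N M.
  have := HM m (leq_maxr _ _); rewrite ltr_norml => /andP[_ um].
  have := hN_ge (u N - u m) b; rewrite hdualD hdualN -hnorm_sqr -nm_hdual.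
  have : nm (u N - u m) ^+ 2 <= K ^+ 2.
    by rewrite ler_sqr ?nnegrE ?nm_ge0// uK// leq_maxl.
  lra.
have lb : l \in dual_bounded Hs.
  apply/dual_boundedP; split=> //; have [N uN] := uc 1 ltr01.
  have lN : real_linear (fun b => u N b - l b).
    by have [[uD uZ] _] := hdualP (u N); split=> *;
      rewrite ?uD ?uZ ?lrl.1 ?lrl.2; ring.
  have /(functional_CS Hs lN) CS1 := bound N 1 ler01
    (fun m Nm => ltW (uN N m (leqnn N) Nm)).
  exists `|2 * (1 ^+ 2 + hN (u N))| => b; apply: (CS_functional Hs).
  have := CS1 b; have := hdual_CS (u N) b.
  have := sqr_ge0 (2 * u N b - l b); have := sqr_ge0 (u N b).
  nra.
exists (HDual lb) => d d0; have [|N uN] := uc (d / 2); first by rewrite divr_gt0.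
exists N => n Nn; apply: (@le_lt_trans _ _ (d / 2)); last by lra.
rewrite nm_hdual; apply: hnorm_le; first by rewrite divr_ge0// ltW.
apply: hN_le => b; rewrite hdualD hdualN /=.
apply: bound; first by rewrite divr_ge0// ltW.
by move=> m nm'; apply: ltW; apply: uN => //; exact: leq_trans Nn nm'.
Qed.

HB.instance Definition _ := Uniform_isComplete.Build (hdual Hs) hdual_complete.

Lemma hvec_subproof a : s a \in dual_bounded Hs.
Proof.
apply/dual_boundedP; split.
  by split=> [x y|t x]; [exact: (siDr Hs)|exact: (siZrr Hs)].
exists (s a a) => b; have := si_ge0 Hs (a - b).
rewrite (siD Hs) !(siDr Hs) !(siN Hs) !(siNr Hs) (siC Hs b); lra.
Qed.

Definition hvec a : hdual Hs := HDual (hvec_subproof a).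

Lemma hvecE a b : hvec a b = s a b. Proof. by []. Qed.

Lemma hvecZ (c : R[i]) a : hvec (c *: a) = c *: hvec a.
Proof. by apply: hdual_eq => b; rewrite hvecE (siJ Hs). Qed.

Lemma hvecN a : hvec (- a) = - hvec a.
Proof. by rewrite -scaleN1r hvecZ scaleN1r. Qed.

(** Translating the variable of the supremum by [a] completes the square. *)
Lemma hN_vecD g a : hN (g + hvec a) = hN g + 2 * g a + s a a.
Proof.
have sE c : s (c + a) (c + a) = s c c + 2 * s a c + s a a.
  by rewrite (siD Hs) !(siDr Hs) (siC Hs c a); ring.
have gD := (hdualP g).1.1.
apply/eqP; rewrite eq_le; apply/andP; split.
  apply: hN_le => b; rewrite hdualD hvecE -(subrK a b); move: (b - a) => c.
  rewrite sE gD (siDr Hs); have := hN_ge g c; lra.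
have h c : 2 * g c - s c c <= hN (g + hvec a) - 2 * g a - s a a.
  have := hN_ge (g + hvec a) (c + a); rewrite hdualD hvecE sE gD (siDr Hs); lra.
by have := hN_le h; lra.
Qed.

Lemma hN_vec a : hN (hvec a) = s a a.
Proof.
have := hN_vecD 0 a; rewrite add0r hdual0 => ->.
suff -> : hN (0 : hdual Hs) = 0 by ring.
by rewrite -hnorm_sqr -nm_hdual nm0 expr0n.
Qed.

(** The squared distance is hN g - (2 g a - s a a), and the subtracted term comes arbitrarily close
    to its supremum [hN g]. *)
Lemma hvec_dense g d : 0 < d -> exists a, nm (g - hvec a) < d.
Proof.
move=> d0; have [|a ga] := @hN_near _ _ _ _ g (d ^+ 2); first exact: exprn_gt0.
exists a; rewrite nm_hdual -ltr_sqr ?nnegrE ?hnorm_ge0 ?(ltW d0)// hnorm_sqr.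
rewrite -hvecN hN_vecD.
have -> : s (- a) (- a) = s a a by rewrite (siN Hs) (siNr Hs) opprK.
have -> : g (- a) = - g a.
  by have := (hdualP g).1.2 (-1) a; rewrite rmorphN1 scaleN1r mulN1r.
lra.
Qed.

Definition hB g h := (hN (g + h) - hN (g - h)) / 4.

Lemma hB_vec g a : hB g (hvec a) = g a.
Proof.
rewrite /hB -hvecN !hN_vecD.
have -> : s (- a) (- a) = s a a by rewrite (siN Hs) (siNr Hs) opprK.
have -> : g (- a) = - g a.
  by have := (hdualP g).1.2 (-1) a; rewrite rmorphN1 scaleN1r mulN1r.
lra.
Qed.

Lemma hN_nm g : hN g = nm g ^+ 2. Proof. by rewrite nm_hdual hnorm_sqr. Qed.

Lemma hBC g h : hB g h = hB h g.
Proof. by rewrite /hB [h + g]addrC -(opprB g h) ![hN (- _)]hN_nm nmN -hN_nm. Qed.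

Lemma hB_self g : hB g g = nm g ^+ 2.
Proof.
rewrite /hB subrr !hN_nm nm0 expr0n subr0 -mulr2n -scaler_nat.
have -> : (2%:R : R[i]) = (2 : R)%:C by rewrite rmorphMn.
by rewrite nmZr ger0_norm// exprMn; field.
Qed.

Lemma nm_sqr_dist (x y : hdual Hs) :
  `|nm x ^+ 2 - nm y ^+ 2| <= nm (x - y) * (2 * nm x + nm (x - y)).
Proof.
have := nmD y (x - y); rewrite addrC subrK.
have := nmD x (y - x); rewrite addrC subrK (nmBC y).
have := nm_ge0 x; have := nm_ge0 y; have := nm_ge0 (x - y).
by move=> ? ? ? ? ?; rewrite ler_norml; apply/andP; split; nra.
Qed.

(* The form [hB] is the limit of the evaluations [g a] as [hvec a] tends to
   its second argument. *)
Lemma hB_approx g h : exists2 C, 0 <= C & forall a, nm (h - hvec a) <= 1 ->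
  `|hB g h - g a| <= C * nm (h - hvec a).
Proof.
exists (nm (g + h) + nm (g - h) + 1).
  by rewrite !addr_ge0 ?nm_ge0.
move=> a; rewrite -(hB_vec g a) /hB !hN_nm; set k := hvec a => hk1.
have := nm_sqr_dist (g + h) (g + k); have := nm_sqr_dist (g - h) (g - k).
have -> : g - h - (g - k) = - (h - k) by lincomb.
have -> : g + h - (g + k) = h - k by lincomb.
rewrite nmN; have := nm_ge0 (g + h); have := nm_ge0 (g - h).
have := nm_ge0 (h - k) => k0 gh gh'; rewrite !ler_norml => /andP[? ?] /andP[? ?].
apply/andP; split; nra.
Qed.

(** By density the distance from [h] can be made arbitrarily small. Identities for [hB], which
    polarization does not give directly, are obtained by bounding the difference of their sides in
    this way. *)
Lemma hB_unique h (x : R) : (exists2 C, 0 <= C &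
  forall a, nm (h - hvec a) <= 1 -> `|x| <= C * nm (h - hvec a)) -> x = 0.
Proof.
move=> [C C0 xC]; apply/eqP; rewrite -normr_le0; apply: (le0_small C0) => d d0.
have [|a ha] := @hvec_dense h (Num.min d 1); first by rewrite lt_min d0 ltr01.
move: ha; rewrite lt_min => /andP[had ha1].
apply: le_trans (xC a (ltW ha1)) _; rewrite ler_wpM2l// ltW//.
Qed.

Lemma hBD g g' h : hB (g + g') h = hB g h + hB g' h.
Proof.
have [C C0 hC] := hB_approx (g + g') h; have [D D0 hD] := hB_approx g h.
have [E E0 hE] := hB_approx g' h.
apply/eqP; rewrite -subr_eq0; apply/eqP; apply: (hB_unique (h := h)).
exists (C + D + E) => [|a a1]; first by rewrite !addr_ge0.
have := hC a a1; have := hD a a1; have := hE a a1; rewrite hdualD.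
rewrite !ler_norml; lra.
Qed.

Lemma hBZr (t : R) g h : hB (t%:C *: g) h = t * hB g h.
Proof.
have [C C0 hC] := hB_approx (t%:C *: g) h; have [D D0 hD] := hB_approx g h.
apply/eqP; rewrite -subr_eq0; apply/eqP; apply: (hB_unique (h := h)).
exists (C + `|t| * D) => [|a a1]; first by rewrite addr_ge0// mulr_ge0.
have := hC a a1; rewrite hdualZr => Ca.
have -> : hB (t%:C *: g) h - t * hB g h =
    (hB (t%:C *: g) h - t * g a) - t * (hB g h - g a) by ring.
apply: le_trans (ler_normB _ _) _; rewrite normrM mulrDl; apply: lerD => //.
by rewrite -mulrA ler_wpM2l// hD.
Qed.

Lemma hBJ (c : R[i]) g h : hB (c *: g) h = hB g ((c^*)%R *: h).
Proof.
have [->|c0] := eqVneq c 0.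
  rewrite rmorph0 !scale0r /hB add0r sub0r addr0 subr0 !hN_nm nmN; ring.
have [C C0 hC] := hB_approx (c *: g) h.
have [D D0 hD] := hB_approx g ((c^*)%R *: h).
pose k := complex.Re `|(c^*)%R|.
have k0 : 0 <= k by rewrite -lecR RRe_real ?normr_real//; exact: normr_ge0.
(* Approximating (1 + k) h within 1 keeps both h - hvec a' and its multiple by the conjugate of [c],
   whose modulus is [k], of norm at most 1. *)
apply/eqP; rewrite -subr_eq0; apply/eqP; apply: (hB_unique (h := ((1 + k)%:C *: h))).
have K0 : 0 < 1 + k by rewrite ltr_pwDl.
exists (C + D * k) => [|a]; first by rewrite addr_ge0// mulr_ge0.
have [a' ->] : exists a', a = (1 + k)%:C *: a'.
  exists ((1 + k)^-1%:C *: a).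
  by rewrite scalerA -rmorphM/= mulfV ?scale1r//; exact: lt0r_neq0.
rewrite hvecZ -scalerBr nmZr gtr0_norm// => a1.
have h0 := nm_ge0 (h - hvec a').
have b1 : nm ((c^*)%R *: h - hvec ((c^*)%R *: a')) <= 1.
  rewrite hvecZ -scalerBr nmZ -/k; nra.
have := hD _ b1; have := hC a' ltac:(nra).
rewrite hdualZ hvecZ -scalerBr nmZ -/k => Ca Da.
have -> : hB (c *: g) h - hB g ((c^*)%R *: h) =
  (hB (c *: g) h - g ((c^*)%R *: a')) -
  (hB g ((c^*)%R *: h) - g ((c^*)%R *: a')) by ring.
apply: le_trans (ler_normB _ _) _; apply: le_trans (lerD Ca Da) _.
have := mulr_ge0 (mulr_ge0 (addr_ge0 C0 (mulr_ge0 D0 k0)) k0) h0; lra.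
Qed.

End HdualComplete.

Section RealInner.
Context {R : realType}.

Definition real_inner {H : completeNormedModType R[i]} (b : H -> H -> R) :=
  semi_inner b /\ forall x, b x x = nm x ^+ 2.

(** Recovers the form from its real part: Im <x, y> = Re <x, i y> when the form is linear in the
    first argument. *)
Definition complex_inner {H : completeNormedModType R[i]} (b : H -> H -> R) x y : R[i] :=
  (b x y)%:C + 'i%C * (b x ('i%C *: y))%:C.

Lemma conj_i : ('i%C : R[i])^*%R = - 'i%C.
Proof. by rewrite complexiE conjCi. Qed.

Lemma Re_conj (z : R[i]) : complex.Re (z^*)%R = complex.Re z.
Proof. by case: z. Qed.

Lemma inner_i {H : completeNormedModType R[i]} (b : H -> H -> R) x y :
  semi_inner b -> b ('i%C *: x) y = - b x ('i%C *: y).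
Proof. by move=> Hb; rewrite (siJ Hb) conj_i scaleNr siNr. Qed.

Lemma complex_innerP {H : completeNormedModType R[i]} (b : H -> H -> R) :
  real_inner b -> is_inner_product (complex_inner b).
Proof.
move=> [Hb bnm]; have bi x y := inner_i x y Hb.
have bii x y : b ('i%C *: x) ('i%C *: y) = b x y.
  by rewrite bi scalerA -expr2 sqr_i scaleN1r siNr// opprK.
split=> [c x y z|x y|x].
- rewrite /complex_inner !(siD Hb).
  have cE w : b (c *: x) w = complex.Re c * b x w - complex.Im c * b x ('i%C *: w).
    rewrite {1}[c]complexE scalerDl (siD Hb) (siZ Hb) [_ * (complex.Im c)%:C]mulrC -scalerA
      (siZ Hb) bi.
    by rewrite mulrN.
  rewrite !cE.
  have -> : b x ('i%C *: ('i%C *: z)) = - b x z.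
    by rewrite scalerA -expr2 sqr_i scaleN1r siNr.
  by case: c {cE} => u v; apply: eq_Re_Im; rewrite /=; ring.
- rewrite /complex_inner (siC Hb y x) (siC Hb y) bi.
  by apply: eq_Re_Im; rewrite /=; ring.
- rewrite /complex_inner; have : b x ('i%C *: x) = 0.
    by have := bi x x; rewrite (siC Hb); lra.
  by move=> ->; rewrite mulr0 addr0 bnm nmE rmorphXn.
Qed.

Lemma inner_product_real {H : completeNormedModType R[i]} (ip : H -> H -> R[i]) :
  is_inner_product ip -> real_inner (fun x y => complex.Re (ip x y)).
Proof.
move=> [ipl ipC ipn].
have ip0 y : ip 0 y = 0.
  by have := ipl (-1) 0 0 y; rewrite scaleN1r oppr0 addr0 mulN1r addNr.
have ipZ c x y : ip (c *: x) y = c * ip x y.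
  by have := ipl c x 0 y; rewrite ip0 !addr0.
split; last first.
  by move=> x; rewrite ipn nmE -rmorphXn.
split=> [x y|x y z|t x y|c x y|x].
- by rewrite ipC Re_conj.
- by have := ipl 1 x y z; rewrite scale1r mul1r => ->; case: (ip x z); case: (ip y z).
- by rewrite ipZ; case: (ip x y) => u v /=; rewrite mul0r subr0.
- by rewrite ipZ [in RHS]ipC ipZ rmorphM /= conjCK -ipC.
- by rewrite ipn nmE -rmorphXn /= sqr_ge0.
Qed.

End RealInner.

(** * Orthogonal projection onto a closed subspace *)

Section Projection.
Context {R : realType} {H : completeNormedModType R[i]} (b : H -> H -> R).
Hypothesis Hb : real_inner b.
Implicit Types x y z : H.

Lemma innerN x y : b (x - y) (x - y) = b x x - 2 * b x y + b y y.
Proof.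
rewrite (siD Hb.1) !(siDr Hb.1) !(siN Hb.1) !(siNr Hb.1) (siC Hb.1 y); ring.
Qed.

Lemma nm_sub_sqr x y : nm (x - y) ^+ 2 = nm x ^+ 2 - 2 * b x y + nm y ^+ 2.
Proof. by rewrite -!(Hb.2) innerN. Qed.

Lemma nm_add_sqr x y : nm (x + y) ^+ 2 = nm x ^+ 2 + 2 * b x y + nm y ^+ 2.
Proof. by rewrite -{1}[y]opprK nm_sub_sqr nmN (siNr Hb.1); ring. Qed.

Lemma parallelogram x y :
  nm (x - y) ^+ 2 = 2 * nm x ^+ 2 + 2 * nm y ^+ 2 - nm (x + y) ^+ 2.
Proof. by rewrite nm_sub_sqr nm_add_sqr; ring. Qed.

Lemma inner_CS x y : b x y ^+ 2 <= nm x ^+ 2 * nm y ^+ 2.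
Proof.
rewrite -!(Hb.2); apply: (functional_CS Hb.1 (g := b x)).
  by split=> *; [rewrite (siDr Hb.1)|rewrite (siZrr Hb.1)].
move=> z; have := innerN x z; have := si_ge0 Hb.1 (x - z); lra.
Qed.

Lemma inner_nm_le x y : `|b x y| <= nm x * nm y.
Proof.
rewrite -ler_sqr ?nnegrE ?mulr_ge0 ?nm_ge0// exprMn real_normK ?num_real//.
exact: inner_CS.
Qed.

Lemma projection (K : set H) x : closed_linear_subspace K ->
  exists2 y, K y & forall k, K k -> b (x - y) k = 0.
Proof.
move=> [K0 KZD /closed_nmP Kcl].
have KD k l : K k -> K l -> K (k + l).
  by move=> Kk Kl; rewrite -(scale1r k); exact: KZD.
have KZ c k : K k -> K (c *: k).
  by move=> Kk; rewrite -[_ *: _]addr0; exact: KZD.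
pose D := [set nm (x - k) | k in K]; pose d := inf D.
have Dinf : has_inf D.
  by split; [exists (nm (x - 0)); exists 0|exists 0 => _ [k _ <-]; exact: nm_ge0].
have dle k : K k -> d <= nm (x - k).
  by move=> Kk; apply: ge_inf; [case: Dinf|exists k].
have d0 : 0 <= d.
  by apply: lb_le_inf; [case: Dinf|move=> _ [k _ <-]; exact: nm_ge0].
have /choice[u uP] : forall n, exists k, K k /\ nm (x - k) < d + n.+1%:R^-1.
  move=> n; have n0 : 0 < n.+1%:R^-1 :> R by rewrite invr_gt0.
  by have [_ [k Kk <-] lt] := inf_adherent n0 Dinf; exists k.
have uK n : K (u n) := (uP n).1.
(* The parallelogram law gives 4 ((d + e)^2 - d^2), which is at most (8 d + 4) e when e <= 1. *)
have par e m n : 0 <= e -> e <= 1 -> nm (x - u m) < d + e -> nm (x - u n) < d + e ->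
    nm (u m - u n) ^+ 2 <= (8 * d + 4) * e.
  move=> e0 e1 um un.
  have -> : u m - u n = (x - u n) - (x - u m) by lincomb.
  rewrite parallelogram.
  have -> : x - u n + (x - u m) = 2%:C *: (x - 2^-1%:C *: (u m + u n)) by lincomb.
  rewrite nmZr exprMn ger0_norm//.
  have := dle _ (KZ (2^-1%:C) _ (KD _ _ (uK m) (uK n))).
  set w := nm _ => dw; have := nm_ge0 (x - u m); have := nm_ge0 (x - u n).
  have : d ^+ 2 <= w ^+ 2 by rewrite ler_sqr ?nnegrE// (le_trans d0).
  have : nm (x - u m) ^+ 2 <= (d + e) ^+ 2.
    by rewrite ler_sqr ?nnegrE ?nm_ge0 ?addr_ge0// ltW.
  have : nm (x - u n) ^+ 2 <= (d + e) ^+ 2.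
    by rewrite ler_sqr ?nnegrE ?nm_ge0 ?addr_ge0// ltW.
  nra.
have [|y /cvg_nmP uy] := complete_nm (u := u).
  move=> r r0; pose e := Num.min 1 (r ^+ 2 / (8 * d + 5)).
  have e0 : 0 < e by rewrite lt_min ltr01 divr_gt0 ?exprn_gt0//; lra.
  have [N Ne] := inv_natS_lt e0; exists N => m n Nm Nn.
  rewrite -ltr_sqr ?nnegrE ?nm_ge0 ?(ltW r0)//.
  have um k : (N <= k)%N -> nm (x - u k) < d + e.
    by move=> Nk; apply: lt_trans (uP k).2 _; rewrite ltrD2l Ne.
  apply: le_lt_trans (par e m n (ltW e0) _ (um m Nm) (um n Nn)) _.
    by rewrite ge_min lexx.
  apply: (@lt_le_trans _ _ ((8 * d + 5) * e)); first by rewrite ltr_pM2r//; lra.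
  by rewrite mulrC -ler_pdivlMr; [rewrite ge_min lexx orbT|lra].
have Ky : K y.
  by apply: Kcl => r /uy[N /(_ N (leqnn N)) uNy]; exists (u N); rewrite // nmBC.
have xy : nm (x - y) <= d.
  rewrite -subr_le0; apply: (le0_small (C := 2)) => // r r0.
  have [N Nr] := inv_natS_lt r0; have [M Mr] := uy r r0.
  have := Mr _ (leq_maxr N M); have := Nr _ (leq_maxl N M); set n := maxn N M.
  have := nm_triangle (u n) x y; have := (uP n).2; set z := n.+1%:R^-1; lra.
exists y => // k Kk.
have q t : 0 <= t ^+ 2 * nm k ^+ 2 - 2 * t * b (x - y) k.
  have := dle _ (KD _ _ Ky (KZ t%:C _ Kk)).
  rewrite opprD addrA => dt; have : nm (x - y) ^+ 2 <= nm (x - y - t%:C *: k) ^+ 2.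
    by rewrite ler_sqr ?nnegrE ?nm_ge0// (le_trans xy).
  by rewrite [leRHS]nm_sub_sqr (siZrr Hb.1) nmZr exprMn real_normK ?num_real//; lra.
have k0 : 0 <= nm k ^+ 2 := sqr_ge0 _.
(* The optimal parameter would divide by the squared norm of [k]; adding 1 covers k = 0 and still
   forces the product to vanish. *)
have := q (b (x - y) k / (nm k ^+ 2 + 1)).
set B := b (x - y) k; set N := nm k ^+ 2 in k0 *.
have N1 : 0 < N + 1 by lra.
have -> : (B / (N + 1)) ^+ 2 * N - 2 * (B / (N + 1)) * B =
    - (B ^+ 2 * (N + 2) / (N + 1) ^+ 2) by field; exact: lt0r_neq0.
rewrite oppr_ge0 pmulr_lle0 ?invr_gt0 ?exprn_gt0//.
rewrite pmulr_lle0; last by lra.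
by move=> B0; apply/eqP; rewrite -sqrf_eq0 eq_le B0 sqr_ge0.
Qed.

End Projection.

(** * The GNS construction and irreducible representations *)

Section GNS.
Context {R : realType} {B : starAlgType R} {p : B -> R} (cn : cstar_norm p).
Variable e : B.
Hypothesis e1 : forall x, e ** x = x.
Hypothesis ee : forall x, x ** e = x.
Variable I : set B.
Hypothesis HI : cn_ideal (p := p) I.

(** The real part of a state of the quotient by [I]. It determines the state, and real functionals
    are what the sublinear argument produces. *)
Definition state (f : B -> R) := [/\ real_linear f, forall x, f (adj x) = f x,
  forall x, @pos R B p e x -> 0 <= f x, f e = 1 & forall j, I j -> f j = 0].

Section Construction.
Variable f : B -> R.
Hypothesis Hf : state f.
Implicit Types a b c x : B.

Definition gns_form a b := f (adj b ** a).

Lemma gns_semi_inner : semi_inner gns_form.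
Proof.
have [[fD fZ] fadj fpos _ _] := Hf; rewrite /gns_form.
split=> [a b|a b c|t a b|c a b|a].
- by rewrite -fadj adjM adjK.
- by rewrite smulDr fD.
- by rewrite smulZr fZ.
- by rewrite adjZ conjCK smulZl smulZr.
- by apply: fpos; exact: (pos_adjM cn e1 ee).
Qed.

Let Hs := gns_semi_inner.
Let H := hdual Hs.

Lemma gns_form_le a b : gns_form (a ** b) (a ** b) <= p a ^+ 2 * gns_form b b.
Proof.
have [[fD fZ] fadj fpos _ _] := Hf.
have /fpos := pos_conj cn e1 ee b (cn_sqr_sub cn ee a).
rewrite /gns_form !smulDr smulDl !smulNr smulNl smulZr smulZl ee fD.
have -> : f (- (adj b ** (adj a ** a) ** b)) = - f (adj (a ** b) ** (a ** b)).
  by rewrite real_linearN// adjM !smulA.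
by rewrite fZ; lra.
Qed.

Lemma gns_rep_subproof c (g : H) : (fun b => g (adj c ** b)) \in dual_bounded Hs.
Proof.
have [[gD gZ] _] := hdualP g; apply/dual_boundedP; split.
  by split=> *; rewrite ?smulDr ?smulZr.
exists `|hN g * p c ^+ 2| => b.
apply: (CS_functional Hs (g := fun b => g (adj c ** b))).
apply: le_trans (hdual_CS g _) _; rewrite -mulrA ler_wpM2l ?hN_ge0//.
by rewrite -(cn_adj cn c) gns_form_le.
Qed.

(** Reads Re <c g, b> = Re <g, c^* b>. On the dual, the operator is defined at once on the whole
    completion. *)
Definition gns_rep c (g : H) : H := HDual (gns_rep_subproof c g).

Lemma gns_repE c g b : gns_rep c g b = g (adj c ** b). Proof. by []. Qed.

Lemma gns_rep_vec c a : gns_rep c (hvec Hs a) = hvec Hs (c ** a).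
Proof.
apply: hdual_eq => b; rewrite gns_repE !hvecE /gns_form.
by rewrite adjM adjK smulA.
Qed.

Lemma gns_rep_linear c : linear (gns_rep c).
Proof.
move=> k g h; apply: hdual_eq => b; rewrite gns_repE !hdualD !hdualZ gns_repE.
by rewrite smulZr.
Qed.

Lemma gns_rep_bound c g : nm (gns_rep c g) <= p c * nm g.
Proof.
rewrite !nm_hdual; apply: hnorm_le; first by rewrite mulr_ge0 ?hnorm_ge0 ?(cn_ge0 cn).
rewrite exprMn hnorm_sqr; apply: hN_le => b.
have K0 : 0 <= p c ^+ 2 * hN g by rewrite mulr_ge0 ?sqr_ge0 ?hN_ge0.
rewrite -(ger0_norm K0); apply: (CS_functional Hs); rewrite gns_repE.
apply: le_trans (hdual_CS g _) _; rewrite [p c ^+ 2 * _]mulrC -mulrA.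
by rewrite ler_wpM2l ?hN_ge0// -(cn_adj cn c) gns_form_le.
Qed.

Lemma gns_hBJ c (g h : H) : hB (gns_rep c g) h = hB g (gns_rep (adj c) h).
Proof.
have [C C0 hC] := hB_approx (gns_rep c g) h.
have [D D0 hD] := hB_approx g (gns_rep (adj c) h).
pose k := p (adj c); have k0 : 0 <= k := cn_ge0 cn _.
have K0 : 0 < 1 + k by rewrite ltr_pwDl.
apply/eqP; rewrite -subr_eq0; apply/eqP.
apply: (hB_unique (h := (1 + k)%:C *: h)).
exists (C + D * k) => [|a]; first by rewrite addr_ge0// mulr_ge0.
have [a' ->] : exists a', a = (1 + k)%:C *: a'.
  exists ((1 + k)^-1%:C *: a).
  by rewrite scalerA -rmorphM/= mulfV ?scale1r//; exact: lt0r_neq0.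
rewrite hvecZ -scalerBr nmZr gtr0_norm// => a1.
have h0 := nm_ge0 (h - hvec Hs a').
have bnd : nm (gns_rep (adj c) h - hvec Hs (adj c ** a')) <=
    k * nm (h - hvec Hs a').
  have [_ gD gN _] := linear_scaleD (gns_rep_linear (adj c)).
  by rewrite -gns_rep_vec -gN -gD gns_rep_bound.
have := hD (adj c ** a') ltac:(nra); have := hC a' ltac:(nra).
rewrite gns_repE => Ca Da.
have -> : hB (gns_rep c g) h - hB g (gns_rep (adj c) h) =
  (hB (gns_rep c g) h - g (adj c ** a')) -
  (hB g (gns_rep (adj c) h) - g (adj c ** a')) by ring.
apply: le_trans (ler_normB _ _) _; apply: le_trans (lerD Ca Da) _.
have := mulr_ge0 (mulr_ge0 (addr_ge0 C0 (mulr_ge0 D0 k0)) k0) h0.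
have := ler_wpM2l D0 bnd; lra.
Qed.

Lemma hB_real_inner : real_inner (@hB _ _ _ Hs).
Proof.
split; last exact: hB_self.
split=> [g h|g h k|t g h|c g h|g].
- exact: hBC.
- exact: hBD.
- exact: hBZr.
- exact: hBJ.
- by rewrite hB_self sqr_ge0.
Qed.

Definition gns_ip := complex_inner (@hB _ _ _ Hs).

Lemma gns_representation : is_representation gns_ip gns_rep.
Proof.
split=> [a|g c a b|a b g|a g h].
- split; first exact: gns_rep_linear.
  apply: (linear_bounded_continuous_nm (C := p a)); first exact: gns_rep_linear.
  by move=> g; exact: gns_rep_bound.
- apply: hdual_eq => x; rewrite hdualD hdualZ !gns_repE adjD adjZ smulDl smulZl.
  by rewrite (hdualP g).1.1 smulZr.
- by apply: hdual_eq => x; rewrite !gns_repE adjM smulA.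
- rewrite /gns_ip /complex_inner !gns_hBJ; congr (_ + _ * (hB _ _)%:C).
  by have [_ _ _ ->] := linear_scaleD (gns_rep_linear (adj a)).
Qed.

Definition gns_vec : H := hvec Hs e.

Lemma gns_cyclic a : gns_rep a gns_vec = hvec Hs a.
Proof. by rewrite gns_rep_vec ee. Qed.

Lemma gns_state a : hB (gns_rep a gns_vec) gns_vec = f a.
Proof.
by rewrite hB_vec gns_cyclic hvecE /gns_form (adj_unit ee) e1.
Qed.

Lemma gns_vec_nm : nm gns_vec = 1.
Proof.
have [_ _ _ fe _] := Hf.
rewrite nm_hdual /hnorm hN_vec /gns_form (adj_unit ee) e1 fe; exact: sqrtr1.
Qed.

Lemma gns_kills j g : I j -> gns_rep j g = 0.
Proof.
move=> Ij; have [_ _ _ _ fI] := Hf; apply: hdual_eq => b; rewrite gns_repE hdual0.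
apply/eqP; rewrite -sqrf_eq0 eq_le sqr_ge0 andbT.
apply: le_trans (hdual_CS g _) _; rewrite /gns_form fI ?mulr0//.
by apply: (cniMl HI); apply: (cniMr HI); exact: (cni_adj HI).
Qed.

Hypothesis f_extreme : forall f1 f2 t, state f1 -> state f2 -> 0 < t < 1 ->
  (forall x, t * f1 x + (1 - t) * f2 x = f x) -> forall x, f1 x = f x.

Lemma vector_state (k : H) t : 0 < t -> nm k ^+ 2 = t ->
  state (fun x => hB (gns_rep x k) k / t).
Proof.
move=> t0 kt; have [_ rZ rM rJ] := gns_representation.
have [[Hb _] bnm] := (hB_real_inner, tt).
have rD x y : gns_rep (x + y) k = gns_rep x k + gns_rep y k.
  by have := rZ k 1 x y; rewrite !scale1r.
split=> [|x|x /(pos_sqrt cn e1 ee)[y [[yy _] <- _]]||j Ij].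
- split=> [x y|c x]; first by rewrite rD hBD mulrDl.
  have r0 : gns_rep 0 k = 0.
    by have := rD 0 0; rewrite addr0 => /eqP; rewrite -subr_eq0 opprD addNKr oppr_eq0 => /eqP.
  by have := rZ k c%:C x 0; rewrite r0 !addr0 => ->; rewrite hBZr mulrA.
- by rewrite gns_hBJ adjK hBC.
- by rewrite rM gns_hBJ yy hB_self mulr_ge0 ?sqr_ge0 ?invr_ge0// ltW.
- have -> : gns_rep e k = k.
    by apply: hdual_eq => b; rewrite gns_repE (adj_unit ee) e1.
  by rewrite hB_self kt divff// gt_eqF.
- by rewrite gns_kills// (siC Hb) -(scale0r k) -[0]/(0%:C) (siZrr Hb) mul0r mul0r.
Qed.

(** Split the cyclic vector as y + z with y its projection onto [K]. If both parts are non-zero, [f]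
    is a convex combination of their vector states; extremality makes y equal to t times the cyclic
    vector, hence z to 1 - t times it, and orthogonality gives t (1 - t) = 0. *)
Lemma gns_irreducible : irreducible_representation gns_rep.
Proof.
have [rl rZ rM rJ] := gns_representation; have Hb := hB_real_inner.
split.
  exists e, gns_vec; rewrite gns_cyclic -/gns_vec; apply/eqP => v0.
  by have := gns_vec_nm; rewrite v0 nm0 => /eqP; rewrite eq_sym oner_eq0.
move=> K Ksub Kinv; have [K0 KZD Kcl] := Ksub.
have [y Ky yK] := projection Hb gns_vec Ksub.
have [z zdef] : exists z, z = gns_vec - y by exists (gns_vec - y).
rewrite -zdef in yK.
have orth x : hB (gns_rep x y) z = 0.
  by rewrite hBC; apply: yK; exact: Kinv.
have orth' x : hB (gns_rep x z) y = 0.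
  by rewrite gns_hBJ hBC orth.
have [y0|y0] := eqVneq y 0.
  left; apply/seteqP; split=> [k Kk|_ ->//].
  apply: hdual_eq => b; rewrite hdual0 -hB_vec hBC -gns_cyclic gns_hBJ.
  by have := yK _ (Kinv (adj b) k Kk); rewrite zdef y0 subr0.
have [z0|z0] := eqVneq z 0.
  right; apply/seteqP; split=> // g _; move/closed_nmP: Kcl; apply => d d0.
  have [a ga] := hvec_dense g d0; exists (hvec Hs a) => //.
  rewrite -gns_cyclic; apply: Kinv; move/eqP: z0; rewrite zdef subr_eq0 => /eqP ->.
  exact: Ky.
exfalso; have vE : gns_vec = y + z by rewrite zdef addrC subrK.
have yz : hB y z = 0 by rewrite hBC; apply: yK.
pose t := nm y ^+ 2; have zt : nm z ^+ 2 = 1 - t.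
  have := gns_vec_nm; rewrite vE => /(congr1 (fun u => u ^+ 2)).
  by rewrite (nm_add_sqr Hb) yz expr1n /t; lra.
have sq0 (w : H) : w != 0 -> 0 < nm w ^+ 2.
  move=> w0; rewrite exprn_gt0// lt_neqAle nm_ge0 andbT eq_sym.
  by apply: contraNneq w0 => /nm0_eq0 ->.
have t0 : 0 < t := sq0 y y0; have t1 : 0 < 1 - t by rewrite -zt; exact: sq0.
have fE : forall x, hB (gns_rep x y) y / t = f x.
  apply: (f_extreme (f2 := fun x => hB (gns_rep x z) z / (1 - t)) (t := t)).
  - exact: vector_state.
  - exact: vector_state.
  - by rewrite t0; lra.
  move=> x; rewrite -gns_state vE.
  have [_ -> _ _] := linear_scaleD (rl x).1.
  rewrite hBD !(siDr Hb.1) orth orth'.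
  rewrite [hB (gns_rep x y) y / t]mulrC mulVKf ?gt_eqF//.
  by rewrite [hB (gns_rep x z) z / (1 - t)]mulrC mulVKf ?gt_eqF//; ring.
have yE : y = t%:C *: gns_vec.
  apply: hdual_eq => b; rewrite hdualZr hvecE /gns_form ee -fE.
  rewrite -hB_vec -gns_cyclic [LHS]hBC [LHS]gns_hBJ [LHS]hBC vE (siDr Hb.1).
  rewrite orth addr0.
  by rewrite mulrC divfK// gt_eqF.
have : hB y z = t * (1 - t).
  have zE : z = (1 - t)%:C *: gns_vec.
    by rewrite zdef {1}yE; lincomb.
  by rewrite zE {1}yE hBZr (siZrr Hb.1) hB_self gns_vec_nm expr1n mulr1.
by rewrite yz => /esym/eqP; rewrite mulf_eq0 !gt_eqF.
Qed.

End Construction.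
End GNS.

Section IrreducibleRepresentations.
Context {R : realType} {B : starAlgType R} {p : B -> R} (cn : cstar_norm p).
Variable e : B.
Hypothesis e1 : forall x, e ** x = x.
Hypothesis ee : forall x, x ** e = x.
Variable I : set B.
Hypothesis HI : cn_ideal (p := p) I.
Implicit Types x y a : B.

Local Notation pos := (@pos R B p e).
Local Notation state := (@state R B p e I).

Definition re_part x : B := (2^-1)%:C *: (x + adj x).

Lemma re_part_sa x : adj (re_part x) = re_part x.
Proof. by rewrite /re_part !adjE addrC. Qed.

Lemma re_part_id x : adj x = x -> re_part x = x.
Proof. by rewrite /re_part => ->; lincomb. Qed.

Lemma re_partD x y : re_part (x + y) = re_part x + re_part y.
Proof. by rewrite /re_part adjD; lincomb. Qed.

Lemma re_partZ (t : R) x : re_part (t%:C *: x) = t%:C *: re_part x.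
Proof. by rewrite /re_part adjZr; lincomb. Qed.

Definition upper_bounds x : set R :=
  [set s | exists j, [/\ I j, adj j = j & pos (s%:C *: e - re_part x + j)]].

(** The largest spectral value of the real part of [x] modulo [I]. States are exactly the
    real-linear functionals below it. *)
Definition sup_mod x := inf (upper_bounds x).

Lemma upper_bound_norm x : upper_bounds x (p (re_part x)).
Proof.
exists 0; rewrite adj0 addr0; split=> //; first exact: (cni0 HI).
exact/(pos_sa_norm cn ee)/re_part_sa.
Qed.

Lemma upper_boundD x y s t : upper_bounds x s -> upper_bounds y t ->
  upper_bounds (x + y) (s + t).
Proof.
move=> [j [Ij jj pj]] [k [Ik kk pk]]; exists (j + k); split.
- exact: (cniD HI).
- by rewrite adjD jj kk.
have -> : (s + t)%:C *: e - re_part (x + y) + (j + k) =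
    (s%:C *: e - re_part x + j) + (t%:C *: e - re_part y + k).
  by rewrite re_partD; lincomb.
exact: (posD cn).
Qed.

Lemma upper_boundZ c x s : 0 < c -> upper_bounds x s -> upper_bounds (c%:C *: x) (c * s).
Proof.
move=> c0 [j [Ij jj pj]]; exists (c%:C *: j); split.
- exact: (cniZ HI).
- by rewrite adjZr jj.
have -> : (c * s)%:C *: e - re_part (c%:C *: x) + c%:C *: j =
    c%:C *: (s%:C *: e - re_part x + j) by rewrite re_partZ; lincomb.
exact: (posZ cn (ltW c0)).
Qed.

Lemma upper_bound_le x s t : s <= t -> upper_bounds x s -> upper_bounds x t.
Proof.
move=> st [j [Ij jj pj]]; exists j; split=> //.
have -> : t%:C *: e - re_part x + j =
    (t - s)%:C *: e + (s%:C *: e - re_part x + j) by lincomb.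
by apply: (posD cn) => //; apply: (pos_unit cn ee); rewrite subr_ge0.
Qed.

(** [ideal_dist] with s = d^2 / 8 finds an element of [I] within d / 2 of [a], and [I] is closed. *)
Lemma upper_bounds_ideal a : (forall s, 0 < s -> upper_bounds (adj a ** a) s) -> I a.
Proof.
move=> ub; apply: (cni_closed HI) => d d0.
have d8 : 0 < d ^+ 2 / 8 by rewrite divr_gt0 ?exprn_gt0.
have [j [Ij jj pj]] := ub _ d8.
rewrite re_part_id ?adjM ?adjK// addrAC in pj.
have [i Ii ai] := ideal_dist cn e1 ee HI d8 Ij jj pj.
exists i => //; rewrite -ltr_sqr ?nnegrE ?(cn_ge0 cn) ?(ltW d0)//.
by apply: le_lt_trans ai _; have := exprn_gt0 2 d0; lra.
Qed.

Hypothesis nIe : ~ I e.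

(** A negative upper bound of 0, rescaled to -1, yields [j] in [I] with j - e positive; then e^* e =
    e has 0 as an upper bound, so [e] would lie in [I]. *)
Lemma upper_bounds0 s : upper_bounds 0 s -> 0 <= s.
Proof.
move=> ub; rewrite leNgt; apply/negP => s0; apply: nIe; apply: upper_bounds_ideal.
move=> t t0; rewrite (adj_unit ee) e1.
apply: (@upper_bound_le _ 0); first exact: ltW.
have s1 : 0 < (- s)^-1 by rewrite invr_gt0 oppr_gt0.
have [j [Ij jj]] := upper_boundZ s1 ub.
have -> : (- s)^-1 * s = -1 by rewrite invrN mulNr mulVf// lt_eqF.
rewrite scaler0 [re_part 0]re_part_id ?adj0// => pj.
exists j; split=> //; rewrite re_part_id ?(adj_unit ee)//.
by have <- : (-1)%:C *: e - 0 + j = 0%:C *: e - e + j by lincomb.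
Qed.

Lemma upper_bounds_lbound x : has_lbound (upper_bounds x).
Proof.
exists (- p (re_part (- x))) => s /upper_boundD/(_ (upper_bound_norm (- x))).
by rewrite subrr => /upper_bounds0; lra.
Qed.

Lemma sup_mod_le x s : upper_bounds x s -> sup_mod x <= s.
Proof. by move=> ub; apply: ge_inf => //; exact: upper_bounds_lbound. Qed.

Lemma sup_mod_ge x c : (forall s, upper_bounds x s -> c <= s) -> c <= sup_mod x.
Proof.
by move=> cs; apply: lb_le_inf; [exists (p (re_part x)); exact: upper_bound_norm|].
Qed.

Lemma sublinear_sup_mod : sublinear sup_mod.
Proof.
split=> [x y|c x c0].
  rewrite -lerBlDr; apply: sup_mod_ge => s sx; rewrite lerBlDr -lerBlDl.
  apply: sup_mod_ge => t ty; rewrite lerBlDl; apply: sup_mod_le.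
  exact: upper_boundD.
rewrite -ler_pdivrMl//; apply: sup_mod_ge => s sx; rewrite ler_pdivrMl//.
exact/sup_mod_le/upper_boundZ.
Qed.

Lemma state_le_sup_mod f : state f -> forall x, f x <= sup_mod x.
Proof.
move=> [fl fadj fpos fe fI] x; apply: sup_mod_ge => s [j [Ij jj /fpos]].
have [fD fZ] := fl; have fN y := real_linearN y fl.
rewrite !fD (fI j Ij) fN fZ fe /re_part fZ fD fadj; lra.
Qed.

Lemma state_of_le_sup_mod f : real_linear f -> (forall x, f x <= sup_mod x) -> state f.
Proof.
move=> fl fle; have [fD fZ] := fl; have fN x := real_linearN x fl.
have ub0 x : re_part x = 0 -> f x <= 0.
  move=> x0; apply: le_trans (fle x) _; apply: sup_mod_le; exists 0.
  rewrite x0 adj0 subr0 addr0 scale0r; split=> //; first exact: (cni0 HI).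
  exact: (pos0 cn ee).
have f0 x : re_part x = 0 -> f x = 0.
  move=> x0; apply/eqP; rewrite eq_le ub0//= -oppr_le0 -fN ub0//.
  by rewrite -scaleN1r -(rmorphN1 (real_complex R)) re_partZ x0 scaler0.
have fIle j : I j -> f j <= 0.
  move=> Ij; apply: le_trans (fle j) _; apply: sup_mod_le; exists (re_part j).
  rewrite scale0r sub0r addNr; split; [|exact: re_part_sa|exact: (pos0 cn ee)].
  by apply: (cniZ HI); apply: (cniD HI) => //; exact: (cni_adj HI).
split=> //.
- move=> x; apply/eqP; rewrite -subr_eq0 -fN -fD f0//.
  by rewrite /re_part !adjE; lincomb.
- move=> x px; rewrite -oppr_le0 -fN; apply: le_trans (fle _) _.
  apply: sup_mod_le; exists 0; split; [exact: (cni0 HI)|exact: adj0|].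
  by rewrite re_part_id ?adjN ?(pos_sa px)// opprK scale0r add0r addr0.
- apply/eqP; rewrite eq_le; apply/andP; split.
    apply: le_trans (fle _) _; apply: sup_mod_le; exists 0.
    split; [exact: (cni0 HI)|exact: adj0|].
    rewrite re_part_id ?(adj_unit ee)// scale1r subrr addr0.
    exact: (pos0 cn ee).
  rewrite -lerN2 -fN; apply: le_trans (fle _) _; apply: sup_mod_le; exists 0.
  split; [exact: (cni0 HI)|exact: adj0|].
  rewrite re_part_id ?adjN ?(adj_unit ee)// opprK addr0 rmorphN scaleN1r addNr.
  exact: (pos0 cn ee).
- move=> j Ij; apply/eqP; rewrite eq_le fIle//= -oppr_le0 -fN fIle//.
  by rewrite -scaleN1r; exact: (cniZ HI).
Qed.

(** An extreme state attaining [sup_mod] at h = a^* a makes the squared norm of pi a xi equal to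
    sup_mod h. This is non-zero because [a] is not in [I], and at least p(a)^2 when [I] is zero. *)
Theorem irreducible_rep_exists a : ~ I a ->
  exists (H : completeNormedModType R[i]) (ip : H -> H -> R[i]) (pi : B -> H -> H) (xi : H),
  [/\ is_inner_product ip, is_representation ip pi, irreducible_representation pi,
     (forall j (y : H), I j -> pi j y = 0) &
     [/\ nm xi = 1, pi a xi != 0 & (I = [set 0] -> p a <= nm (pi a xi))]].
Proof.
move=> nIa; pose h := adj a ** a.
have [f [fl fle fh ff]] := extreme_functional h sublinear_sup_mod.
have Hf := state_of_le_sup_mod fl fle.
have fext : forall f1 f2 t, state f1 -> state f2 -> 0 < t < 1 ->
    (forall x, t * f1 x + (1 - t) * f2 x = f x) -> forall x, f1 x = f x.
  move=> f1 f2 t s1 s2 t01 f12 x; have [l1 _ _ _ _] := s1; have [l2 _ _ _ _] := s2.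
  have le1 : forall y, f1 y <= f y.
    apply: (ff f1 f2 t) => //; try exact: state_le_sup_mod.
    by move=> y; rewrite f12.
  apply/eqP; rewrite eq_le le1/=.
  by have := le1 (- x); rewrite !real_linearN// lerN2.
have Hin := hB_real_inner cn e1 ee Hf.
have Hrep := gns_representation cn e1 ee Hf.
pose pi := @gns_rep _ _ _ cn e e1 ee I f Hf.
pose xi := @gns_vec _ _ _ cn e e1 ee I f Hf.
have pia : nm (pi a xi) ^+ 2 = sup_mod h.
  rewrite -fh -(gns_state cn e1 ee Hf) -hB_self /pi [LHS]gns_hBJ [LHS]hBC.
  by have [_ _ rM _] := Hrep; rewrite -rM.
exists (hdual (gns_semi_inner cn e1 ee Hf)), (@gns_ip _ _ _ cn e e1 ee I f Hf), pi, xi.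
split=> //; first exact: complex_innerP.
- exact: gns_irreducible.
- by move=> j x; exact: gns_kills.
split; first exact: gns_vec_nm.
- apply: contra_notN nIa => /eqP pia0; apply: upper_bounds_ideal => s s0.
  have /(_ s s0)[|t ut ts] := @inf_adherent _ (upper_bounds h).
    split; last exact: upper_bounds_lbound.
    by exists (p (re_part h)); exact: upper_bound_norm.
  apply: upper_bound_le ut; apply: ltW; apply: lt_le_trans ts _.
  by rewrite -/(sup_mod h) -pia pia0 nm0 expr0n add0r.
- move=> I0; rewrite -ler_sqr ?nnegrE ?nm_ge0 ?(cn_ge0 cn)// pia -(cnC cn).
  apply: sup_mod_ge => s us; have ph := pos_adjM cn e1 ee a.
  have hh := pos_sa ph; have [j []] := us; rewrite I0 => -> _.
  rewrite re_part_id// addr0 => ps; apply: (pos_norm_le cn e1 ee) => //.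
  apply: upper_bounds0; exists 0; split; [exact: (cni0 HI)|exact: adj0|].
  rewrite [re_part 0]re_part_id ?adj0// subr0 addr0.
  by rewrite -(subrK h (s%:C *: e)); exact: (posD cn).
Qed.

End IrreducibleRepresentations.

(** * The multiplier algebra *)

Section OperatorNorm.
Context {R : realType} {A : cstarAlgType R}.
Implicit Types (a b c : A) (m : multiplier A).

Let cnA := cstar_norm_nm A.

Lemma smul_nondeg a : (forall b, a ** b = 0) -> a = 0.
Proof.
move=> a0; rewrite -[a]adjK; suff -> : adj a = 0 by rewrite adj0.
apply: (cn_eq0 cnA); have := cnC cnA (adj a); rewrite adjK a0 nm0.
by move=> /esym/eqP; rewrite sqrf_eq0 => /eqP.
Qed.

Lemma mult1_linear m : linear m.1. Proof. by have [[]] := multiplierP m. Qed.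
Lemma mult2_linear m : linear m.2. Proof. by have [_ []] := multiplierP m. Qed.
Lemma mult_bal m a b : a ** m.1 b = m.2 a ** b.
Proof. by have [] := multiplierP m. Qed.

Lemma smul_nondegl a : (forall b, b ** a = 0) -> a = 0.
Proof.
move=> a0; rewrite -[a]adjK; suff -> : adj a = 0 by rewrite adj0.
by apply: smul_nondeg => b; rewrite -[b]adjK -adjM a0 adj0.
Qed.

(** Module linearity is automatic: multiply by an arbitrary [c], move the multiplier across, and use
    non-degeneracy. *)
Lemma mult1M m a b : m.1 (a ** b) = m.1 a ** b.
Proof.
apply/eqP; rewrite -subr_eq0; apply/eqP; apply: smul_nondegl => c.
by rewrite smulDr smulNr mult_bal !smulA mult_bal subrr.
Qed.

Lemma mult2M m a b : m.2 (a ** b) = a ** m.2 b.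
Proof.
apply/eqP; rewrite -subr_eq0; apply/eqP; apply: smul_nondeg => c.
by rewrite smulDl smulNl -mult_bal -!smulA -mult_bal subrr.
Qed.

Lemma mult_adj1 m a : (adj m).1 a = adj (m.2 (adj a)). Proof. by []. Qed.
Lemma mult_smul1 m (n : multiplier A) a : (m ** n).1 a = m.1 (n.1 a). Proof. by []. Qed.
Lemma mult_smul2 m (n : multiplier A) a : (m ** n).2 a = n.2 (m.2 a). Proof. by []. Qed.

Definition opn m : R := sup [set nm (m.1 a) | a in [set a | nm a <= 1]].

Lemma opn_hassup m : has_sup [set nm (m.1 a) | a in [set a | nm a <= 1]].
Proof.
split; first by exists (nm (m.1 0)); exists 0; rewrite //= nm0 ler01.
have [[ml mc] _ _] := multiplierP m.
have [C C0 mC] := linear_continuous_bounded_nm ml mc.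
exists C => _ [a /= a1 <-]; apply: le_trans (mC a) _.
by rewrite -[leRHS]mulr1 ler_wpM2l.
Qed.

Lemma opn_ge0 m : 0 <= opn m.
Proof.
apply: le_trans (nm_ge0 (m.1 0)) _; apply: ub_le_sup.
  by case: (opn_hassup m).
by exists 0; rewrite //= nm0 ler01.
Qed.

Lemma opn_bound m a : nm (m.1 a) <= opn m * nm a.
Proof.
have [m0 mD mN mZ] := linear_scaleD (@mult1_linear m).
have [->|a0] := eqVneq a 0; first by rewrite m0 nm0 mulr0.
have pa : 0 < nm a.
  by rewrite lt_neqAle nm_ge0 andbT eq_sym; apply: contraNneq a0 => /nm0_eq0 ->.
rewrite -ler_pdivrMr//.
have -> : nm (m.1 a) / nm a = nm (m.1 ((nm a)^-1%:C *: a)).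
  by rewrite mZ nmZr gtr0_norm ?invr_gt0// mulrC.
apply: ub_le_sup; first by case: (opn_hassup m).
exists ((nm a)^-1%:C *: a) => //=.
by rewrite nmZr gtr0_norm ?invr_gt0// mulVf// gt_eqF.
Qed.

Lemma opn_le m C : 0 <= C -> (forall a, nm (m.1 a) <= C * nm a) -> opn m <= C.
Proof.
move=> C0 mC; apply: ge_sup; first by case: (opn_hassup m).
move=> _ [a /= a1 <-]; apply: le_trans (mC a) _.
by rewrite -[leRHS]mulr1 ler_wpM2l.
Qed.

(** By the C*-identity of [A], the squared norm of m a is the norm of a^* times the image of [a]
    under m^* m. *)
Lemma opn_adjM_ge m : opn m ^+ 2 <= opn (adj m ** m).
Proof.
rewrite -[leRHS]sqr_sqrtr ?opn_ge0// ler_sqr ?nnegrE ?opn_ge0 ?sqrtr_ge0//.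
apply: opn_le; first exact: sqrtr_ge0.
move=> a; rewrite -ler_sqr ?nnegrE ?mulr_ge0 ?nm_ge0 ?sqrtr_ge0//.
rewrite exprMn sqr_sqrtr ?opn_ge0// -(cnC cnA).
have -> : adj (m.1 a) ** m.1 a = adj a ** (adj m ** m).1 a.
  rewrite mult_smul1 mult_adj1; apply: (can_inj adjK).
  by rewrite !adjM !adjK mult_bal.
have := cnM cnA (adj a) ((adj m ** m).1 a); rewrite (cn_adj cnA).
have := opn_bound (adj m ** m) a; have := nm_ge0 a; nra.
Qed.

Lemma opn_smul_le m (n : multiplier A) : opn (m ** n) <= opn m * opn n.
Proof.
apply: opn_le; first by rewrite mulr_ge0 ?opn_ge0.
move=> a; rewrite mult_smul1; apply: le_trans (opn_bound _ _) _.
by rewrite -mulrA ler_wpM2l ?opn_ge0// opn_bound.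
Qed.

Lemma opn_adj m : opn (adj m) = opn m.
Proof.
have le n : opn n <= opn (adj n).
  have := le_trans (opn_adjM_ge n) (opn_smul_le (adj n) n).
  have := opn_ge0 n; rewrite le_eqVlt => /predU1P[<- _|n0]; first exact: opn_ge0.
  by rewrite expr2 ler_pM2r.
by apply/eqP; rewrite eq_le le andbT -{2}(adjK m) le.
Qed.

Lemma opn_bound2 m a : nm (m.2 a) <= opn m * nm a.
Proof.
by rewrite -opn_adj -(cn_adj cnA a) -(cn_adj cnA) -[a in m.2 a]adjK -mult_adj1 opn_bound.
Qed.

Lemma nm_le_lim (V : normedModType R[i]) (u : nat -> V) l C N :
  u n @[n --> \oo] --> l -> (forall n, (N <= n)%N -> nm (u n) <= C) -> nm l <= C.
Proof.
move=> /cvg_nmP ul uC; rewrite -subr_le0; apply: (le0_small ler01) => d /ul[M uM].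
have := uC _ (leq_maxl N M); have := uM _ (leq_maxr N M).
have := nm_triangle (u (maxn N M)) l 0; rewrite !subr0 (nmBC l); lra.
Qed.

Lemma cvg_smull (u : nat -> A) l a :
  u n @[n --> \oo] --> l -> (a ** u n) @[n --> \oo] --> a ** l.
Proof.
move=> /cvg_nmP ul; apply/cvg_nmP => d d0.
have a1 : 0 < nm a + 1 by rewrite ltr_wpDl ?nm_ge0.
have [|N uN] := ul (d / (nm a + 1)); first by rewrite divr_gt0.
exists N => n /uN; rewrite ltr_pdivlMr// -smulNr -smulDr => lt.
apply: le_lt_trans (cnM cnA _ _) _; apply: le_lt_trans lt.
have := nm_ge0 (u n - l); have := nm_ge0 a; nra.
Qed.

Lemma cvg_adj (u : nat -> A) l :
  u n @[n --> \oo] --> l -> adj (u n) @[n --> \oo] --> adj l.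
Proof.
move=> /cvg_nmP ul; apply/cvg_nmP => d /ul[N uN]; exists N => n /uN.
by rewrite -adjN -adjD (cn_adj cnA).
Qed.

Lemma cvg_smulr (u : nat -> A) l a :
  u n @[n --> \oo] --> l -> (u n ** a) @[n --> \oo] --> l ** a.
Proof.
move=> /cvg_adj/(@cvg_smull _ _ (adj a))/cvg_adj.
by rewrite adjM !adjK; under eq_fun do rewrite adjM !adjK.
Qed.

Lemma cvg_mult1 (u : nat -> A) l m :
  u n @[n --> \oo] --> l -> m.1 (u n) @[n --> \oo] --> m.1 l.
Proof.
have [[_ mc] _ _] := multiplierP m => ul.
exact: (cvg_comp _ _ ul (mc l)).
Qed.

Lemma cvg_mult2 (u : nat -> A) l m :
  u n @[n --> \oo] --> l -> m.2 (u n) @[n --> \oo] --> m.2 l.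
Proof.
have [_ [_ mc] _] := multiplierP m => ul.
exact: (cvg_comp _ _ ul (mc l)).
Qed.

Lemma opn_complete (u : nat -> multiplier A) :
  (forall d : R, 0 < d -> exists N, forall m n : nat, (N <= m)%N -> (N <= n)%N ->
    opn (u m - u n) < d) ->
  exists l, forall d, 0 < d -> exists N, forall n, (N <= n)%N -> opn (u n - l) < d.
Proof.
move=> uc.
have cauchy (v : multiplier A -> A) K : (forall m n : multiplier A, v (m - n) = v m - v n) ->
    (forall m, nm (v m) <= opn m * K) -> 0 <= K ->
    exists l : A, v (u n) @[n --> \oo] --> l.
  move=> vB vK K0; apply: (complete_nm (u := fun n => v (u n))) => d d0.
  have K1 : 0 < K + 1 by rewrite ltr_wpDl.
  have [|N uN] := uc (d / (K + 1)); first by rewrite divr_gt0.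
  exists N => i j Ni Nj; rewrite -vB; apply: le_lt_trans (vK _) _.
  have := uN i j Ni Nj; rewrite ltr_pdivlMr// => lt; apply: le_lt_trans lt.
  by rewrite ler_wpM2l ?opn_ge0// lerDl.
have /choice[l1 l1P] a : exists l : A, (u n).1 a @[n --> \oo] --> l.
  apply: (cauchy (fun m => m.1 a) (nm a)) => //; [|exact: nm_ge0].
  by move=> m; exact: opn_bound.
have /choice[l2 l2P] a : exists l : A, (u n).2 a @[n --> \oo] --> l.
  apply: (cauchy (fun m => m.2 a) (nm a)) => //; [|exact: nm_ge0].
  by move=> m; exact: opn_bound2.
have haus := @norm_hausdorff _ A.
have [N0 uN0] := uc 1 ltr01; pose C := opn (u N0) + 1.
have uC n : (N0 <= n)%N -> opn (u n) <= C.
  move=> Nn; have := uN0 n N0 Nn (leqnn _).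
  have : opn (u n) <= opn (u n - u N0) + opn (u N0).
    apply: opn_le; first by rewrite addr_ge0 ?opn_ge0.
    move=> a; have -> : (u n).1 a = (u n - u N0).1 a + (u N0).1 a by rewrite subrK.
    by apply: le_trans (nmD _ _) _; rewrite mulrDl lerD ?opn_bound.
  rewrite /C; lra.
have lin (w : nat -> A -> A) (l : A -> A) : (forall n, linear (w n)) ->
    (forall a, w n a @[n --> \oo] --> l a) ->
    (forall n a, (N0 <= n)%N -> nm (w n a) <= C * nm a) -> linear l /\ continuous l.
  move=> wl wc wC; have ll : linear l.
    move=> c x y; apply: (cvg_unique haus (wc _)).
    have -> : (fun n => w n (c *: x + y)) = (fun n => c *: w n x + w n y).
      by apply/funext => n; rewrite wl.
    by apply: cvgD; [apply: cvgZr|]; exact: wc.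
  split=> //; apply: (linear_bounded_continuous_nm (C := C) ll) => a.
  by apply: (nm_le_lim (N := N0) (wc a)) => n Nn; exact: wC.
have dc : (l1, l2) \in double_centralizers (A := A).
  apply/asboolP; split=> /=.
  - apply: (lin (fun n => (u n).1)) => [n|//|n a Nn].
      exact: (@mult1_linear (u n)).
    by apply: le_trans (opn_bound _ _) _; rewrite ler_wpM2r ?nm_ge0// uC.
  - apply: (lin (fun n => (u n).2)) => [n|//|n a Nn].
      exact: (@mult2_linear (u n)).
    by apply: le_trans (opn_bound2 _ _) _; rewrite ler_wpM2r ?nm_ge0// uC.
  - move=> a b; have := cvg_smull (a := a) (l1P b).
    have -> : (fun n => a ** (u n).1 b) = (fun n => (u n).2 a ** b).
      by apply/funext => n; rewrite mult_bal.
    by move=> l1b; apply: (cvg_unique haus l1b); exact: (cvg_smulr (a := b) (l2P a)).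
exists (Multiplier dc) => d d0; have [|N uN] := uc (d / 2); first by rewrite divr_gt0.
exists N => n Nn; apply: (@le_lt_trans _ _ (d / 2)); last by lra.
apply: opn_le; first by rewrite divr_ge0// ltW.
move=> a; apply: (@nm_le_lim _ (fun k => (u n).1 a - (u k).1 a) _ _ N).
  by apply: cvgB; [exact: cvg_cst|exact: l1P].
move=> k Nk; apply: le_trans (opn_bound (u n - u k) a) _.
by rewrite ler_wpM2r ?nm_ge0// ltW// uN.
Qed.

Lemma opn_cstar_norm : cstar_norm opn.
Proof.
split.
- move=> m n; apply: opn_le; first by rewrite addr_ge0 ?opn_ge0.
  by move=> a; apply: le_trans (nmD _ _) _; rewrite mulrDl lerD ?opn_bound.
- have Zle (c : R[i]) m : opn (c *: m) <= complex.Re `|c| * opn m.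
    have c0 : 0 <= complex.Re `|c|.
      by rewrite -lecR RRe_real ?normr_real //; exact: normr_ge0.
    apply: opn_le; first by rewrite mulr_ge0 ?opn_ge0.
    by move=> a; rewrite nmZ -mulrA ler_wpM2l// opn_bound.
  move=> c m; apply/eqP; rewrite eq_le Zle andTb.
  have [->|c0] := eqVneq c 0; first by rewrite normr0 mul0r opn_ge0.
  have := Zle c^-1 (c *: m); rewrite scalerA mulVf// scale1r.
  have cE : (complex.Re `|c|)%:C = `|c| by rewrite RRe_real ?normr_real.
  have k0 : 0 < complex.Re `|c| by rewrite -ltcR cE normr_gt0.
  by rewrite normfV -cE -fmorphV [complex.Re _]/= ler_pdivlMl.
- move=> m m0; have m10 a : m.1 a = 0.
    apply: nm0_eq0; apply/eqP; rewrite eq_le nm_ge0 andbT.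
    by have := opn_bound m a; rewrite m0 mul0r.
  apply: multiplier_eq => a; first exact: m10.
  by apply: smul_nondeg => b; rewrite -mult_bal m10 smul0r.
- exact: opn_smul_le.
- move=> m; apply/eqP; rewrite eq_le opn_adjM_ge andbT.
  by have := opn_smul_le (adj m) m; rewrite opn_adj expr2.
- exact: opn_complete.
Qed.

Lemma mult_one_subproof : (@idfun A, @idfun A) \in double_centralizers (A := A).
Proof.
by apply/asboolP; split=> //=; split=> // x; exact: cvg_id.
Qed.

Definition mult_one : multiplier A := Multiplier mult_one_subproof.

Lemma mult_one1 m : mult_one ** m = m. Proof. exact: multiplier_eq. Qed.
Lemma mult_1one m : m ** mult_one = m. Proof. exact: multiplier_eq. Qed.

Lemma mult_of_subproof a : ((fun b => a ** b), (fun b => b ** a)) \in double_centralizers (A := A).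
Proof.
apply/asboolP; split=> /=; last by move=> b c; rewrite smulA.
- have l : linear (fun b => a ** b) by move=> c x y; rewrite smulDr smulZr.
  split=> //; apply: (linear_bounded_continuous_nm (C := nm a) l) => x.
  exact: (cnM cnA).
- have l : linear (fun b => b ** a) by move=> c x y; rewrite smulDl smulZl.
  split=> //; apply: (linear_bounded_continuous_nm (C := nm a) l) => x.
  by rewrite mulrC; exact: (cnM cnA).
Qed.

Definition mult_of a : multiplier A := Multiplier (mult_of_subproof a).

Lemma mult_of1 a b : (mult_of a).1 b = a ** b. Proof. by []. Qed.
Lemma mult_ofZD (c : R[i]) a b : mult_of (c *: a + b) = c *: mult_of a + mult_of b.
Proof.
by apply: multiplier_eq => x /=; rewrite ?smulDl ?smulDr ?smulZl ?smulZr.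
Qed.

Lemma mult_ofM a b : mult_of (a ** b) = mult_of a ** mult_of b.
Proof. by apply: multiplier_eq => x /=; rewrite smulA. Qed.

Lemma mult_of_adj a : mult_of (adj a) = adj (mult_of a).
Proof. by apply: multiplier_eq => x /=; rewrite adjM adjK. Qed.

Lemma mult_ofl m a : m ** mult_of a = mult_of (m.1 a).
Proof. by apply: multiplier_eq => x /=; [rewrite mult1M|rewrite mult_bal]. Qed.

Lemma mult_ofr m a : mult_of a ** m = mult_of (m.2 a).
Proof. by apply: multiplier_eq => x /=; [rewrite mult_bal|rewrite mult2M]. Qed.

Lemma opn_mult_of a : opn (mult_of a) = nm a.
Proof.
apply/eqP; rewrite eq_le; apply/andP; split.
  by apply: opn_le; [exact: nm_ge0|move=> b; exact: (cnM cnA)].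
have := opn_bound (mult_of a) (adj a); rewrite mult_of1 -{1}[a]adjK (cnC cnA).
rewrite (cn_adj cnA) expr2; have [->|a0] := eqVneq (nm a) 0.
  by rewrite opn_ge0.
by rewrite ler_pM2r// lt_def a0 nm_ge0.
Qed.

End OperatorNorm.

Section Representations.
Context {R : realType} {B : starAlgType R} {p : B -> R} (cn : cstar_norm p).
Context {H : completeNormedModType R[i]} {ip : H -> H -> R[i]} { pi : B -> H -> H}.
Hypotheses (Hip : is_inner_product ip) (Hpi : is_representation ip pi).

Let b x y := complex.Re (ip x y).
Let Hb : real_inner b := inner_product_real Hip.

Lemma repD a c x : pi (a + c) x = pi a x + pi c x.
Proof. by have [_ rZ _ _] := Hpi; have := rZ x 1 a c; rewrite !scale1r. Qed.

Lemma rep0 x : pi 0 x = 0.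
Proof.
by have := repD 0 0 x; rewrite addr0 => /eqP; rewrite -subr_eq0 opprD addNKr oppr_eq0 => /eqP.
Qed.

Lemma repZ (c : R[i]) a x : pi (c *: a) x = c *: pi a x.
Proof. by have [_ rZ _ _] := Hpi; have := rZ x c a 0; rewrite rep0 !addr0. Qed.

Lemma repN a x : pi (- a) x = - pi a x.
Proof. by rewrite -scaleN1r repZ scaleN1r. Qed.

Lemma repM a c x : pi (a ** c) x = pi a (pi c x).
Proof. by have [_ _ rM _] := Hpi. Qed.

Lemma rep_linear a : linear (pi a).
Proof. by have [/(_ a)[]] := Hpi. Qed.

Lemma rep_adj a x y : b (pi a x) y = b x (pi (adj a) y).
Proof. by have [_ _ _ rJ] := Hpi; rewrite /b rJ. Qed.

(* [1 - a^* a = (1 - k)^2] when [p a <= 1]. *)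
Lemma rep_contractive a x : nm (pi a x) <= p a * nm x.
Proof.
have [a0|a0] := eqVneq (p a) 0.
  by rewrite (cn_eq0 cn a0) rep0 nm0 (cn0 cn) mul0r.
have pa : 0 < p a by rewrite lt_def a0 (cn_ge0 cn).
pose c := (p a)^-1%:C *: a.
have pc : p c = 1 by rewrite (cnZr cn) gtr0_norm ?invr_gt0// mulVf.
suff le : nm (pi c x) <= nm x.
  have -> : a = (p a)%:C *: c by rewrite /c scalerA -rmorphM/= mulfV// scale1r.
  rewrite repZ nmZr (cnZr cn) pc mulr1 gtr0_norm//.
  by rewrite ler_wpM2l// ltW.
have cc1 : p (adj c ** c) <= 1 by rewrite (cnC cn) pc expr1n.
have [k kE kI] := half_square_fixpoint cn cc1.
have kk : adj k = k.
  apply: (kI [set k | adj k = k]); [exact: (closed_sa cn)|exact: adj0|].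
  by move=> y /= yy; rewrite /half_square !adjE yy.
have ccE : adj c ** c = 2%:C *: k - k ** k by rewrite -{1}kE /half_square; lincomb.
rewrite -ler_sqr ?nnegrE ?nm_ge0//.
have -> : nm (pi c x) ^+ 2 = b x (pi (adj c ** c) x).
  by rewrite repM -(Hb.2) rep_adj.
have -> : b x (pi (adj c ** c) x) = 2 * b x (pi k x) - nm (pi k x) ^+ 2.
  rewrite ccE repD repZ repN repM (siDr Hb.1) (siZrr Hb.1) (siNr Hb.1) -(Hb.2).
  by rewrite rep_adj kk.
by have := sqr_ge0 (nm (x - pi k x)); rewrite (nm_sub_sqr Hb); lra.
Qed.

Hypothesis Hirr : irreducible_representation pi.

(** Containing every [pi a x] makes [K] invariant and non-zero. With [K] the set where two bounded
    operators agree, it suffices to compare them on such vectors. *)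
Lemma irr_nondeg (K : set H) : closed_linear_subspace K ->
  (forall a x, K (pi a x)) -> K = setT.
Proof.
move=> Ksub Kpi; have [[a [x pax]] irr] := Hirr.
have [//|K0|//] := irr K Ksub.
by exfalso; have := Kpi a x; rewrite K0 /= => e; move: pax; rewrite e eqxx.
Qed.

End Representations.

Lemma inner_adjoint {R : realType} {H : completeNormedModType R[i]}
    (ip : H -> H -> R[i]) (f g : H -> H) : is_inner_product ip -> linear g ->
  (forall x y, complex.Re (ip (f x) y) = complex.Re (ip x (g y))) ->
  forall x y, ip (f x) y = ip x (g y).
Proof.
move=> Hip gl fg x y; have [ipl ipC _] := Hip.
have ip0 z : ip 0 z = 0.
  by have := ipl (-1) 0 0 z; rewrite scaleN1r oppr0 addr0 mulN1r addNr.
have ImE v w : complex.Im (ip v w) = complex.Re (ip v ('i%C *: w)).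
  have := ipl 'i%C w 0 v; rewrite ip0 !addr0 => iw.
  rewrite [ip v (_ *: _)]ipC iw rmorphM/= conj_i -ipC.
  by case: (ip v w) => r s /=; ring.
apply: eq_Re_Im; first exact: fg.
by rewrite !ImE fg; have [_ _ _ ->] := linear_scaleD gl.
Qed.

Section ClosedSubspaces.
Context {R : realType} {H : completeNormedModType R[i]}.

Lemma closed_ker (W : normedModType R[i]) (f : H -> W) C :
  linear f -> (forall x, nm (f x) <= C * nm x) ->
  closed_linear_subspace [set x | f x = 0].
Proof.
move=> fl fC; have [f0 fD fN fZ] := linear_scaleD fl; split=> //.
- by move=> c x y /= fx fy; rewrite fl fx fy scaler0 addr0.
- apply/closed_nmP => x xK /=; apply: nm0_eq0; apply/eqP.
  rewrite eq_le nm_ge0 andbT; apply: (le0_small (C := `|C|)) => // d /xK[y /= fy xy].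
  have -> : f x = f (x - y) by rewrite fD fN fy subr0.
  apply: le_trans (fC _) _; have := nm_ge0 (x - y); have := ler_norm C.
  have := normr_ge0 C; nra.
Qed.

Lemma closure_subspace (D : set H) : D 0 ->
  (forall (c : R[i]) x y, D x -> D y -> D (c *: x + y)) ->
  closed_linear_subspace (closure D).
Proof.
move=> D0 DZ; split; [exact: subset_closure| |exact: closed_closure].
move=> c x y /closure_nmP xD /closure_nmP yD; apply/closure_nmP => d d0.
pose k := complex.Re `|c|.
have k0 : 0 <= k by rewrite -lecR RRe_real ?normr_real //; exact: normr_ge0.
have k1 : 0 < 2 * (k + 1) by lra.
have [|x' Dx' xx'] := xD (d / (2 * (k + 1))); first by rewrite divr_gt0.
have [|y' Dy' yy'] := yD (d / 2); first by rewrite divr_gt0.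
exists (c *: x' + y'); first exact: DZ.
have -> : c *: x + y - (c *: x' + y') = c *: (x - x') + (y - y') by lincomb.
apply: le_lt_trans (nmD _ _) _; rewrite nmZ -/k; move: xx'.
by rewrite ltr_pdivlMr//; have := nm_ge0 (x - x'); nra.
Qed.

End ClosedSubspaces.

(** * Extension of irreducible representations from A to M(A) *)

Section Extension.
Context {R : realType} {A : cstarAlgType R} (u : nat -> A).
Hypothesis u1 : forall n, nm (u n) <= 1.
Hypothesis ul : forall a, u n ** a @[n --> \oo] --> a.
Context {H : completeNormedModType R[i]} {ip : H -> H -> R[i]} { pi : A -> H -> H}.
Hypotheses (Hip : is_inner_product ip) (Hpi : is_representation ip pi).
Hypothesis Hirr : irreducible_representation pi.

Let cnA := cstar_norm_nm A.
Let b x y := complex.Re (ip x y).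
Let Hb : real_inner b := inner_product_real Hip.
Let contr := rep_contractive cnA Hip Hpi.
Let rJ a x y : b (pi a x) y = b x (pi (adj a) y) := rep_adj Hpi a x y.

Lemma rep_lim (v : nat -> A) a x : v n @[n --> \oo] --> a ->
  pi (v n) x @[n --> \oo] --> pi a x.
Proof.
move=> /cvg_nmP va; apply/cvg_nmP => d d0.
have x1 : 0 < nm x + 1 by rewrite ltr_wpDl ?nm_ge0.
have [|N vN] := va (d / (nm x + 1)); first by rewrite divr_gt0.
exists N => n /vN; rewrite ltr_pdivlMr// -(repN Hpi) -(repD Hpi) => lt.
apply: le_lt_trans (contr _ _) _; apply: le_lt_trans lt.
have := nm_ge0 (v n - a); have := nm_ge0 x; nra.
Qed.

Let bound (m : multiplier A) n x : nm (pi (m.1 (u n)) x) <= opn m * nm x.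
Proof.
apply: le_trans (contr _ _) _; rewrite ler_wpM2r ?nm_ge0//.
apply: le_trans (opn_bound _ _) _.
by rewrite -[leRHS]mulr1 ler_wpM2l ?opn_ge0.
Qed.

(** The operators are uniformly bounded, so the vectors where they converge form a closed subspace;
    it contains every pi a z because m (u_n a) tends to m a. *)
Lemma rep_extension_cvg (m : multiplier A) x :
  exists y : H, pi (m.1 (u n)) x @[n --> \oo] --> y.
Proof.
pose K := [set x | exists y : H, pi (m.1 (u n)) x @[n --> \oo] --> y].
suff KT : K = setT by have : K x by rewrite KT.
apply: (irr_nondeg Hirr); last first.
  move=> a z; exists (pi (m.1 a) z).
  have -> : (fun n => pi (m.1 (u n)) (pi a z)) = (fun n => pi (m.1 (u n ** a)) z).
    by apply/funext => n; rewrite mult1M (repM Hpi).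
  by apply: rep_lim; apply: cvg_mult1; exact: ul.
split.
- exists 0; have -> : (fun n => pi (m.1 (u n)) 0) = (fun=> 0).
    by apply/funext => n; have [] := linear_scaleD (rep_linear Hpi (m.1 (u n))).
  exact: cvg_cst.
- move=> c y z [y' yy'] [z' zz']; exists (c *: y' + z').
  have -> : (fun n => pi (m.1 (u n)) (c *: y + z)) =
      (fun n => c *: pi (m.1 (u n)) y + pi (m.1 (u n)) z).
    by apply/funext => n; rewrite (rep_linear Hpi).
  by apply: cvgD => //; exact: cvgZr.
apply/closed_nmP => y yK; apply: complete_nm => d d0.
have m1 : 0 < 3 * (opn m + 1) by have := opn_ge0 m; lra.
have [|z [z' /cvg_nmP zz'] yz] := yK (d / (3 * (opn m + 1))); first by rewrite divr_gt0.
have [|N zN] := zz' (d / 6); first by rewrite divr_gt0.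
exists N => i j Ni Nj.
have le k : nm (pi (m.1 (u k)) y - pi (m.1 (u k)) z) < d / 3.
  have [_ lD lN _] := linear_scaleD (rep_linear Hpi (m.1 (u k))).
  rewrite -lN -lD; apply: le_lt_trans (bound _ _ _) _.
  move: yz; rewrite ltr_pdivlMr//.
  by have := nm_ge0 (y - z); have := opn_ge0 m; lra.
have := le i; have := le j; rewrite [nm (pi (m.1 (u j)) y - _)]nmBC.
have := zN i Ni; have := zN j Nj; rewrite [nm (pi (m.1 (u j)) z - _)]nmBC.
have := nm_triangle (pi (m.1 (u i)) z) (pi (m.1 (u i)) y) (pi (m.1 (u j)) y).
have := nm_triangle z' (pi (m.1 (u i)) z) (pi (m.1 (u j)) y).
have := nm_triangle (pi (m.1 (u j)) z) z' (pi (m.1 (u j)) y).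
lra.
Qed.

Lemma rep_extension : exists s : multiplier A -> H -> H,
  [/\ is_representation ip s, irreducible_representation s,
     forall m a x, s m (pi a x) = pi (m.1 a) x,
     forall a x, s (mult_of a) x = pi a x
   & [set m | forall x, s m x = 0] = tilde [set a | forall x, pi a x = 0]].
Proof.
have /choice[s0 s0P] : forall mx : multiplier A * H, exists y : H,
    pi (mx.1.1 (u n)) mx.2 @[n --> \oo] --> y.
  by move=> [m x]; exact: rep_extension_cvg.
pose s m x := s0 (m, x).
have sP (m : multiplier A) x : pi (m.1 (u n)) x @[n --> \oo] --> s m x := s0P (m, x).
have haus := @norm_hausdorff _ H.
have sb (m : multiplier A) x : nm (s m x) <= opn m * nm x.
  by apply: (nm_le_lim (N := 0) (sP m x)) => n _; exact: bound.
have spi (m : multiplier A) a x : s m (pi a x) = pi (m.1 a) x.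
  apply: (cvg_unique haus (sP _ _)).
  have -> : (fun n => pi (m.1 (u n)) (pi a x)) = (fun n => pi (m.1 (u n ** a)) x).
    by apply/funext => n; rewrite mult1M (repM Hpi).
  by apply: rep_lim; apply: cvg_mult1; exact: ul.
have sl (m : multiplier A) : linear (s m).
  move=> c x y; apply: (cvg_unique haus (sP _ _)).
  have -> : (fun n => pi (m.1 (u n)) (c *: x + y)) =
      (fun n => c *: pi (m.1 (u n)) x + pi (m.1 (u n)) y).
    by apply/funext => n; rewrite (rep_linear Hpi).
  by apply: cvgD; [apply: cvgZr|]; exact: sP.
have eq_on (f g : H -> H) C D : linear f -> linear g ->
    (forall x, nm (f x) <= C * nm x) -> (forall x, nm (g x) <= D * nm x) ->
    (forall a x, f (pi a x) = g (pi a x)) -> forall x, f x = g x.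
  move=> fl gl fC gD fg x.
  have fgl : linear (fun x => f x - g x).
    by move=> c y z; rewrite fl gl; lincomb.
  have fgC y : nm (f y - g y) <= (C + D) * nm y.
    by apply: le_trans (nmD _ _) _; rewrite nmN mulrDl lerD.
  have KT : [set x | f x - g x = 0] = setT.
    apply: (irr_nondeg Hirr (closed_ker fgl fgC)) => a y /=.
    by rewrite fg subrr.
  have : [set x | f x - g x = 0] x by rewrite KT.
  by move=> /= /eqP; rewrite subr_eq0 => /eqP.
have s_mult a x : s (mult_of a) x = pi a x.
  apply: (eq_on _ _ (opn (mult_of a)) (nm a)) => //; first exact: (rep_linear Hpi).
  by move=> c y; rewrite spi mult_of1 (repM Hpi).
have sM (m n : multiplier A) x : s (m ** n) x = s m (s n x).
  apply: (eq_on _ (fun x => s m (s n x)) (opn (m ** n)) (opn m * opn n)) => //.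
  - by move=> c y z; rewrite !sl.
  - move=> y; apply: le_trans (sb _ _) _.
    by rewrite -mulrA ler_wpM2l ?opn_ge0.
  - by move=> a y; rewrite !spi mult_smul1.
have sZ x c (m n : multiplier A) : s (c *: m + n) x = c *: s m x + s n x.
  apply: (cvg_unique haus (sP _ _)).
  have -> : (fun k => pi ((c *: m + n).1 (u k)) x) =
      (fun k => c *: pi (m.1 (u k)) x + pi (n.1 (u k)) x).
    by apply/funext => k; have [_ -> _ _] := Hpi.
  by apply: cvgD; [apply: cvgZr|]; exact: sP.
(* Non-degeneracy is used first in [x] and then in [y], which reduces the identity to vectors in the
   range of [pi], where it is the relation [mult_bal]. *)
have sJ (m : multiplier A) x y : b (s m x) y = b x (s (adj m) y).
  pose K := [set x | forall y, b (s m x) y = b x (s (adj m) y)].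
  suff KT : K = setT by have : K x by rewrite KT.
  have [_ _ _ sZ'] := linear_scaleD (sl (adj m)).
  apply: (irr_nondeg Hirr).
    split.
    - move=> z; have [-> _ _ _] := linear_scaleD (sl m).
      by rewrite -(scale0r z) -[0]/(0%:C) !(siZ Hb.1) !mul0r.
    - move=> c v w Kv Kw z; rewrite sl !(siD Hb.1) !(siJ Hb.1) Kv Kw.
      by rewrite sZ'.
    - apply/closed_nmP => v vK z; apply/eqP; rewrite -subr_eq0 -normr_le0.
      apply: (le0_small (C := opn m * nm z + nm (s (adj m) z))) => [|d /vK[w Kw vw]].
        by rewrite addr_ge0 ?mulr_ge0 ?nm_ge0 ?opn_ge0.
      have [_ sD sN _] := linear_scaleD (sl m).
      have -> : b (s m v) z - b v (s (adj m) z) =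
          b (s m (v - w)) z - b (v - w) (s (adj m) z).
        by rewrite sD sN !(siD Hb.1) !(siN Hb.1) Kw; ring.
      apply: le_trans (ler_normB _ _) _; rewrite mulrDl; apply: lerD.
        apply: le_trans (inner_nm_le Hb _ _) _.
        apply: le_trans (ler_wpM2r (nm_ge0 z) (sb m (v - w))) _.
        by rewrite -!mulrA ler_wpM2l ?opn_ge0// mulrC ler_wpM2l ?nm_ge0// ltW.
      apply: le_trans (inner_nm_le Hb _ _) _.
      by rewrite mulrC ler_wpM2l ?nm_ge0// ltW.
  move=> a v w; rewrite spi.
  pose L := [set w | forall v, b (pi (m.1 a) v) w = b (pi a v) (s (adj m) w)].
  suff LT : L = setT by have : L w by rewrite LT.
  apply: (irr_nondeg Hirr).
    split.
    - move=> z; have [-> _ _ _] := linear_scaleD (sl (adj m)).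
      by rewrite -(scale0r z) -[0]/(0%:C) !(siZrr Hb.1) !mul0r.
    - move=> c y' z' Ly Lz z; rewrite sl !(siDr Hb.1) Lz; congr (_ + _).
      rewrite -[c]conjCK -!(siJ Hb.1).
      by have [_ _ _ pZ] := linear_scaleD (rep_linear Hpi (m.1 a));
        have [_ _ _ pZ'] := linear_scaleD (rep_linear Hpi a);
        rewrite -pZ -pZ' Ly.
    - apply/closed_nmP => y' yL z; apply/eqP; rewrite -subr_eq0 -normr_le0.
      apply: (le0_small (C := nm (pi (m.1 a) z) + nm (pi a z) * opn (adj m))) => [|d /yL[w' Lw vw]].
        by rewrite addr_ge0 ?mulr_ge0 ?nm_ge0 ?opn_ge0.
      have [_ sD sN _] := linear_scaleD (sl (adj m)).
      have -> : b (pi (m.1 a) z) y' - b (pi a z) (s (adj m) y') =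
          b (pi (m.1 a) z) (y' - w') - b (pi a z) (s (adj m) (y' - w')).
        by rewrite sD sN !(siDr Hb.1) !(siNr Hb.1) Lw; ring.
      apply: le_trans (ler_normB _ _) _; rewrite mulrDl; apply: lerD.
        apply: le_trans (inner_nm_le Hb _ _) _.
        by rewrite ler_wpM2l ?nm_ge0// ltW.
      apply: le_trans (inner_nm_le Hb _ _) _.
      rewrite -mulrA ler_wpM2l ?nm_ge0//; apply: le_trans (sb _ _) _.
      by rewrite ler_wpM2l ?opn_ge0// ltW.
  move=> c v' z; rewrite spi (siC Hb.1) [in RHS](siC Hb.1) !rJ -!(repM Hpi).
  by rewrite mult_adj1 adjK mult_bal.
exists s; split=> //.
- split=> //.
  + by move=> m; split=> //; exact: (linear_bounded_continuous_nm (sl m) (sb m)).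
  + by move=> m x y; apply: (inner_adjoint Hip) => // *; exact: sJ.
- split.
    by have [[a [x pax]] _] := Hirr; exists (mult_of a), x; rewrite s_mult.
  move=> K Ksub Ks; have [_ irr] := Hirr; apply: irr => // a x Kx.
  by rewrite -s_mult; exact: Ks.
- apply/seteqP; split=> m /=.
    move=> sm a; split=> x; first by rewrite -spi.
    by rewrite -s_mult -mult_ofr sM sm; have [-> _ _ _] := linear_scaleD (sl (mult_of a)).
  move=> tm x; have := irr_nondeg Hirr (closed_ker (sl m) (sb m)).
  move=> /(_ (fun a y => etrans (spi m a y) ((tm a).1 y))) KT.
  by have : [set x | s m x = 0] x by rewrite KT.
Qed.

End Extension.

(** * Primitive ideals *)

Lemma ker_rep_ideal {R : realType} {B : starAlgType R} {p : B -> R}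
    (cn : cstar_norm p) {H : completeNormedModType R[i]} (ip : H -> H -> R[i])
    (pi : B -> H -> H) : is_inner_product ip -> is_representation ip pi ->
  cn_ideal (p := p) [set a | forall x, pi a x = 0].
Proof.
move=> Hip Hpi; split=> [x|c a a' pa pa' x|a a' pa x|a a' pa x|a pa x|a aK x] /=.
- exact: (rep0 Hpi).
- by rewrite (repD Hpi) (repZ Hpi) pa pa' scaler0 addr0.
- by rewrite (repM Hpi) pa; have [] := linear_scaleD (rep_linear Hpi a').
- by rewrite (repM Hpi) pa.
- apply: nm0_eq0; apply/eqP; rewrite -sqrf_eq0; apply/eqP.
  have [Hb bnm] := inner_product_real Hip.
  rewrite -bnm (rep_adj Hpi) adjK pa.
  by rewrite -(scale0r x) -[0]/(0%:C) (siZrr Hb) mul0r.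
- apply: nm0_eq0; apply/eqP; rewrite eq_le nm_ge0 andbT.
  apply: (le0_small (nm_ge0 x)) => d /aK[y /= py ay].
  have -> : pi a x = pi (a - y) x by rewrite (repD Hpi) (repN Hpi) py subr0.
  apply: le_trans (rep_contractive cn Hip Hpi _ _) _.
  by rewrite mulrC ler_wpM2l ?nm_ge0// ltW.
Qed.

Section PrimitiveIdeals.
Context {R : realType} {B : starAlgType R}.

Lemma prim_of_rep {H : completeNormedModType R[i]} (ip : H -> H -> R[i])
    (pi : B -> H -> H) : is_inner_product ip -> is_representation ip pi ->
  irreducible_representation pi ->
  exists P : Prim B, ideal_of P = [set a | forall x, pi a x = 0].
Proof.
move=> Hip Hpi Hirr; have prim : primitive [set a | forall x, pi a x = 0].
  by exists H, ip, pi.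
by exists (exist (fun y => y \in @primitive R B) _ (mem_set prim)).
Qed.

Lemma prim_rep (P : Prim B) : exists (H : completeNormedModType R[i])
    (ip : H -> H -> R[i]) (pi : B -> H -> H),
  [/\ is_inner_product ip, is_representation ip pi,
     irreducible_representation pi & ideal_of P = [set a | forall x, pi a x = 0]].
Proof. exact: ideal_of_primitive. Qed.

Lemma prim_ideal {p : B -> R} (cn : cstar_norm p) (P : Prim B) :
  cn_ideal (p := p) (ideal_of P).
Proof.
by have [H [ip [pi [Hip Hpi _ ->]]]] := prim_rep P; exact: (ker_rep_ideal cn Hip).
Qed.

Lemma ker_ideal {p : B -> R} (cn : cstar_norm p) (F : set (Prim B)) :
  cn_ideal (p := p) (ker F).
Proof.
have I P := prim_ideal cn P.
split=> [P _|c x y Fx Fy P FP|x b Fx P FP|x b Fx P FP|x Fx P FP|x xF P FP].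
- exact: (cni0 (I P)).
- by apply: (cniZD (I P)); [exact: Fx|exact: Fy].
- by apply: (cniMl (I P)); exact: Fx.
- by apply: (cniMr (I P)); exact: Fx.
- by apply: (cni_adj (I P)); exact: Fx.
- by apply: (cni_closed (I P)) => d /xF[y Fy xy]; exists y => //; exact: Fy.
Qed.

Lemma closed_hull (F : set (Prim B)) : closed F -> hull (ker F) `<=` F.
Proof. by move=> Fc; have := closed_openC Fc; rewrite /open/= /hull_kernel_open setCK. Qed.

Lemma hull_closed (J : set B) : closed (hull J).
Proof.
rewrite -[hull J]setCK; apply: open_closedC; rewrite /open/= /hull_kernel_open setCK.
by move=> P hP a Ja; apply: hP => Q; exact.
Qed.

End PrimitiveIdeals.

(** * Restriction of irreducible representations from M(A) to A *)

Section Restriction.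
Context {R : realType} {A : cstarAlgType R}.
Context {H : completeNormedModType R[i]} {ip : H -> H -> R[i]}.
Context (s : multiplier A -> H -> H).
Hypotheses (Hip : is_inner_product ip) (Hs : is_representation ip s).
Hypothesis Hirr : irreducible_representation s.

Let pi a := s (mult_of a).

Lemma rep_restriction : is_representation ip pi.
Proof.
have [sl sZ sM sJ] := Hs; split.
- by move=> a; exact: sl.
- by move=> x c a b; rewrite /pi mult_ofZD sZ.
- by move=> a b x; rewrite /pi mult_ofM sM.
- by move=> a x y; rewrite /pi mult_of_adj sJ.
Qed.

Let cnMA := @opn_cstar_norm R A.

(** As [A] is an ideal of M(A), the vectors killed by [A] form an M(A)-invariant subspace, which
    must be zero. So for x <> 0 in [K] the closure of the orbit of [x] under [A] is non-zero and
    M(A)-invariant, hence everything. *)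
Lemma irreducible_restriction : (exists a x, pi a x != 0) ->
  irreducible_representation pi.
Proof.
move=> pin0; split=> // K Ksub Kpi; have [K0 KZ Kc] := Ksub.
have sC m := rep_contractive cnMA Hip Hs m.
have [[x [Kx x0]]|nK] := pselect (exists x, K x /\ x <> 0); last first.
  left; apply/seteqP; split=> [x Kx|_ ->//]; apply: contrapT => x0.
  by apply: nK; exists x.
pose N := [set y | forall a, pi a y = 0].
have Nsub : closed_linear_subspace N.
  have ck a := closed_ker (rep_linear rep_restriction a) (sC (mult_of a)).
  split.
  - by move=> a; have [+ _ _] := ck a.
  - by move=> c y z Ny Nz a; have [_ + _] := ck a; apply; [exact: Ny|exact: Nz].
  - have -> : N = \bigcap_a [set y | pi a y = 0].
      by apply/seteqP; split=> [y Ny a _|y Ny a]; [exact: Ny|exact: (Ny a I)].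
    by apply: closed_bigI => a _; have [_ _] := ck a.
have [_ irr] := Hirr; have [m y Ny a||NT] := irr N Nsub.
- by rewrite /pi -(repM Hs) mult_ofr; exact: Ny.
- move=> N0; right; pose D := [set pi a x | a in setT].
  have [a ax] : exists a, pi a x <> 0.
    apply: contrapT => /forallNP ax; apply: x0.
    suff : N x by rewrite N0.
    by move=> a; apply: contrapT; exact: ax.
  have Dsub : closed_linear_subspace (closure D).
    apply: closure_subspace.
      by exists 0 => //; exact: (rep0 rep_restriction).
    move=> c _ _ [a1 _ <-] [a2 _ <-]; exists (c *: a1 + a2) => //.
    by rewrite (repD rep_restriction) (repZ rep_restriction).
  have [m y Dy||DT] := irr (closure D) Dsub.
  + have [_ sD sN _] := linear_scaleD (rep_linear Hs m).
    move/closure_nmP: Dy => Dy; apply/closure_nmP => d d0.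
    have m1 : 0 < opn m + 1 by rewrite ltr_wpDl ?opn_ge0.
    have [|_ [b _ <-] yb] := Dy (d / (opn m + 1)); first by rewrite divr_gt0.
    exists (pi (m.1 b) x); first by exists (m.1 b).
    rewrite /pi -mult_ofl (repM Hs) -sN -sD; apply: le_lt_trans (sC m _) _.
    move: yb; rewrite ltr_pdivlMr// => yb; apply: le_lt_trans yb.
    by rewrite mulrC ler_wpM2l ?nm_ge0// lerDl.
  + move=> D0; exfalso; apply: ax; suff : closure D (pi a x) by rewrite D0.
    by apply: subset_closure; exists a.
  apply/seteqP; split=> // z _; have : closure D z by rewrite DT.
  move=> /closure_nmP zD; move/closed_nmP: Kc; apply => d /zD[_ [b _ <-] zb].
  by exists (pi b x) => //; exact: Kpi.
- have [a [y /eqP]] := pin0; have : N y by rewrite NT.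
  by move=> ->.
Qed.

End Restriction.

Definition approximate_unit {R : realType} {A : cstarAlgType R} (u : nat -> A) :=
  [/\ forall n, nm (u n) <= 1, forall a, u n ** a @[n --> \oo] --> a
    & forall a, a ** u n @[n --> \oo] --> a].

Lemma sigma_unital_approximate {R : realType} (A : cstarAlgType R) :
  sigma_unital A -> exists u : nat -> A, approximate_unit u.
Proof.
move=> [u [u1 _ ul]]; exists u; split=> [n|a|a].
- by have [_] := u1 n; rewrite nmE -[1]/(1%:C) lecR.
- by have [] := ul a.
- by have [] := ul a.
Qed.

(** * Ideals as intersections of primitive ideals; compactness in Prim(A) *)

Section Separation.
Context {R : realType} {A : cstarAlgType R} (u : nat -> A).
Hypothesis Hu : approximate_unit u.

Let cnA := cstar_norm_nm A.
Let cnMA := @opn_cstar_norm R A.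

Lemma closed_lim (I : set A) (v : nat -> A) a : cn_closed (nm : A -> R) I ->
  v n @[n --> \oo] --> a -> (forall n, I (v n)) -> I a.
Proof.
move=> Icl /cvg_nmP va Iv; apply: Icl => d /va[N vN]; exists (v N) => //.
by rewrite nmBC vN.
Qed.

Section Ideal.
Variable I : set A.
Hypothesis HI : cn_ideal (p := nm) I.

(** The image of [j] is the limit of m (u_n j) = m (u_n) j, which lies in [I]. *)
Lemma ideal_mult1 (m : multiplier A) j : I j -> I (m.1 j).
Proof.
have [_ ul _] := Hu => Ij; apply: (closed_lim (cni_closed HI)).
  by apply: cvg_mult1; exact: ul.
by move=> n /=; rewrite mult1M; exact: (cniMl HI).
Qed.

Lemma ideal_mult2 (m : multiplier A) j : I j -> I (m.2 j).
Proof.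
have [_ _ ur] := Hu => Ij; apply: (closed_lim (cni_closed HI)).
  by apply: cvg_mult2; exact: ur.
by move=> n /=; rewrite mult2M; exact: (cniMr HI).
Qed.

Lemma tilde_ideal : cn_ideal (p := opn) (tilde I).
Proof.
split=> [a|c m n tm tn a|m n tm a|m n tm a|m tm a|m mI a].
- by split; exact: (cni0 HI).
- by split; apply: (cniZD HI); try exact: (tm a).1; try exact: (tm a).2;
    try exact: (tn a).1; exact: (tn a).2.
- split; last exact: (tm (n.2 a)).2.
  by rewrite mult_smul1; apply: ideal_mult1; exact: (tm a).1.
- split; first exact: (tm (n.1 a)).1.
  by rewrite mult_smul2; apply: ideal_mult2; exact: (tm a).2.
- by split; apply: (cni_adj HI); [exact: (tm (adj a)).2|exact: (tm (adj a)).1].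
- have a1 : 0 < nm a + 1 by rewrite ltr_wpDl ?nm_ge0.
  have small d : 0 < d -> exists2 n, tilde I n & opn (m - n) * nm a < d.
    move=> d0; have [|n tn mn] := mI (d / (nm a + 1)); first by rewrite divr_gt0.
    exists n => //; move: mn; rewrite ltr_pdivlMr// => mn; apply: le_lt_trans mn.
    by rewrite ler_wpM2l ?opn_ge0// lerDl.
  split; apply: (cni_closed HI) => d /small[n tn mn].
    exists (n.1 a); first exact: (tn a).1.
    exact: le_lt_trans (opn_bound (m - n) a) mn.
  exists (n.2 a); first exact: (tn a).2.
  exact: le_lt_trans (opn_bound2 (m - n) a) mn.
Qed.

Lemma tilde_mult_of a : tilde I (mult_of a) -> I a.
Proof.
have [_ _ ur] := Hu => ta; apply: (closed_lim (cni_closed HI) (ur a)) => n.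
exact: (ta (u n)).1.
Qed.

End Ideal.

(** The required unit is found in [multiplier A]: the representation is built there modulo
    [tilde I], then restricted to [A]. *)
Lemma irreducible_rep_mult_of (I : set A) a : cn_ideal (p := nm) I -> ~ I a ->
  exists (H : completeNormedModType R[i]) (ip : H -> H -> R[i]) (pi : A -> H -> H) (xi : H),
  [/\ is_inner_product ip, is_representation ip pi, irreducible_representation pi,
     (forall j (y : H), I j -> pi j y = 0) &
     [/\ nm xi = 1, pi a xi != 0 & (I = [set 0] -> nm a <= nm (pi a xi))]].
Proof.
move=> HI nIa; have HtI := tilde_ideal HI.
have nIe : ~ tilde I (mult_one (A := A)).
  by move=> /(_ a)[].
have nta : ~ tilde I (mult_of a) by move=> /(tilde_mult_of HI).
have [H [ip [s [xi [Hip Hs Hirr sI [xi1 sa san]]]]]] :=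
  irreducible_rep_exists cnMA (@mult_one1 R A) (@mult_1one R A) HtI nIe nta.
exists H, ip, (fun a => s (mult_of a)), xi; split=> //.
- exact: rep_restriction.
- by apply: (irreducible_restriction Hip Hs Hirr); exists a, xi.
- move=> j y Ij; apply: sI => b.
  by split; [exact: (cniMr HI)|exact: (cniMl HI)].
- split=> // I0; rewrite -opn_mult_of; apply: san.
  apply/seteqP; split=> [m /= tm|_ ->]; last by exact: (cni0 HtI).
  apply: multiplier_eq => b; [have := (tm b).1|have := (tm b).2];
    by rewrite I0.
Qed.

Lemma prim_separates (I : set A) a : cn_ideal (p := nm) I -> ~ I a ->
  exists2 P : Prim A, I `<=` ideal_of P & ~ ideal_of P a.
Proof.
move=> HI /(irreducible_rep_mult_of HI)[H [ip [pi [xi]]]].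
move=> [Hip Hpi Hirr piI [_ pia _]]; have [P PE] := prim_of_rep Hip Hpi Hirr.
exists P; rewrite PE; first by move=> j Ij x; exact: piI.
by move=> /(_ xi)/eqP; rewrite (negbTE pia).
Qed.

Lemma zero_ideal : cn_ideal (p := nm) [set (0 : A)].
Proof.
split=> //= [c _ _ -> ->|_ b ->|_ b ->|_ ->|x x0].
- by rewrite scaler0 addr0.
- by rewrite smul0r.
- by rewrite smul0l.
- by rewrite adj0.
- apply: (cn_small cnA ler01) => d /x0[_ -> ]; rewrite subr0 mul1r; exact: ltW.
Qed.

Lemma prim_norm_le a (C : R) : 0 <= C ->
  (forall (H : completeNormedModType R[i]) (ip : H -> H -> R[i]) (pi : A -> H -> H),
    is_inner_product ip -> is_representation ip pi ->
    irreducible_representation pi -> forall x, nm (pi a x) <= C * nm x) ->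
  nm a <= C.
Proof.
move=> C0 piC; have [->|a0] := eqVneq a 0; first by rewrite nm0.
have [|H [ip [pi [xi [Hip Hpi Hirr _ [xi1 _ pia]]]]]] :=
  @irreducible_rep_mult_of _ a zero_ideal.
  by move=> /= a00; rewrite a00 eqxx in a0.
apply: le_trans (pia erefl) _; have := piC _ _ _ Hip Hpi Hirr xi.
by rewrite xi1 mulr1.
Qed.

(* A primitive ideal containing the closure of the union of the ideals [ker F]
   lies in every [F]. *)
Lemma ker_bigcap_approx (FF : set (set (Prim A))) c : FF !=set0 ->
  (forall F, FF F -> closed F) ->
  (forall F G, FF F -> FF G -> exists2 K, FF K & K `<=` F `&` G) ->
  ker (\bigcap_(F in FF) F) c ->
  forall d, 0 < d -> exists2 F, FF F & exists2 j, ker F j & nm (c - j) < d.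
Proof.
move=> [F0 FF0] FFc FFd kc.
pose I := [set a | forall d, 0 < d ->
  exists2 F, FF F & exists2 j, ker F j & nm (a - j) < d].
have kI F := ker_ideal cnA F.
have kS F G : F `<=` G -> ker G `<=` ker F.
  by move=> FG a Ga P FP; apply: Ga; exact: FG.
have HI : cn_ideal (p := nm) I.
  split.
  - by move=> d d0; exists F0 => //; exists 0; rewrite ?subr0 ?nm0//; exact: (cni0 (kI _)).
  - move=> k x y Ix Iy d d0; pose r := complex.Re `|k|.
    have r0 : 0 <= r by rewrite -lecR RRe_real ?normr_real //; exact: normr_ge0.
    have r1 : 0 < 2 * (r + 1) by lra.
    have [|F Ff [j Fj xj]] := Ix (d / (2 * (r + 1))); first by rewrite divr_gt0.
    have [|G Gf [l Gl yl]] := Iy (d / 2); first by rewrite divr_gt0.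
    have [K Kf KFG] := FFd F G Ff Gf; exists K => //.
    exists (k *: j + l).
      apply: (cniZD (kI K)).
        by apply: kS Fj => P /KFG[].
      by apply: kS Gl => P /KFG[].
    have -> : k *: x + y - (k *: j + l) = k *: (x - j) + (y - l) by lincomb.
    apply: le_lt_trans (nmD _ _) _; rewrite nmZ -/r; move: xj.
    by rewrite ltr_pdivlMr//; have := nm_ge0 (x - j); nra.
  - move=> x b Ix d d0; have b1 : 0 < nm b + 1 by rewrite ltr_wpDl ?nm_ge0.
    have [|F Ff [j Fj xj]] := Ix (d / (nm b + 1)); first by rewrite divr_gt0.
    exists F => //; exists (b ** j); first exact: (cniMl (kI F)).
    rewrite -smulNr -smulDr; apply: le_lt_trans (cnM cnA _ _) _.
    move: xj; rewrite ltr_pdivlMr//; have := nm_ge0 (x - j); nra.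
  - move=> x b Ix d d0; have b1 : 0 < nm b + 1 by rewrite ltr_wpDl ?nm_ge0.
    have [|F Ff [j Fj xj]] := Ix (d / (nm b + 1)); first by rewrite divr_gt0.
    exists F => //; exists (j ** b); first exact: (cniMr (kI F)).
    rewrite -smulNl -smulDl; apply: le_lt_trans (cnM cnA _ _) _.
    move: xj; rewrite ltr_pdivlMr//; have := nm_ge0 (x - j); nra.
  - move=> x Ix d /Ix[F Ff [j Fj xj]]; exists F => //; exists (adj j).
      exact: (cni_adj (kI F)).
    by rewrite -adjN -adjD (cn_adj cnA).
  - move=> x xI d d0; have [|y Iy xy] := xI (d / 2); first by rewrite divr_gt0.
    have [|F Ff [j Fj yj]] := Iy (d / 2); first by rewrite divr_gt0.
    by exists F => //; exists j => //; have := nm_triangle y x j; lra.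
apply: contrapT => nIc.
have [|P IP nPc] := @prim_separates I c HI.
  by move=> Ic; apply: nIc => d d0; exact: Ic.
apply: nPc; apply: kc => F Ff; apply: (closed_hull (FFc F Ff)).
move=> j Fj; apply: IP => d d0; exists F => //; exists j => //.
by rewrite subrr nm0.
Qed.

Definition union_closed {T : topologicalType} (W : set (set T)) :=
  [/\ W set0, forall G, W G -> open G & forall G G', W G -> W G' -> W (G `|` G')].

(** Covers closed under finite unions let one member replace a finite subcover, and make the
    differences with these members downward directed, as [ker_bigcap_approx] requires. *)
Definition dir_compact {T : topologicalType} (N : set T) :=
  forall W, union_closed W -> N `<=` \bigcup_(G in W) G -> exists2 G, W G & N `<=` G.

Definition dir_lindelof {T : topologicalType} (F : set T) :=
  forall W, union_closed W -> F `<=` \bigcup_(G in W) G ->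
  exists2 g : nat -> set T, forall n, W (g n) & F `<=` \bigcup_n g n.

(** The differences of [F] with members of the cover have empty intersection, whose kernel is all of
    [A]; so every [c] is a limit of elements of their kernels. *)
Lemma cover_approx (F : set (Prim A)) W c d : closed F -> union_closed W ->
  F `<=` \bigcup_(G in W) G -> 0 < d ->
  exists2 G, W G & exists2 j, ker (F `\` G) j & nm (c - j) < d.
Proof.
move=> Fc [W0 Wo WU] FW d0.
have [||||_ [G WG <-] [j Gj cj]] :=
  @ker_bigcap_approx [set F `\` G | G in W] c _ _ _ _ d d0.
- by exists (F `\` set0), set0.
- by move=> _ [G WG <-]; apply: closedI => //; exact/open_closedC/Wo.
- move=> _ _ [G WG <-] [G' WG' <-]; exists (F `\` (G `|` G')).
    by exists (G `|` G') => //; exact: WU.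
  by rewrite setDUr.
- move=> P FP; exfalso; have FP' G : W G -> F P /\ ~ G P.
    by move=> WG; apply: (FP (F `\` G)); exists G.
  have [/FW[G WG GP] _] := FP' _ W0.
  by have [_] := FP' G WG.
by exists G => //; exists j.
Qed.

(** Take [j] within 1 of [e] vanishing on the uncovered part of [N]. At an uncovered point [e] would
    fix the non-zero vector pi a x and [j] would kill it, against contractivity. *)
Lemma unital_compact (N : set (Prim A)) e : closed N ->
  (forall a, ker N (e ** a - a)) -> dir_compact N.
Proof.
move=> Nc eN W Wu NW; have [G WG [j Gj ej]] := cover_approx e Nc Wu NW ltr01.
exists G => // P NP; apply: contrapT => nGP.
have Pj : ideal_of P j by apply: Gj.
have [H [ip [pi [Hip Hpi [[a [x pax]] _] PE]]]] := prim_rep P.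
have := rep_contractive cnA Hip Hpi (e - j) (pi a x).
have jx : pi j (pi a x) = 0 by move: Pj; rewrite PE; apply.
have ex : pi e (pi a x) = pi a x.
  have := eN a P NP; rewrite PE => /(_ x); rewrite (repD Hpi) (repN Hpi) (repM Hpi).
  by move=> /eqP; rewrite subr_eq0 => /eqP.
rewrite (repD Hpi) (repN Hpi) jx subr0 ex.
have : 0 < nm (pi a x).
  by rewrite lt_def nm_ge0 andbT; apply: contraNneq pax => /nm0_eq0 ->.
nra.
Qed.

(** Countably many members suffice to approximate each [u n] within each 1 / (m + 1). A primitive
    ideal of [F] outside all of them would contain every [u n], hence all of [A]. *)
Lemma prim_lindelof (F : set (Prim A)) : closed F -> dir_lindelof F.
Proof.
move=> Fc W Wu FW; have [u1 ul ur] := Hu.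
have /choice[G GP] : forall ij : nat * nat, exists G, W G /\
    exists2 j, ker (F `\` G) j & nm (u ij.1 - j) < ij.2.+1%:R^-1.
  move=> [n m]; have m0 : 0 < m.+1%:R^-1 :> R by rewrite invr_gt0.
  by have [G WG Gj] := cover_approx (u n) Fc Wu FW m0; exists G.
have [W0 _ _] := Wu.
exists (fun k => if unpickle k is Some nm then G nm else set0).
  by move=> k; case: unpickle => [nm|//]; exact: (GP nm).1.
move=> P FP; apply: contrapT => nP.
have nG nm : ~ G nm P.
  by move=> GnmP; apply: nP; exists (pickle nm) => //; rewrite pickleK.
have IP := prim_ideal cnA P.
have Pu n : ideal_of P (u n).
  apply: (cni_closed IP) => d d0; have [N Nd] := inv_natS_lt d0.
  have [_ [j Gj uj]] := GP (n, N); exists j.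
    by apply: Gj; split=> //; exact: nG.
  by apply: lt_trans uj _; exact: Nd.
apply: (primitive_proper (ideal_of_primitive P)); apply/seteqP; split=> // a _.
by apply: (closed_lim (cni_closed IP) (ul a)) => n; exact: (cniMr IP).
Qed.

End Separation.

(** * Separation in Prim(A) *)

Section Urysohn.
Context {R : realType} {T : topologicalType}.
Variable rel : set T -> set T -> Prop.
Hypothesis rel_closed : forall B V, rel B V -> closed B.
Hypothesis rel_open : forall B V, rel B V -> open V.
Hypothesis rel_sub : forall B V, rel B V -> B `<=` V.
Hypothesis rel_interp : forall B V, rel B V ->
  exists V' B', [/\ rel B V', V' `<=` B' & rel B' V].

Section Function.
Variables B0 V0 : set T.
Hypothesis rel0 : rel B0 V0.
Variable mid : set T * set T -> set T * set T.
Hypothesis midP : forall B V, rel B V ->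
  [/\ rel B (mid (B, V)).1, (mid (B, V)).1 `<=` (mid (B, V)).2
    & rel (mid (B, V)).2 V].

(* At the dyadic number [j / 2^n] sits an open set [.1] inside a closed set
   [.2]. *)
Fixpoint dyadic n j : set T * set T :=
  if n is n'.+1 then
    if odd j then mid ((dyadic n' j./2).2, (dyadic n' j./2.+1).1)
    else dyadic n' j./2
  else if j is 0 then (set0, B0) else (V0, setT).

Let V n j := (dyadic n j).1.
Let B n j := (dyadic n j).2.

Lemma dyadic_double n j : dyadic n.+1 j.*2 = dyadic n j.
Proof. by rewrite /= odd_double doubleK. Qed.

Lemma dyadic_rel n j : (j < 2 ^ n)%N ->
  rel (B n j) (V n j.+1) /\ V n j.+1 `<=` B n j.+1.
Proof.
elim: n j => [|n IHn] j; first by rewrite expn0 ltnS leqn0 => /eqP ->; split.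
move=> jn; have jn2 : (j./2 < 2 ^ n)%N by rewrite ltn_half_double -muln2 -expnSr.
have [r1 s1] := IHn _ jn2; have [m1 m2 m3] := midP r1.
rewrite /B /V /= uphalf_half; have [oj|ej] := boolP (odd j); rewrite ?add0n ?add1n //=.
Qed.

Lemma dyadic_last n : dyadic n (2 ^ n) = (V0, setT).
Proof. by elim: n => // n <-; rewrite expnS mul2n dyadic_double. Qed.

Lemma dyadic_up n m j : dyadic (n + m) (j * 2 ^ m) = dyadic n j.
Proof.
elim: m => [|m IHm]; first by rewrite addn0 muln1.
by rewrite addnS expnS mulnCA mul2n dyadic_double.
Qed.

Lemma dyadic_step n j : (j < 2 ^ n)%N -> B n j `<=` V n j.+1.
Proof. by move=> /dyadic_rel[/rel_sub]. Qed.

Lemma dyadic_mono n i j : (i <= j)%N -> (j <= 2 ^ n)%N -> B n i `<=` B n j.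
Proof.
move=> /subnKC <-; elim: (j - i)%N => [|d IHd]; first by rewrite addn0 => _ x.
rewrite addnS => lt; apply: subset_trans (IHd (ltnW lt)) _.
by apply: subset_trans (dyadic_step lt) _; have [_] := dyadic_rel lt.
Qed.

Definition dyadic_values x : set R :=
  [set r | exists n j, [/\ (j <= 2 ^ n)%N, B n j x & r = j%:R / 2 ^+ n]].

Definition dyadic_fun x := inf (dyadic_values x).

Let p2 n : 0 < 2 ^+ n :> R. Proof. by rewrite exprn_gt0. Qed.

Lemma dyadic_values1 x : dyadic_values x 1.
Proof.
by exists 0%N, 1%N; split=> //; rewrite expr0 divr1.
Qed.

Lemma dyadic_lbound x : has_lbound (dyadic_values x).
Proof. by exists 0 => _ [n [j [_ _ ->]]]; rewrite divr_ge0// ltW. Qed.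

Lemma dyadic_fun_le x n j : (j <= 2 ^ n)%N -> B n j x ->
  dyadic_fun x <= j%:R / 2 ^+ n.
Proof. by move=> jn Bx; apply: ge_inf; [exact: dyadic_lbound|exists n, j]. Qed.

Lemma dyadic_fun01 x : 0 <= dyadic_fun x <= 1.
Proof.
apply/andP; split; last by apply: ge_inf; [exact: dyadic_lbound|exact: dyadic_values1].
apply: lb_le_inf; first by exists 1; exact: dyadic_values1.
by move=> _ [n [j [_ _ ->]]]; rewrite divr_ge0// ltW.
Qed.

Lemma dyadic_fun_ge x n j : (j <= 2 ^ n)%N -> ~ B n j x ->
  j%:R / 2 ^+ n <= dyadic_fun x.
Proof.
move=> jn nB; apply: lb_le_inf; first by exists 1; exact: dyadic_values1.
move=> _ [m [i [im Bi ->]]]; rewrite leNgt; apply/negP.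
rewrite ltr_pdivrMr// mulrAC ltr_pdivlMr// -!natrX -!natrM ltr_nat => lt.
apply: nB; rewrite /B -(dyadic_up n m).
apply: (@dyadic_mono _ (i * 2 ^ n)).
- exact: ltnW.
- by rewrite expnD leq_mul2r jn orbT.
- by rewrite /B addnC dyadic_up.
Qed.

Lemma pow2_small (d : R) : 0 < d -> exists n, (2 ^+ n)^-1 < d.
Proof.
move=> d0; have /cvgrPdist_lt/(_ d d0) : (2^-1 : R) ^+ n @[n --> \oo] --> 0.
  by apply: cvg_expr; rewrite ger0_norm ?invr_ge0// invf_lt1// ltr1n.
move=> [N _ /(_ N (leqnn N))] /=; rewrite sub0r normrN ger0_norm ?exprn_ge0 ?invr_ge0//.
by rewrite exprVn => lt; exists N.
Qed.

Lemma dyadic_fun_continuous : continuous dyadic_fun.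
Proof.
move=> x; apply/cvgrPdist_lt => d d0; near=> y.
rewrite distrC ltr_distl; apply/andP; split; near: y.
- have [fd|fd] := ltP (dyadic_fun x) d.
    by apply: nearW => y; case/andP: (dyadic_fun01 y); lra.
  have [n nd] := @pow2_small (d / 2) ltac:(by rewrite divr_gt0).
  have [f0 f1] := andP (dyadic_fun01 x).
  have a0 : 0 <= (dyadic_fun x - d) * 2 ^+ n by rewrite mulr_ge0 ?subr_ge0// ltW.
  (* j / 2^n is the first dyadic of level [n] above f x - d; since 2^-n < d / 2 it is still below f
     x, so [x] lies outside the closed set [B n j]. *)
  pose j := (Num.truncn ((dyadic_fun x - d) * 2 ^+ n)).+1.
  have /andP[jl jr] := truncn_itv a0; rewrite -/j in jr.
  have ja : dyadic_fun x - d < j%:R / 2 ^+ n by rewrite ltr_pdivlMr.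
  have jf : j%:R / 2 ^+ n < dyadic_fun x.
    rewrite /j -natr1 mulrDl mul1r; apply: (@le_lt_trans _ _ (dyadic_fun x - d + (2 ^+ n)^-1)).
      by rewrite lerD2r ler_pdivrMr.
    by lra.
  have jn : (j < 2 ^ n)%N.
    rewrite -(ltr_nat R) natrX -[ltRHS]mul1r -ltr_pdivrMr//.
    exact: lt_le_trans jf f1.
  have nB : ~ B n j x by move=> /(dyadic_fun_le (ltnW jn)); rewrite leNgt jf.
  have Bc : closed (B n j) by have [/rel_closed] := dyadic_rel jn.
  have : nbhs x (~` B n j).
    by apply: open_nbhs_nbhs; split=> //; exact: closed_openC.
  apply: filterS => y /(dyadic_fun_ge (ltnW jn)); exact: lt_le_trans.
- have [_ [n [j [jn Bj ->]]] lt] := inf_adherent d0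
    (conj (ex_intro _ 1 (dyadic_values1 x)) (dyadic_lbound x)).
  rewrite -/(dyadic_fun x) in lt.
  have [jn'|jn'] := ltnP j (2 ^ n); last first.
    have jE : j = (2 ^ n)%N by apply/eqP; rewrite eqn_leq jn jn'.
    move: lt; rewrite jE natrX divff ?gt_eqF// => lt.
    apply: nearW => y; apply: le_lt_trans lt; by case/andP: (dyadic_fun01 y).
  (* [B n j] need not be a neighbourhood of [x]; the open set at the next dyadic of level n + m is
     one, and raises the bound by at most 2^-m < e. *)
  pose e := dyadic_fun x + d - j%:R / 2 ^+ n.
  have [m me] := @pow2_small e ltac:(by rewrite subr_gt0).
  have jm : (j * 2 ^ m < 2 ^ (n + m))%N by rewrite expnD ltn_pmul2r ?expn_gt0.
  have [r1 VB] := dyadic_rel jm.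
  have : nbhs x (V (n + m) (j * 2 ^ m).+1).
    apply: open_nbhs_nbhs; split; first exact: rel_open r1.
    by apply: (dyadic_step jm); rewrite /B dyadic_up.
  apply: filterS => y /VB/(dyadic_fun_le jm) /le_lt_trans; apply.
  rewrite -natr1 mulrDl natrM natrX exprD -mulf_div divff ?gt_eqF// mulr1 mul1r.
  have : (2 ^+ n * 2 ^+ m)^-1 <= (2 ^+ m)^-1 :> R.
    rewrite lef_pV2 ?posrE ?mulr_gt0// ler_peMl ?(ltW (p2 m))//.
    by rewrite exprn_ege1// ler1n.
  by move: me; rewrite /e; lra.
Unshelve. all: by end_near. Qed.

Lemma dyadic_fun0 x : B0 x -> dyadic_fun x = 0.
Proof.
move=> Bx; apply/eqP; rewrite eq_le; case/andP: (dyadic_fun01 x) => -> _.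
by have := @dyadic_fun_le x 0 0 isT Bx; rewrite mul0r => ->.
Qed.

Lemma dyadic_fun1 x : ~ V0 x -> dyadic_fun x = 1.
Proof.
move=> nV; apply/eqP; rewrite eq_le; case/andP: (dyadic_fun01 x) => _ -> /=.
apply: lb_le_inf; first by exists 1; exact: dyadic_values1.
move=> _ [n [j [jn Bj ->]]]; have [jn'|jn'] := ltnP j (2 ^ n).
  exfalso; apply: nV; have : V n (2 ^ n) x; last by rewrite /V dyadic_last.
  have [m mE] : exists m, (2 ^ n)%N = m.+1.
    by exists (2 ^ n).-1; rewrite prednK// expn_gt0.
  rewrite mE; apply: dyadic_step; first by rewrite mE.
  by apply: dyadic_mono Bj; rewrite ?mE -ltnS -?mE.
have -> : j = (2 ^ n)%N by apply/eqP; rewrite eqn_leq jn jn'.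
by rewrite natrX divff ?gt_eqF.
Qed.

End Function.

Lemma urysohn_interpolation B0 V0 : rel B0 V0 ->
  exists f : T -> R, [/\ continuous f, forall x, 0 <= f x <= 1,
    forall x, B0 x -> f x = 0 & forall x, ~ V0 x -> f x = 1].
Proof.
move=> r0; have /choice[mid midP] : forall BV : set T * set T,
    exists VB : set T * set T, rel BV.1 BV.2 ->
      [/\ rel BV.1 VB.1, VB.1 `<=` VB.2 & rel VB.2 BV.2].
  move=> [B V]; have [/rel_interp[V' [B' h]]|nr] := pselect (rel B V).
    by exists (V', B').
  by exists (B, V).
have midP' B V := midP (B, V).
exists (dyadic_fun B0 V0 mid); split.
- exact: dyadic_fun_continuous.
- exact: dyadic_fun01.
- exact: dyadic_fun0.
- exact: dyadic_fun1.
Qed.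

End Urysohn.

Lemma set0_absurd (T : Type) (A : set T) x (Q : Prop) : A = set0 -> A x -> Q.
Proof. by move=> ->. Qed.

Section LindelofSeparation.
Context {T : topologicalType}.
Implicit Types S C N : set T.

Lemma dir_lindelof_monotone S (W : set (set T)) : dir_lindelof S ->
  union_closed W -> S `<=` \bigcup_(G in W) G ->
  exists g : nat -> set T, [/\ forall n, W (g n),
    forall n m, (n <= m)%N -> g n `<=` g m & S `<=` \bigcup_n g n].
Proof.
move=> SL Wu SW; have [g Wg Sg] := SL W Wu SW; have [W0 Wo WU] := Wu.
pose h := fix h n := if n is m.+1 then h m `|` g n else g 0%N.
exists h; split.
- by elim=> [|n IHn] /=; [exact: Wg|apply: WU => //; exact: Wg].
- move=> n m /subnKC <-; elim: (m - n)%N => [|d IHd]; first by rewrite addn0.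
  by rewrite addnS => x /IHd hx; left.
- by move=> x /Sg[[|n] _ gx]; [exists 0%N|exists n.+1 => //; right].
Qed.

Lemma closure_disjoint_union_closed C :
  union_closed [set G | open G /\ closure G `&` C = set0].
Proof.
split=> [|G []//|G G' [Go GC] [G'o G'C]].
  by split; [exact: open0|rewrite closure0 set0I].
by split; [exact: openU|rewrite closureU setIUl GC G'C setU0].
Qed.

(** The proof that a regular Lindelof space is normal. Monotone covers let a single closure be
    removed at each index. *)
Lemma lindelof_separation S C : dir_lindelof S -> dir_lindelof C ->
  (forall x, S x -> exists G, [/\ open G, G x & closure G `&` C = set0]) ->
  (forall x, C x -> exists G, [/\ open G, G x & closure G `&` S = set0]) ->
  exists V, [/\ open V, S `<=` V & closure V `&` C = set0].
Proof.
move=> SL CL Sreg Creg.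
have [x /Sreg[G [Go Gx GC]]|a [aP amono Sa]] :=
  dir_lindelof_monotone SL (closure_disjoint_union_closed C).
  by exists G.
have [x /Creg[G [Go Gx GS]]|c [cP cmono Cc]] :=
  dir_lindelof_monotone CL (closure_disjoint_union_closed S).
  by exists G.
pose V := \bigcup_n (a n `\` closure (c n)).
pose V' := \bigcup_n (c n `\` closure (a n)).
have Vo : open V.
  apply: bigcup_open => n _; apply: openI; first by have [] := aP n.
  exact/closed_openC/closed_closure.
have V'o : open V'.
  apply: bigcup_open => n _; apply: openI; first by have [] := cP n.
  exact/closed_openC/closed_closure.
have VV' : V `&` V' = set0.
  apply/seteqP; split=> // x [[n _ [an ncn]] [m _ [cm nam]]].
  have [nm|/ltnW mn] := leqP n m.
    by apply: nam; apply: subset_closure; exact: amono nm _ an.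
  by apply: ncn; apply: subset_closure; exact: cmono mn _ cm.
exists V; split=> //.
  move=> x Sx; have [n _ an] := Sa x Sx; exists n => //; split=> // cx.
  by have [_ cS] := cP n; apply: (@set0_absurd _ _ x _ cS).
apply/seteqP; split=> // x [Vx Cx].
have V'x : V' x.
  have [n _ cn] := Cc x Cx; exists n => //; split=> // ax.
  by have [_ aC] := aP n; apply: (@set0_absurd _ _ x _ aC).
have [y [Vy V'y]] := Vx V' (open_nbhs_nbhs (conj V'o V'x)).
by apply: (@set0_absurd _ _ y _ VV').
Qed.

End LindelofSeparation.

(** * Separating H from closed sets by continuous functions *)

Section LocallyClosed.
Context {T : topologicalType}.
Variables (H : set T) (k : nat).
Implicit Types (B C N S V : set T) (x y : T).

Let U := interior H.

Hypothesis H_closed : closed H.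
Hypothesis lindelof : forall S, closed S -> dir_lindelof S.
Hypothesis H_compact : forall x, H x -> ~ U x ->
  exists N, [/\ closed N, dir_compact N & interior (N `|` U) x].
Hypothesis H_regular : forall x, ~ H x ->
  exists G, [/\ open G, G x & closure G `&` H = set0].
Hypothesis short_paths : forall x y s, sim_path x y s ->
  exists2 s', sim_path x y s' & (size s' <= k)%N.

Lemma inseparable_refl x : inseparable x x.
Proof.
by move=> [G [G' [_ _ Gx G'x GG']]]; apply: (@set0_absurd _ _ x _ GG').
Qed.

Lemma inseparable_sym x y : inseparable x y -> inseparable y x.
Proof.
by move=> xy [G [G' [Go G'o Gy G'x GG']]]; apply: xy; exists G', G; rewrite setIC.
Qed.

Lemma inseparable_closure x y G : open G -> G x -> inseparable x y -> closure G y.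
Proof.
move=> Go Gx xy; apply: contrapT => nGy; apply: xy; exists G, (~` closure G).
split=> //; first exact/closed_openC/closed_closure.
by apply/disjoints_subset; rewrite setCK; exact: subset_closure.
Qed.

Definition nbr B := [set y | exists2 x, B x & inseparable x y].

Lemma sub_nbr B : B `<=` nbr B.
Proof. by move=> x Bx; exists x => //; exact: inseparable_refl. Qed.

Lemma nbr_mono B C : B `<=` C -> nbr B `<=` nbr C.
Proof. by move=> BC y [x Bx xy]; exists x => //; exact: BC. Qed.

Lemma nbr_iter_le n m B : (n <= m)%N -> iter n nbr B `<=` iter m nbr B.
Proof.
move=> /subnKC <-; elim: (m - n)%N => [|d IHd]; first by rewrite addn0.
by rewrite addnS => x /IHd; exact: sub_nbr.
Qed.

Lemma nbr_iter_path n B y : iter n nbr B y ->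
  exists2 x, B x & exists s, sim_path x y s.
Proof.
elim: n y => [|n IHn] y /=; first by move=> By; exists y => //; exists [::].
move=> [z /IHn[x Bx [s [ps ls]]] zy]; exists x => //; exists (rcons s y).
by split; rewrite ?last_rcons// rcons_path ps ls; apply/asboolP.
Qed.

Lemma path_nbr_iter B x y s : B x -> sim_path x y s -> iter (size s) nbr B y.
Proof.
move=> Bx [+ <-]; elim/last_ind: s => [//|s z IHs].
rewrite rcons_path last_rcons size_rcons => /andP[/IHs sB /asboolP lz].
by exists (last x s).
Qed.

(** The path bound enters here: a point reached in k + 1 steps is also reached in at most [k]. *)
Lemma nbr_iter_saturated B : nbr (iter k nbr B) `<=` iter k nbr B.
Proof.
move=> y By; have [x Bx [s /short_paths[s' ps sk]]] := @nbr_iter_path k.+1 B y By.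
exact: nbr_iter_le sk _ (path_nbr_iter Bx ps).
Qed.

(** Near such a point, separation is a matter of the compact [N]: the rest lies in [U], whose
    closure stays in [H]. *)
Definition near_compact := [set x | exists N, [/\ closed N, dir_compact N & interior (N `|` U) x]].

Lemma open_near_compact : open near_compact.
Proof.
rewrite openE => x [N [Nc Nk Nx]]; apply: filterS (open_nbhs_nbhs (conj (@open_interior _ _) Nx)).
by move=> y Ny; exists N.
Qed.

Lemma sub_near_compact : H `<=` near_compact.
Proof.
move=> x Hx; have [Ux|nUx] := pselect (U x); last exact: H_compact.
exists set0; split; first exact: closed0.
  by move=> W [W0 _ _] _; exists set0.
by rewrite set0U; apply: (open_nbhs_nbhs (conj (@open_interior _ H) Ux)).
Qed.

Lemma closure_U : closure U `<=` H.
Proof.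
move=> x Ux; rewrite ((closure_id H).1 H_closed).
by apply: closureS Ux; exact: interior_subset.
Qed.

Lemma compact_separation N C x : dir_compact N -> closed C ->
  (forall y, N y -> C y -> ~ inseparable x y) ->
  exists G, [/\ open G, G x & N `&` C `&` closure G = set0].
Proof.
move=> Nk Cc xC.
pose W := [set G | open G /\
  exists G', [/\ open G', G' x & G `&` C `&` closure G' = set0]].
have Wu : union_closed W.
  split=> [|G []//|G G' [Go [D [Do Dx GD]]] [G'o [D' [D'o D'x GD']]]].
    by split; [exact: open0|exists setT; rewrite !set0I; split=> //; exact: openT].
  split; first exact: openU.
  exists (D `&` D'); split=> //; first exact: openI.
  apply/seteqP; split=> // y [[[Gy|Gy] Cy] Dy].
    by rewrite -GD; split=> //; apply: closureS Dy; exact: subIsetl.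
  by rewrite -GD'; split=> //; apply: closureS Dy; exact: subIsetr.
have [y Ny|G [_ [G' [G'o G'x GG']]] NG] := Nk W Wu.
  have [Cy|nCy] := pselect (C y); last first.
    exists (~` C) => //; split; first exact: closed_openC.
    exists setT; split=> //; first exact: openT.
    by rewrite setICl set0I.
  have /contrapT[D [D' [Do D'o Dx D'y DD']]] := xC y Ny Cy.
  exists D' => //; split=> //; exists D; split=> //.
  apply/seteqP; split=> // z [[D'z _] Dz].
  have [w [Dw D'w]] := Dz D' (open_nbhs_nbhs (conj D'o D'z)).
  by apply: (@set0_absurd _ _ w _ DD').
exists G'; split=> //; apply/seteqP; split=> // y [[Ny Cy] Gy].
by rewrite -GG'; split=> //; split=> //; exact: NG.
Qed.

Lemma near_compact_separation x C : near_compact x -> closed C -> C `&` H = set0 ->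
  (forall y, C y -> ~ inseparable x y) ->
  exists G, [/\ open G, G x & closure G `&` C = set0].
Proof.
move=> [N [Nc Nk Nx]] Cc CH xC.
have [|G [Go Gx NCG]] := @compact_separation N C x Nk Cc; first by move=> y _; exact: xC.
exists (G `&` interior (N `|` U)); split=> //; first by apply: openI => //; exact: open_interior.
apply/seteqP; split=> // y [Gy Cy].
have [Ny|Uy] : (N `|` H) y.
  have : closure (N `|` U) y.
    by apply: closureS Gy => z [_ /interior_subset].
  by rewrite closureU -((closure_id N).1 Nc) => -[Ny|/closure_U Uy]; [left|right].
- by rewrite -NCG; split=> //; apply: closureS Gy; exact: subIsetl.
- by rewrite -CH.
Qed.

(** Cutting the neighbourhood down to the complement of [H] removes its part in [U], so [S] may meet
    [H]. *)
Lemma near_compact_separation_out x S : near_compact x -> ~ H x -> closed S ->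
  (forall y, S y -> ~ inseparable x y) ->
  exists G, [/\ open G, G x & closure G `&` S = set0].
Proof.
move=> [N [Nc Nk Nx]] nHx Sc xS.
have [|G [Go Gx NSG]] := @compact_separation N S x Nk Sc; first by move=> y _; exact: xS.
exists (G `&` interior (N `|` U) `&` ~` H); split=> //.
  apply: openI; last exact: closed_openC.
  by apply: openI => //; exact: open_interior.
apply/seteqP; split=> // y [Gy Sy].
rewrite -NSG; split; last by apply: closureS Gy => z [[]].
split=> //; rewrite ((closure_id N).1 Nc); apply: closureS Gy => z [[_ /interior_subset[//|Uz]] nHz].
by exfalso; apply: nHz; exact: interior_subset.
Qed.

(** A limit point [x] outside [nbr B] has a neighbourhood whose closure misses [B]; but that closure
    contains every point inseparable from a point of the neighbourhood. *)
Lemma closed_nbr B : closed B -> H `<=` B -> closure (nbr B) `<=` near_compact ->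
  closed (nbr B).
Proof.
move=> Bc HB Bnear x xB; have [Hx|nHx] := pselect (H x).
  by apply: sub_nbr; exact: HB.
apply: contrapT => nBx.
have [|G [Go Gx GB]] := near_compact_separation_out (Bnear x xB) nHx Bc.
  by move=> y By xy; apply: nBx; exists y => //; exact: inseparable_sym.
have [y [[z Bz zy] Gy]] := xB G (open_nbhs_nbhs (conj Go Gx)).
apply: (@set0_absurd _ _ z _ GB); split=> //.
exact: inseparable_closure Go Gy (inseparable_sym zy).
Qed.

(** Saturation separates points of [S] from points of [C], and near-compactness turns this into the
    local separation that [lindelof_separation] asks for. At points of [C] that are not near-compact
    it has to be supplied. *)
Lemma saturated_separation S C : closed S -> nbr S `<=` S -> H `<=` S ->
  S `<=` near_compact -> closed C -> C `&` S = set0 ->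
  (forall x, C x -> (exists G, [/\ open G, G x & closure G `&` S = set0]) \/ near_compact x) ->
  exists V, [/\ open V, S `<=` V & closure V `&` C = set0].
Proof.
move=> Sc Ss HS Sg Cc CS Creg.
have CH : C `&` H = set0.
  by apply/seteqP; split=> // x [Cx /HS Sx]; rewrite -CS.
apply: lindelof_separation; [exact: lindelof|exact: lindelof| |].
  move=> x Sx; apply: near_compact_separation => // [|y Cy xy]; first exact: Sg.
  by apply: (@set0_absurd _ _ y _ CS); split=> //; apply: Ss; exists x.
move=> x Cx; have [//|gx] := Creg x Cx; apply: near_compact_separation_out => //.
  by move=> Hx; apply: (@set0_absurd _ _ x _ CH).
move=> y Sy xy; apply: (@set0_absurd _ _ x _ CS); split=> //.
by apply: Ss; exists y => //; exact: inseparable_sym.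
Qed.

Lemma nbr_H : nbr H `<=` H.
Proof.
move=> y [x Hx xy]; apply: contrapT => /H_regular[G [Go Gy GH]].
apply: (@set0_absurd _ _ x _ GH); split=> //.
exact: inseparable_closure Go Gy (inseparable_sym xy).
Qed.

Lemma separating_function (R : realType) (Y : set T) : closed Y -> Y `&` H = set0 ->
  exists f : T -> R, [/\ continuous f, forall x, 0 <= f x <= 1,
    forall x, H x -> f x = 0 & forall x, Y x -> f x = 1].
Proof.
move=> Yc YH.
have gc : closed (~` near_compact) by exact/open_closedC/open_near_compact.
(* Avoiding the complement of [near_compact] as well as [Y] keeps the closure of [A1] where
   [closed_nbr] applies. *)
have [|||||A1 [A1o HA1 A1Y]] := @saturated_separation H (Y `|` ~` near_compact) H_closed nbr_H.
- by [].
- exact: sub_near_compact.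
- exact: closedU.
- rewrite setIUl YH set0U; apply/seteqP; split=> // x [ngx Hx].
  by apply: ngx; exact: sub_near_compact.
- by move=> x _; have [/sub_near_compact|/H_regular] := pselect (H x); [right|left].
have A1g : closure A1 `<=` near_compact.
  by move=> x A1x; apply: contrapT => ngx; apply: (@set0_absurd _ _ x _ A1Y); split=> //; right.
have A1Y' x : A1 x -> ~ Y x.
  move=> A1x Yx; apply: (@set0_absurd _ _ x _ A1Y); split; last by left.
  exact: subset_closure.
(* The second shrinking supplies local separation outside [A1]: there the complement of the closure
   of [A2] is a neighbourhood whose closure misses every subset of [A2]. *)
have [|||||A2 [A2o HA2 A2A1]] := @saturated_separation H (~` A1) H_closed nbr_H.
- by [].
- exact: sub_near_compact.
- exact: open_closedC.
- by apply/seteqP; split=> // x [nA1 /HA1].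
- by move=> x _; have [/sub_near_compact|/H_regular] := pselect (H x); [right|left].
have {}A2A1 : closure A2 `<=` A1.
  by move=> x A2x; apply: contrapT => nA1x; apply: (@set0_absurd _ _ x _ A2A1).
pose rel B V := [/\ closed B, H `<=` B, open V, V `<=` A2 & iter k nbr B `<=` V].
have rel0 : rel H A2.
  split=> //; elim: (k) => //= n IHn x /nbr_mono.
  have HH : iter n nbr H `<=` H.
    by elim: (n) => //= m IHm y /(nbr_mono IHm)/nbr_H.
  by move=> /(_ H HH)/nbr_H/HA2.
have iter_closed B V : rel B V -> closed (iter k nbr B).
  move=> [Bc HB Vo VA2 BV].
  have : forall j, (j <= k)%N -> closed (iter j nbr B).
    elim=> //= j IHj jk; apply: closed_nbr; first exact: IHj (ltnW jk).
      by apply: subset_trans HB _; exact: (@nbr_iter_le 0 j).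
    apply: subset_trans A1g; apply: closureS.
    apply: subset_trans (nbr_iter_le (n := j.+1) jk) _.
    apply: subset_trans BV _; apply: subset_trans VA2 _.
    by apply: subset_trans A2A1; exact: subset_closure.
  exact.
have step S V : closed S -> nbr S `<=` S -> H `<=` S -> S `<=` V -> open V ->
    V `<=` A2 -> exists V', [/\ open V', S `<=` V' & closure V' `<=` V].
  move=> Sc Ss HS SV Vo VA2.
  have SA2 : S `<=` A2 by exact: subset_trans SV VA2.
  have [||||V' [V'o SV' V'V]] := @saturated_separation S (~` V) Sc Ss HS.
  - move=> x /SA2 A2x; apply: A1g; apply: subset_closure; apply: A2A1.
    exact: subset_closure.
  - exact: open_closedC.
  - by apply/seteqP; split=> // x [nVx /SV].
  - move=> x _; have [A1x|nA1x] := pselect (A1 x).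
      by right; apply: A1g; exact: subset_closure.
    left; exists (~` closure A2); split=> //.
    + exact/closed_openC/closed_closure.
    + by move=> /A2A1.
    + apply/seteqP; split=> // y [cy /SA2 A2y].
      have [z [ncz A2z]] := cy A2 (open_nbhs_nbhs (conj A2o A2y)).
      by apply: ncz; exact: subset_closure.
  exists V'; split=> // x V'x; apply: contrapT => nVx.
  by apply: (@set0_absurd _ _ x _ V'V).
(* One ~-step from an open set stays in its closure, so each step is absorbed by one more
   shrinking. *)
have chain S n V : closed S -> nbr S `<=` S -> H `<=` S -> S `<=` V -> open V ->
    V `<=` A2 -> exists V', [/\ open V', S `<=` V', V' `<=` V &
      iter n nbr (closure V') `<=` V].
  move=> Sc Ss HS; elim: n V => [|n IHn] V SV Vo VA2.
    have [V' [V'o SV' V'V]] := step S V Sc Ss HS SV Vo VA2.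
    by exists V'; split=> //; apply: subset_trans V'V; exact: subset_closure.
  have [V1 [V1o SV1 V1V]] := step S V Sc Ss HS SV Vo VA2.
  have V1V' : V1 `<=` V by apply: subset_trans V1V; exact: subset_closure.
  have [V' [V'o SV' V'V1 V'n]] := IHn V1 SV1 V1o (subset_trans V1V' VA2).
  exists V'; split=> //; first exact: subset_trans V1V'.
  move=> y [x /V'n V1x xy]; apply: V1V.
  exact: inseparable_closure V1o V1x xy.
have [||||f [fc f01 f0 f1]] := @urysohn_interpolation R T rel _ _ _ _ _ _ rel0.
- by move=> B V [].
- by move=> B V [].
- by move=> B V [_ _ _ _ BV]; apply: subset_trans BV; exact: (@nbr_iter_le 0 k).
- move=> B V rBV; have Sc := iter_closed B V rBV; have [Bc HB Vo VA2 BV] := rBV.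
  have HS : H `<=` iter k nbr B.
    by apply: subset_trans HB _; exact: (@nbr_iter_le 0 k).
  have [V' [V'o SV' V'V V'k]] := chain _ k V Sc (@nbr_iter_saturated B) HS BV Vo VA2.
  exists V', (closure V'); split.
  + by split=> //; exact: subset_trans V'V VA2.
  + exact: subset_closure.
  + split=> //; first exact: closed_closure.
    apply: subset_trans HS _; apply: subset_trans SV' _; exact: subset_closure.
exists f; split=> // x Yx; apply: f1 => A2x.
apply: A1Y' Yx; apply: A2A1; exact: subset_closure.
Qed.

End LocallyClosed.

(** * Passage between Prim(A) and X *)

Section CompletelyRegular.
Context (R : realType) {X : topologicalType}.
Hypotheses (X_hausdorff : hausdorff_space X) (X_lc : locally_compact [set: X]).

Lemma locally_compact_separator (x : X) (F : set X) : closed F -> ~ F x ->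
  exists f : X -> R, [/\ continuous f, forall y, 0 <= f y <= 1, f x = 1 &
    forall y, F y -> f y = 0].
Proof.
move=> Fc nFx.
have := @locally_compact_completely_regular X R X_lc X_hausdorff _ _ Fc nFx.
move=> /(uniform_separatorP (R := R))[g [gc g01 gx gF]].
exists (fun y => 1 - g y); split=> [y|y||y Fy].
- by apply: cvgB; [exact: cvg_cst|exact: gc].
- have /g01 /= : range g (g y) by exists y.
  by rewrite in_itv /= => /andP[? ?]; apply/andP; split; lra.
- have -> : g x = 0 by apply: gx; exists x. by rewrite subr0.
- have -> : g y = 1 by apply: gF; exists y. by rewrite subrr.
Qed.

End CompletelyRegular.

Lemma finite_Orc_short_paths {R : realType} (A : starAlgType R) :
  (Orc A < +oo)%E -> exists k, forall (P Q : Prim A) s, sim_path P Q s ->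
    exists2 s', sim_path P Q s' & (size s' <= k)%N.
Proof.
move=> Afin; have [k Ak] : exists k : nat, (Orc A < k%:R%:E)%E.
  case: (Orc A) Afin => [r _|//|_]; last by exists 0%N; rewrite ltNyr.
  exists (Num.truncn `|r|).+1; rewrite lte_fin.
  by apply: le_lt_trans (ler_norm r) _; rewrite truncnS_gt.
exists k => P Q s sP.
have CP : sim_component P P by exists [::].
have CQ : sim_component P Q by exists s.
have /le_lt_trans/(_ Ak) : (sim_diameter R (sim_component P) <= Orc A)%E.
  by apply: ereal_sup_ubound; exists P.
rewrite /sim_diameter; case: asboolP => [[x Cx] _|_].
  move: CP CQ; rewrite Cx /= => -> ->; exists [::] => //.
move=> Ck; have /le_lt_trans/(_ Ck) : (sim_dist R P Q <=
    ereal_sup [set sim_dist R p.1 p.2 | p in sim_component P `*` sim_component P])%E.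
  by apply: ereal_sup_ubound; exists (P, Q).
move=> /ereal_inf_lt[_ [s' sP' <-]]; rewrite lte_fin ltr_nat => s'k.
by exists s' => //; exact: ltnW.
Qed.

Lemma continuous_ptws_eval (I : eqType) (S V : topologicalType)
    (g : S -> {ptws I -> V}) (i : I) :
  continuous g -> continuous (fun s => g s i).
Proof.
move=> gc s; apply: (@continuous_comp _ {ptws I -> V} _ g (fun x => x i)).
  exact: gc.
exact: (@proj_continuous I (fun=> V) i).
Qed.

Section CompleteRegularizationOpen.
Context {R : realType} {T X : topologicalType} (phi : T -> X).
Hypothesis phi_cr : is_complete_regularization R phi.

(** [f] is an evaluation on [cr_space] composed with the quotient map; the embedding turns the open
    sublevel set of the evaluation into the trace of an open set of [X]. *)
Lemma complete_regularization_open (f : T -> R) (c : R) x : continuous f ->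
  (forall y, 0 <= f y <= 1) -> f x < c -> exists V, [/\ open V, V (phi x) &
    forall y, V (phi y) -> f y < c].
Proof.
move=> fc f01 fxc; have [h [hinj hopen] phiE] := phi_cr.
have bf : bounded_continuous f.
  split=> //; exists 1 => y; have /andP[y0 y1] := f01 y.
  by rewrite ger0_norm.
pose F : @bounded_continuous R T := exist (fun y => y \in @bounded_continuous R T) f (mem_set bf).
have evalE y : cr_eval (cr_map R y) F = f y.
  rewrite /cr_eval /cr_map /=.
  suff : cr_rel R (repr (\pi_(cr_quotient R T)%qT y)) y by move=> /asboolP; exact.
  have : repr (\pi_(cr_quotient R T)%qT y) = y %[mod (cr_quotient R T)]%qT by rewrite reprK.
  by move/eqmodP.
have ec : continuous (fun q : cr_space R T => cr_eval q F : R).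
  apply: (@continuous_ptws_eval _ _ _ (@cr_eval R T : cr_space R T -> _)).
  exact: (@initial_continuous _ _ (@cr_eval R T)).
have /hopen[V Vo VE] : open [set q : cr_space R T | (cr_eval q F : R) < c].
  have -> : [set q : cr_space R T | (cr_eval q F : R) < c] =
    (fun q : cr_space R T => cr_eval q F : R) @^-1` [set r | r < c] by [].
  by apply: open_comp; [move=> q _; exact: ec|exact: open_lt].
have VP y : V (phi y) <-> f y < c.
  have -> : V (phi y) = (h @^-1` V) (cr_map R y) by rewrite phiE.
  by rewrite -VE /= evalE.
by exists V; split=> [//||y]; [apply/VP|move/VP].
Qed.

End CompleteRegularizationOpen.

Lemma locally_modular_locally_closed {R : realType} {A : cstarAlgType R}
    {X : topologicalType} (phi : Prim A -> X) (E : set X) :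
  hausdorff_space X -> locally_compact [set: X] -> continuous phi ->
  sigma_unital A -> is_complete_regularization R phi -> (Orc A < +oo)%E ->
  closed_in (range phi) E -> locally_modular phi E -> locally_closed_at phi E.
Proof.
move=> Xh Xlc phic /sigma_unital_approximate[u Hu] phi_cr.
move=> /finite_Orc_short_paths[k short] [F Fc EF] lm Y Yc YE.
have HF : phi @^-1` E = phi @^-1` F.
  by rewrite EF; apply/seteqP; split=> [P []//|P FP]; split=> //; exists P.
have Hc : closed (phi @^-1` E) by rewrite HF; exact: preimage_closed.
have YH : Y `&` phi @^-1` E = set0.
  apply/seteqP; split=> // P [YP EP]; apply: (@set0_absurd _ _ (phi P) _ YE).
  by split=> //; exists P.
have Hcpt P : (phi @^-1` E) P -> ~ (phi @^-1` E)° P ->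
    exists N, [/\ closed N, dir_compact N & (N `|` (phi @^-1` E)°)° P].
  move=> HP nUP; have [|W [Wo WP] [e eW]] := lm P.
    by split=> //; exact: subset_closure.
  exists (hull (ker (W `\` (phi @^-1` E)°))); split.
  - exact: hull_closed.
  - apply: (unital_compact Hu (@hull_closed _ _ _) (e := e)) => a Q hQ.
    by apply: hQ; exact: (eW a).1.
  - exists W; split=> // Q WQ.
    have [UQ|nUQ] := pselect ((phi @^-1` E)° Q); [by right|left].
    by move=> a; apply.
have Hreg P : ~ (phi @^-1` E) P ->
    exists G, [/\ open G, G P & closure G `&` phi @^-1` E = set0].
  rewrite HF => nFP; have [f [fc _ fP fF]] := locally_compact_separator R Xh Xlc Fc nFP.
  have gc : continuous (f \o phi) by move=> Q; apply: continuous_comp; [exact: phic|exact: fc].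
  exists ((f \o phi) @^-1` [set r | 1/2 < r]); split.
  - by apply: open_comp; [move=> Q _; exact: gc|exact: open_gt].
  - by rewrite /= fP; lra.
  - apply/seteqP; split=> // Q [cQ FQ].
    have : ((f \o phi) @^-1` [set r | 1/2 <= r]) Q.
      have /closure_id -> : closed ((f \o phi) @^-1` [set r | 1/2 <= r]).
        by apply: preimage_closed; [move=> ? _; exact: gc|exact: closed_ge].
      by apply: closureS cQ => Q' /=; exact: ltW.
    by rewrite /= (fF _ FQ); lra.
have [f [fc f01 fH fY]] := separating_function Hc (fun S => prim_lindelof Hu (F := S))
  Hcpt Hreg short R Yc YH.
apply/seteqP; split=> // x [[cx [P _ Px]] EP].
move: cx EP; rewrite -{}Px => cx EP.
have [|V [Vo VP Vf]] := complete_regularization_open phi_cr (c := 1/2) (x := P) fc f01.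
  by rewrite fH //; lra.
have [_ [[Q YQ <-] /Vf]] := cx V (open_nbhs_nbhs (conj Vo VP)).
by rewrite fY //; lra.
Qed.

(** * Strict closedness *)

(** Otherwise log-convexity keeps every ratio at least d (1 + t) with t > 0, so a j >= d^j (1 + j t)
    a 0 as in Bernoulli's inequality, which outgrows d^j C. *)
Lemma log_convex_ratio {R : realType} (a : nat -> R) (C d : R) : 0 < d ->
  (forall j, 0 <= a j) -> (forall j, a j.+1 ^+ 2 <= a j * a j.+2) ->
  (forall j, a j <= d ^+ j * C) -> a 1%N <= d * a 0%N.
Proof.
move=> d0 a0 aconv aC; rewrite leNgt; apply/negP => a01.
have a00 : 0 < a 0%N.
  rewrite lt_def a0 andbT; apply/eqP => a00; move: a01 (aconv 0%N).
  by rewrite a00 mul0r mulr0; nra.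
pose t := a 1%N / (d * a 0%N) - 1.
have da0 : 0 < d * a 0%N by exact: mulr_gt0.
have t0 : 0 < t by rewrite subr_gt0 ltr_pdivlMr// mul1r.
have step j : 0 < a j /\ d * (1 + t) * a j <= a j.+1.
  elim: j => [|j [aj IH]].
    split=> //; rewrite /t addrC subrK mulrAC.
    by rewrite mulrC -mulrA mulVf ?mulr1// lt0r_neq0.
  have aj1 : 0 < a j.+1.
    by apply: lt_le_trans IH; rewrite !mulr_gt0// addr_gt0.
  split=> //; rewrite -(ler_pM2l aj); apply: le_trans (aconv j).
  by rewrite mulrCA expr2 [in X in _ <= X]mulrC mulrA mulrC ler_wpM2l// ltW.
have grow j : d ^+ j * (1 + j%:R * t) * a 0%N <= a j.
  elim: j => [|j IH]; first by rewrite expr0 mul0r addr0 !mul1r.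
  apply: le_trans (step j).2; rewrite exprS -!mulrA ler_pM2l//.
  have -> : d ^+ j * ((1 + j.+1%:R * t) * a 0%N) =
    d ^+ j * (1 + j%:R * t) * a 0%N + d ^+ j * (a 0%N * t).
    by rewrite -natr1; ring.
  have : d ^+ j * (a 0%N * t) <= a j * t.
    rewrite mulrA ler_pM2r//; apply: le_trans IH; rewrite ler_pM2r//.
    by rewrite ler_peMr ?exprn_ge0 ?(ltW d0)// lerDl mulr_ge0// ltW.
  by lra.
have dj j : 0 < d ^+ j by rewrite exprn_gt0.
have bound j : (1 + j%:R * t) * a 0%N <= C.
  rewrite -(ler_pM2l (dj j)); apply: le_trans (aC j).
  by rewrite mulrA; exact: grow.
have := bound (Num.truncn (C / (t * a 0%N))).+1.
apply/negP; rewrite -ltNge.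
have ta : 0 < t * a 0%N by exact: mulr_gt0.
have := truncnS_gt (C / (t * a 0%N)); rewrite ltr_pdivrMr// => Ct.
apply: lt_le_trans Ct _; move: (_.+1%:R) => k.
by rewrite [leRHS]mulrDl mul1r -mulrA lerDr ltW.
Qed.

Section StrictlyClosed.
Context {R : realType} {A : cstarAlgType R}.

Lemma strictly_closed_tilde (J : set A) : closed J -> strictly_closed (tilde J).
Proof.
move=> Jc; rewrite /strictly_closed.
pose g (b : strict_topology) := ((b : multiplier A).1, (b : multiplier A).2)
  : {ptws A -> A} * {ptws A -> A}.
have gc : continuous g by exact: initial_continuous.
have c1 a : continuous (fun b : strict_topology => (b : multiplier A).1 a).
  apply: (@continuous_ptws_eval _ strict_topology A (fun b => (g b).1) a) => b.
  by apply: (@continuous_comp _ _ _ g fst); [exact: gc|exact: cvg_fst].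
have c2 a : continuous (fun b : strict_topology => (b : multiplier A).2 a).
  apply: (@continuous_ptws_eval _ strict_topology A (fun b => (g b).2) a) => b.
  by apply: (@continuous_comp _ _ _ g snd); [exact: gc|exact: cvg_snd].
have -> : tilde J = \bigcap_a
    (((fun b : strict_topology => (b : multiplier A).1 a) @^-1` J) `&`
     ((fun b : strict_topology => (b : multiplier A).2 a) @^-1` J)).
  apply/seteqP; split=> [b bJ a _|b bJ a]; first exact: bJ.
  by have [] := bJ a I.
apply: closed_bigI => a _.
apply: closedI; (apply: preimage_closed; last exact: Jc) => b _; [exact: c1|exact: c2].
Qed.

End StrictlyClosed.

(** * Upper semicontinuity of the norm of a multiplier at points over E *)

Section Multipliers.
Context {R : realType} {A : cstarAlgType R} (u : nat -> A).
Hypothesis Hu : approximate_unit u.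

Let cnA := cstar_norm_nm A.
Let cnMA := @opn_cstar_norm R A.

Lemma prim_tilde (P : Prim A) :
  exists Q : Prim (multiplier A), ideal_of Q = tilde (ideal_of P).
Proof.
have [H [ip [pi [Hip Hpi Hirr PE]]]] := prim_rep P.
have [u1 ul _] := Hu.
have [s [Hs sirr _ _ sE]] := rep_extension u1 ul Hip Hpi Hirr.
by have [Q QE] := prim_of_rep Hip Hs sirr; exists Q; rewrite QE sE PE.
Qed.

(* [pi] extends to [M(A)], and [pi (h.1 a) = pi h (pi a)]: the condition says that
   [pi h] has norm at most [d]. *)
Definition small_at (h : multiplier A) (d : R) : set (Prim A) :=
  [set P | forall (H : completeNormedModType R[i]) (ip : H -> H -> R[i])
    (pi : A -> H -> H), is_inner_product ip -> is_representation ip pi ->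
    ideal_of P = [set a | forall x, pi a x = 0] ->
    forall a x, nm (pi (h.1 a) x) <= d * nm (pi a x)].

Section Base.
Context {X : topologicalType} (phi : Prim A -> X).
Hypothesis X_hausdorff : hausdorff_space X.
Hypothesis phi_cont : continuous phi.
Variable E : set X.

Lemma H_ideal_sub_tilde (phibar : Prim (multiplier A) -> stone_cech R X) :
  extends_base_map phi phibar -> H_ideal phibar E `<=` tilde (J_ideal phi E).
Proof.
move=> [_ ext] b bH a.
have tP P : (phi @^-1` E) P -> tilde (ideal_of P) b.
  move=> EP; have [Q QE] := prim_tilde P; rewrite -QE; apply: bH.
  by exists (phi P) => //; rewrite (ext P).
by split=> P /tP/(_ a)[].
Qed.

Hypothesis E_modular : locally_modular phi E.

(** At a boundary point, a unit [e] modulo the kernel of the nearby points outside [U] replaces [h]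
    by the element [h.1 e] of [A]; its distance to the kernel of a small neighbourhood bounds the
    norm of [h] there. *)
Lemma multiplier_norm_usc h P (d : R) : tilde (J_ideal phi E) h ->
  (phi @^-1` E) P -> 0 < d ->
  exists G, [/\ open G, G P & G `<=` small_at h d].
Proof.
move=> hJ EP d0.
have small0 Q : (phi @^-1` E) Q -> small_at h d Q.
  move=> EQ H ip pi Hip Hpi QE a x.
  have := (hJ a).1 Q EQ; rewrite QE => ->.
  by rewrite nm0 mulr_ge0 ?nm_ge0// ltW.
have [UP|nUP] := pselect ((phi @^-1` E)° P).
  exists (phi @^-1` E)°; split=> //; first exact: open_interior.
  by move=> Q /interior_subset; exact: small0.
have [|W [Wo WP] [e eW]] := E_modular (P := P).
  by split=> //; exact: subset_closure.
pose N := hull (ker (W `\` (phi @^-1` E)°)).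
have Nc : closed N by exact: hull_closed.
(* As [X] is Hausdorff, these sets intersect in the part of [N] over phi P, where [h.1 e]
   vanishes. *)
pose FF := [set N `&` phi @^-1` closure G | G in [set G | open G /\ G (phi P)]].
have [||||_ [G [Go GP] <-] [j jG hj]] := @ker_bigcap_approx _ _ u Hu FF (h.1 e) _ _ _ _ d d0.
- by exists (N `&` phi @^-1` closure setT), setT => //; split=> //; exact: openT.
- move=> _ [G [Go _] <-]; apply: closedI => //.
  by apply: preimage_closed => [? _|]; [exact: phi_cont|exact: closed_closure].
- move=> _ _ [G [Go GP] <-] [G' [G'o G'P] <-].
  exists (N `&` phi @^-1` closure (G `&` G')).
    by exists (G `&` G') => //; split=> //; exact: openI.
  move=> Q [NQ cQ]; split; split=> //;
    by apply: closureS cQ => // ? [].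
- move=> Q FQ; apply: (hJ e).1; rewrite /preimage /=.
  suff -> : phi Q = phi P by [].
  apply: X_hausdorff => G1 G2 /nbhs_interior; rewrite nbhsE /=.
  move=> [B1 [B1o B1Q] B1G] /nbhs_interior; rewrite nbhsE => -[B2 [B2o B2P] B2G].
  have [_ /(_ B1 (open_nbhs_nbhs (conj B1o B1Q)))[y [B2y B1y]]] :
      (N `&` phi @^-1` closure B2) Q by apply: FQ; exists B2.
  by exists y; split; apply: interior_subset; [exact: B1G|exact: B2G].
exists (W `&` phi @^-1` G); split=> //.
  by apply: openI => //; apply: open_comp => // ? _; exact: phi_cont.
move=> Q [WQ GQ]; have [EQ|nUQ] := pselect ((phi @^-1` E) Q); first exact: small0.
have WUQ : (W `\` (phi @^-1` E)°) Q by split=> // /interior_subset.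
have jQ : ideal_of Q j.
  by apply: jG; split; [move=> a; apply|exact: subset_closure].
move=> H ip pi Hip Hpi QE a x.
have IQ := prim_ideal cnA Q.
have /(ideal_mult1 Hu IQ h) : ideal_of Q (e ** a - a) by exact: (eW a).1.
have [_ hD hN _] := linear_scaleD (mult1_linear h).
rewrite hD hN mult1M QE => /(_ x); rewrite (repD Hpi) (repN Hpi) (repM Hpi).
move=> /eqP; rewrite subr_eq0 => /eqP <-.
have jx : pi j (pi a x) = 0 by move: jQ; rewrite QE; exact.
have := rep_contractive cnA Hip Hpi (h.1 e - j) (pi a x).
rewrite (repD Hpi) (repN Hpi) jx subr0 => /le_trans; apply.
by rewrite ler_wpM2r ?nm_ge0// ltW.
Qed.

End Base.
End Multipliers.

Section Saturation.
Context {R : realType} {A : cstarAlgType R} (u : nat -> A).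
Hypothesis Hu : approximate_unit u.
Context {X : topologicalType} (phi : Prim A -> X).
Hypotheses (X_hausdorff : hausdorff_space X) (X_lc : locally_compact [set: X]).
Hypothesis phi_cont : continuous phi.
Variable phibar : Prim (multiplier A) -> stone_cech R X.
Hypothesis phibar_ext : extends_base_map phi phibar.
Variable E : set X.
Hypotheses (E_range : E `<=` range phi) (E_modular : locally_modular phi E).
Hypothesis E_closed : locally_closed_at phi E.

Let cnA := cstar_norm_nm A.
Let cnMA := @opn_cstar_norm R A.

(* [K] is the set of multipliers vanishing wherever [h] is not small; as [phi]
   stays away from [x] there, [K] is not contained in [Q]. *)
Lemma small_multiplier h (d : R) (Q : Prim (multiplier A)) x :
  tilde (J_ideal phi E) h -> E x -> phibar Q = stone_cech_in R x -> 0 < d ->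
  exists K, [/\ cn_ideal (p := opn) K, ~ K `<=` ideal_of Q &
    forall n, K n -> opn (h ** n) <= d * opn n].
Proof.
move=> hJ Ex Qx d0; have [phibarc ext] := phibar_ext.
pose Y := closure (~` small_at h d).
have YE : (phi @` Y) `&` E = set0.
  apply/seteqP; split=> // y [[P YP Py] Ey].
  have [|G [Go GP Gsmall]] := multiplier_norm_usc Hu X_hausdorff phi_cont E_modular hJ (P := P) _ d0.
    by rewrite /preimage /= Py.
  by have [P' [nP' /Gsmall]] := YP G (open_nbhs_nbhs (conj Go GP)).
have nYx : ~ closure (phi @` Y) x.
  move=> cx; have := E_closed (@closed_closure _ _) YE.
  by apply/seteqP => -[/(_ x) + _]; apply; split=> //; split=> //; exact: E_range.
have [f [fc f01 fx fY]] := locally_compact_separator R X_hausdorff X_lc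
  (@closed_closure _ _) nYx.
have uf : unit_interval_maps f by [].
pose F : @unit_interval_maps R X :=
  exist (fun y => y \in @unit_interval_maps R X) f (mem_set uf).
pose g Q' : R := set_val (phibar Q') F.
have gc : continuous g.
  apply: (@continuous_ptws_eval _ (Prim (multiplier A)) R (fun Q' => set_val (phibar Q')) F).
  move=> Q'; apply: (@continuous_comp _ _ _ phibar set_val); first exact: phibarc.
  exact: (@initial_continuous _ _ set_val).
(* [g] carries [f] over to the primitive ideals of M(A): it is 1 at [Q] and 0 at the ideals tilde P
   with P in [Y]. So [ker W] is not contained in [Q], and its elements vanish on [Y]. *)
pose W := [set Q' | g Q' <= 1/2].
have Wc : closed W.
  have -> : W = g @^-1` [set r | r <= 1/2] by [].
  by apply: preimage_closed; [move=> ? _; exact: gc|exact: closed_le].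
exists (ker W); split; first exact: (ker_ideal cnMA).
  move=> /(closed_hull Wc); rewrite /W /= /g Qx -[set_val _ F]/(f x) fx.
  by lra.
move=> n nW.
have nY P a : Y P -> ideal_of P (n.1 a).
  move=> YP; have [QP QPE] := prim_tilde Hu P.
  have : ideal_of QP n; last by rewrite QPE => /(_ a)[].
  apply: nW; rewrite /W /= /g (ext P) // -[set_val _ F]/(f (phi P)).
  by rewrite fY; [lra|apply: subset_closure; exists P].
apply: opn_le => [|a]; first by rewrite mulr_ge0 ?opn_ge0// ltW.
apply: (@le_trans _ _ (d * nm (n.1 a))); last first.
  by rewrite -mulrA ler_pM2l// opn_bound.
apply: (prim_norm_le Hu) => [|H ip pi Hip Hpi Hirr y].
  by rewrite mulr_ge0 ?nm_ge0// ltW.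
have [P PE] := prim_of_rep Hip Hpi Hirr.
have [sP|nsP] := pselect (small_at h d P).
  apply: le_trans (sP _ _ _ Hip Hpi PE _ _) _.
  by rewrite -mulrA ler_pM2l//; exact: (rep_contractive cnA Hip Hpi).
have : ideal_of P (h.1 (n.1 a)).
  by apply: (ideal_mult1 Hu (prim_ideal cnA P)); apply: nY; exact: subset_closure.
by rewrite PE => ->; rewrite nm0 !mulr_ge0 ?nm_ge0// ltW.
Qed.

Lemma tilde_sub_H_ideal : tilde (J_ideal phi E) `<=` H_ideal phibar E.
Proof.
move=> b bJ Q [x Ex Qx].
have HJ := tilde_ideal Hu (ker_ideal cnA (phi @^-1` E)).
have [h hE] : exists h, h = adj b ** b by exists (adj b ** b).
have hJ : tilde (J_ideal phi E) h by rewrite hE; exact: (cniMl HJ).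
have hsa : adj h = h by rewrite hE adjM adjK.
have [H [ip [s [Hip Hs Hirr QE]]]] := prim_rep Q.
have [Hb bnm] := inner_product_real Hip.
have sC m := rep_contractive cnMA Hip Hs m.
have hd (d : R) z : 0 < d -> nm (s h z) <= d * nm z.
  move=> d0; have [K [HK KQ Kd]] := small_multiplier hJ Ex (esym Qx) d0.
  have /existsNP[n /not_implyP[Kn]] := KQ.
  rewrite QE => /existsNP[y0 /= ny0].
  have on m y : K m -> nm (s h (s m y)) <= d * nm (s m y).
    move=> Km; pose m_ j := iter j (fun m => h ** m) m.
    have m_S j z' : s (m_ j.+1) z' = s h (s (m_ j) z') by rewrite /m_ iterS (repM Hs).
    have KM j : K (m_ j) by elim: j => // j IHj; exact: (cniMl HK).
    have opM j : opn (m_ j) <= d ^+ j * opn m.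
      elim: j => [|j IHj]; first by rewrite expr0 mul1r.
      by apply: le_trans (Kd _ (KM j)) _; rewrite exprS -mulrA ler_pM2l.
    have := @log_convex_ratio R (fun j => nm (s (m_ j) y)) (opn m * nm y) d d0.
    rewrite m_S; apply=> j; first exact: nm_ge0.
    (* Moving one self-adjoint [h] across makes the square at j + 1 the inner product of the vectors
       at j and j + 2, to which Cauchy-Schwarz applies. *)
    - rewrite -bnm m_S (rep_adj Hs) hsa -!m_S.
      by apply: le_trans (ler_norm _) _; exact: (inner_nm_le (conj Hb bnm)).
    - by apply: le_trans (sC _ _) _; rewrite mulrA ler_wpM2r ?nm_ge0.
  pose D := [set s m y0 | m in K].
  have Dsub : closed_linear_subspace (closure D).
    apply: closure_subspace.
      by exists 0; [exact: (cni0 HK)|exact: (rep0 Hs)].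
    move=> c _ _ [m1 Km1 <-] [m2 Km2 <-]; exists (c *: m1 + m2).
      exact: (cniZD HK).
    by rewrite (repD Hs) (repZ Hs).
  have Dinv m y : closure D y -> closure D (s m y).
    have [_ sD sN _] := linear_scaleD (rep_linear Hs m).
    move=> /closure_nmP yD; apply/closure_nmP => e e0.
    have m1 : 0 < opn m + 1 by rewrite ltr_wpDl ?opn_ge0.
    have [|_ [k Kk <-] yk] := yD (e / (opn m + 1)); first by rewrite divr_gt0.
    exists (s m (s k y0)); first by exists (m ** k); [exact: (cniMl HK)|exact: (repM Hs)].
    rewrite -sN -sD; apply: le_lt_trans (sC m _) _.
    move: yk; rewrite ltr_pdivlMr// => yk; apply: le_lt_trans yk.
    by rewrite mulrC ler_wpM2l ?nm_ge0// lerDl.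
  have [_ irr] := Hirr; have [D0|DT] := irr _ Dsub Dinv.
    exfalso; apply: ny0; suff : closure D (s n y0) by rewrite D0.
    by apply: subset_closure; exists n.
  have /closure_nmP zD : closure D z by rewrite DT.
  have [_ sD sN _] := linear_scaleD (rep_linear Hs h).
  rewrite -subr_le0; apply: (@le0_small _ _ (opn h + d)).
    by rewrite addr_ge0 ?opn_ge0 ?ltW.
  move=> e /zD[_ [m Km <-] zm].
  have := on m y0 Km; have := sC h (z - s m y0); rewrite sD sN => hz.
  have := nm_triangle (s h (s m y0)) (s h z) 0.
  have := nm_triangle z (s m y0) 0; rewrite !subr0 [nm (s m y0 - z)]nmBC => t1 t2 t3.
  have : opn h * nm (z - s m y0) <= opn h * e by rewrite ler_wpM2l ?opn_ge0// ltW.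
  have : d * nm (s m y0) <= d * (nm (z - s m y0) + nm z) by rewrite ler_pM2l.
  have : d * nm (z - s m y0) <= d * e by rewrite ler_pM2l// ltW.
  by lra.
have h0 z : s h z = 0.
  apply: nm0_eq0; apply/eqP; rewrite eq_le nm_ge0 andbT.
  by apply: (le0_small (nm_ge0 z)) => d d0; rewrite mulrC; exact: hd.
rewrite QE => z /=; apply: nm0_eq0; apply/eqP; rewrite -sqrf_eq0; apply/eqP.
rewrite -bnm (rep_adj Hs) -(repM Hs) -hE h0.
by rewrite -(scale0r z) -[0]/(0%:C) (siZrr Hb) mul0r.
Qed.

End Saturation.

Theorem theorem5p3 (R : realType) (A : cstarAlgType R) (X : topologicalType)
    (phi : Prim A -> X) (phibar : Prim (multiplier A) -> stone_cech R X)
    (E : set X) :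
  hausdorff_space X -> locally_compact [set: X] -> continuous phi ->
  extends_base_map phi phibar ->
  sigma_unital A ->
  is_complete_regularization R phi ->
  (Orc A < +oo)%E ->
  E !=set0 -> closed_in (range phi) E ->
  locally_modular phi E ->
  locally_closed_at phi E /\ strictly_closed (H_ideal phibar E).
Proof.
move=> Xh Xlc phic ext su cr orc _ EF lm.
have lc : locally_closed_at phi E by exact: locally_modular_locally_closed su _ _ _ _.
split=> //; have [u Hu] := sigma_unital_approximate su.
have -> : H_ideal phibar E = tilde (J_ideal phi E).
  apply/seteqP; split; first exact: (H_ideal_sub_tilde Hu).
  apply: (tilde_sub_H_ideal Hu Xh Xlc phic ext) => //.
  by have [F _ ->] := EF => x [].
apply: strictly_closed_tilde; apply/closed_nmP.
exact: (cni_closed (ker_ideal (cstar_norm_nm A) _)).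
Qed.
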